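(* Let $N\ge1$ be an integer, $\alpha>0$, $0<l<N\alpha$. Let $\varphi\in L^q_\gamma(\mathbb R^N)$, where $$\gamma=\frac l\alpha<N,\qquad q>\frac{N\alpha}2,\qquad \frac N{N-\gamma}<q\le\infty .$$ Then the existence time $T_{\max}(\lambda\varphi)$ of the maximal solution of $$u(t)=e^{t\Delta}u_0+\int_0^te^{(t-\sigma)\Delta}\left(|\cdot|^l|u(\sigma)|^\alpha u(\sigma)\right)d\sigma,\qquad u_0=\lambda\varphi,$$ satisfies $$T_{\max}(\lambda\varphi)\ \ge\ C\left(\lambda\|\varphi\|_{L^q_\gamma}\right)^{-\left(\frac1\alpha-\frac N{2q}\right)^{-1}}\qquad\text{for all }\lambda>0,$$ where $C=C(\alpha,q,l,N)>0$.
   Context: The integral equation is the mild formulation of the Hénon parabolic equation $\partial_tu=\Delta u+|\cdot|^l|u|^\alpha u$ on $\mathbb R^N$, with $e^{t\Delta}$ the heat semigroup on $\mathbb R^N$. $L^q_\gamma(\mathbb R^N)$ is the space of measurable $f:\mathbb R^N\to\mathbb R$ with $|\cdot|^\gamma f\in L^q(\mathbb R^N)$, normed by $\|f\|_{L^q_\gamma}=\||\cdot|^\gamma f\|_{L^q(\mathbb R^N)}$; $1/\infty=0$. Under the stated conditions the equation is locally well-posed in $L^q_\gamma(\mathbb R^N)$: fixing $r>q$ with $\frac1{q(\alpha+1)}<\frac1r<\frac{N-\gamma}{N(\alpha+1)}$ ($r=\infty$ if $q=\infty$), there is a unique solution in $C([0,T];L^q_\gamma)$ for which $t^{\frac N2(\frac1q-\frac1r)}\|u(t)\|_{L^r_\gamma}$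 is bounded on $(0,T]$ (if $q=\infty$, $[0,T]$ is replaced by $(0,T]$ and $\lim_{t\to0}\|u(t)-e^{t\Delta}u_0\|_{L^\infty_\gamma}=0$); it extends to a maximal interval $[0,T_{\max}(u_0))$, and either $T_{\max}(u_0)=\infty$ or $\|u(t)\|_{L^q_\gamma}\to\infty$ as $t\to T_{\max}(u_0)$. *)

(* Defs.v *)
From HB Require Import structures.
From mathcomp Require Import all_boot all_order all_algebra.
From mathcomp Require Import all_classical all_reals all_analysis.

Set Implicit Arguments.
Unset Strict Implicit.
Unset Printing Implicit Defensive.
Import Order.TTheory GRing.Theory Num.Theory.
Import numFieldNormedType.Exports.
Local Open Scope classical_set_scope.
Local Open Scope ring_scope.

(* Tuples carry the product sigma-algebra, here the Borel sets of R^N. *)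
Notation Rn R N := (N.-tuple (measurableTypeR R)).

(* pushforward, bundled as a measure *)
Definition measure_image d1 d2 (T1 : measurableType d1) (T2 : measurableType d2)
    (R : realType) (m : {measure set T1 -> \bar R}) (f : T1 -> T2)
    (mf : measurable_fun [set: T1] f) : {measure set T2 -> \bar R}.
Proof.
by unshelve refine (pushforward m f : {measure set T2 -> \bar R}); exact: mf.
Defined.

Section Euclidean_space.
Context {R : realType}.

Definition cons_coord N (p : Rn R N * measurableTypeR R) : Rn R N.+1 :=
  [tuple of p.2 :: p.1].

Lemma measurable_cons_coord N : measurable_fun [set: _] (@cons_coord N).
Proof. exact: measurable_cons. Qed.

Fixpoint lebesgue_Rn (N : nat) : {measure set (Rn R N) -> \bar R} :=
  match N with
  | 0 => \d_ [tuple]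
  | N'.+1 => measure_image (lebesgue_Rn N' \x (@lebesgue_measure R))%E
               (@measurable_cons_coord N')
  end.

Lemma lebesgue_Rn_box N (A : 'I_N -> set (measurableTypeR R)) :
  (forall i, measurable (A i)) ->
  lebesgue_Rn N [set x : Rn R N | forall i, A i (tnth x i)] =
  (\prod_(i < N) @lebesgue_measure R (A i))%E.
Proof.
elim: N A => [|N IHN] A mA.
  by rewrite big_ord0 /= diracE mem_set // => -[].
have mB : measurable [set x : Rn R N | forall i, A (lift ord0 i) (tnth x i)].
  rewrite (_ : mkset _ = \bigcap_(i in [set: 'I_N])
      ((fun x : Rn R N => tnth x i) @^-1` A (lift ord0 i))); last first.
    by apply/seteqP; split => x /= Hx i; [move=> _; exact: Hx|exact: (Hx i I)].
  apply: fin_bigcap_measurable => // i _.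
  by rewrite -[X in measurable X]setTI; exact: measurable_tnth.
rewrite big_ord_recl -IHN// muleC -product_measure1E//=.
rewrite /pushforward; congr (_ _).
apply/seteqP; split => -[x y] /=.
  move=> H; split; last exact: (H ord0).
  by move=> i; have := H (lift ord0 i); rewrite tnthS.
by move=> [Hx Hy] i; case: (unliftP ord0 i) => [j ->|->//]; rewrite tnthS.
Qed.

Definition enorm N (x : Rn R N) : R := Num.sqrt (\sum_(i < N) tnth x i ^+ 2).

Definition rnsub N (x y : Rn R N) : Rn R N :=
  [tuple (tnth x i : R) - tnth y i | i < N].

(* 1/q, with 1/oo = 0 *)
Definition rinv (q : \bar R) : R := fine (q^-1)%E.

Definition wnorm N (q : \bar R) (gamma : R) (f : Rn R N -> R) : \bar R :=
  Lnorm (lebesgue_Rn N) q (fun x => (enorm x `^ gamma * f x)%:E).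

Definition in_wLq N (q : \bar R) (gamma : R) (f : Rn R N -> R) : Prop :=
  measurable_fun [set: Rn R N] f /\ (wnorm q gamma f < +oo)%E.

Definition heat_kernel N (t : R) (x : Rn R N) : R :=
  (4 * pi * t) `^ (- (N%:R / 2)) * expR (- (enorm x ^+ 2 / (4 * t))).

Definition heat N (t : R) (f : Rn R N -> R) : Rn R N -> R :=
  if t == 0 then f
  else fun x => \int[lebesgue_Rn N]_y (heat_kernel t (rnsub x y) * f y).

Definition henon N (alpha l : R) (v : Rn R N -> R) : Rn R N -> R :=
  fun x => enorm x `^ l * `|v x| `^ alpha * v x.

(* The exponents r of the norms t^(N/2 (1/q - 1/r)) |u(t)|_{L^r_gamma} that
   select the solution class; r < oo when q < oo, as 0 < 1/r then. *)
Definition admissible (N : nat) (alpha gamma : R) (q r : \bar R) : Prop :=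
  if q == +oo%E then r = +oo%E
  else [/\ (q < r)%E, rinv q / (alpha + 1) < rinv r
         & rinv r < (N%:R - gamma) / (N%:R * (alpha + 1))].

Definition time_itv (q : \bar R) (T : R) : set R :=
  if q == +oo%E then `]0, T]%classic else `[0, T]%classic.

(* Functions of L^q_gamma are represented by pointwise defined ones, so the
   equation holds almost everywhere in x for every t, and the time integral is
   taken pointwise in x. The library's integral is total, hence the explicit
   integrability; in the space integral defining heat it follows from sol_mem
   and sol_bound. *)
Record mild_solution N (alpha l gamma : R) (q r : \bar R) (u0 : Rn R N -> R)
    (T : R) (u : R -> Rn R N -> R) : Prop := MildSolution {
  sol_mem : forall t, time_itv q T t -> in_wLq q gamma (u t);
  sol_continuous : forall t, time_itv q T t ->
    wnorm q gamma (fun x => u s x - u t x)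
      @[s --> within (time_itv q T) (nbhs t)] --> 0%E;
  sol_bound : exists M : R, forall t, 0 < t -> t <= T ->
    ((t `^ (N%:R / 2 * (rinv q - rinv r)))%:E * wnorm r gamma (u t) <= M%:E)%E;
  sol_initial : q = +oo%E ->
    wnorm q gamma (fun x => u t x - heat t u0 x) @[t --> 0^'+] --> 0%E;
  sol_equation : forall t, time_itv q T t ->
    {ae lebesgue_Rn N, forall x,
      (@lebesgue_measure R).-integrable `[0, t]
        (fun s => (heat (t - s) (henon alpha l (u s)) x)%:E) /\
      u t x = heat t u0 x +
        \int[@lebesgue_measure R]_(s in `[0, t])
          heat (t - s) (henon alpha l (u s)) x}
}.

(* End point of the maximal existence interval. It is -oo, not 0, if there is
   no local solution. *)
Definition Tmax N (alpha l gamma : R) (q r : \bar R) (u0 : Rn R N -> R)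
    : \bar R :=
  ereal_sup [set T%:E | T in [set T : R |
    0 < T /\ exists u, mild_solution alpha l gamma q r u0 T u]].

End Euclidean_space.

(* Main.v *)
(* The norm in which the iteration is run is that of L^rho_gamma, rho = q (alpha + 1): as
   l = gamma alpha, the nonlinearity maps it to L^q_gamma with
   | |.|^l |v|^(alpha + 1) |_(L^q_gamma) = |v|_(L^rho_gamma)^(alpha + 1).
   Let b = N alpha / (2 q) < 1. The operator W |-> e^(t Delta) |u_0| + Duhamel(|.|^l W^(alpha + 1))
   is monotone on [0, oo]-valued functions and, when c |u_0|^alpha T^(1 - b) <= 1, preserves the
   bound |W(t)|_(L^rho_gamma) <= M t^(- b / (alpha + 1)) on (0, T]; iterating it from 0 gives a
   majorant W. A second monotone iteration, for V = u + W, gives a solution u with |u| <= W of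
   the signed equation, pointwise wherever W is finite. Since the first iteration only involves
   rho, the constant c does not depend on the exponent r of the solution class, and the
   L^r_gamma bounds follow from |u| <= W. Continuity at t > 0 comes from the Hoelder continuity in
   time of the heat kernel, and at t = 0 (q < oo) from the L^1 convergence of the kernel to the
   identity, which is reduced to dimension one by the product structure of the kernel.
   Finally c |lambda phi|^alpha T^(1 - b) <= 1 reads
   T <= C |lambda phi|^(- 1 / (1 / alpha - N / (2 q))). *)

(* Monotone iteration stands in for a contraction argument. Integrals of [0, oo]-valued functions
   are total and commute with increasing limits, and such limits stay measurable; no complete space
   of curves has to be built, and both fixed-point equations hold at every point of space-time. The
   obstacle is the sign of the nonlinearity, which the shift by W removes. The exponent rho is the
   one at which the iteration closes. The rate s^(- b / (alpha + 1)) becomes s^(- b) under the power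
   alpha + 1, which is integrable since b < 1, that is q > N alpha / 2; the Duhamel integral then
   returns t^(- b / (alpha + 1)) times t^(1 - b), and the last factor is made small by the choice of
   T. As 1 / rho is the excluded lower end point of the range of 1 / r, the bounds of the solution
   class need one more reading of the equation. The condition q > N / (N - gamma) makes |y|^(-
   gamma) locally of class L^q', q' the conjugate exponent; this is what lets the heat semigroup act
   on L^q_gamma. As [Tmax] is a supremum of existence times, a lower bound for it only asks for one
   solution on each interval in question. *)
Require Import Defs.
From HB Require Import structures.
From mathcomp Require Import all_boot all_order all_algebra.
From mathcomp Require Import all_classical all_reals all_analysis.
From mathcomp Require Import measurable_realfun ess_sup_inf ring lra.
Set Implicit Arguments.
Unset Strict Implicit.
Unset Printing Implicit Defensive.
Import Order.TTheory GRing.Theory Num.Theory.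
Import numFieldNormedType.Exports.
Local Open Scope classical_set_scope.
Local Open Scope ring_scope.

(** * Lebesgue measure on R^N *)

Section lebesgue_measure_Rn.
Context {R : realType}.
Implicit Types N : nat.

Lemma measurable_box N (A : 'I_N -> set (measurableTypeR R)) :
  (forall i, measurable (A i)) ->
  measurable [set x : Rn R N | forall i, A i (tnth x i)].
Proof.
move=> mA.
rewrite (_ : mkset _ = \bigcap_(i in [set: 'I_N])
    ((fun x : Rn R N => tnth x i) @^-1` A i)); last first.
  by apply/seteqP; split => x /= Hx i; [move=> _; exact: Hx|exact: (Hx i I)].
apply: fin_bigcap_measurable => // i _.
by rewrite -[X in measurable X]setTI; exact: measurable_tnth.
Qed.

Lemma lebesgue_Rn_sigma_finite N : sigma_finite [set: Rn R N] (lebesgue_Rn N).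
Proof.
exists (fun k => [set x : Rn R N | forall i, `[- k%:R, k%:R]%classic (tnth x i)]).
  apply/seteqP; split => // x _.
  pose s := \sum_(i < N) `|tnth x i : R|.
  exists (Num.truncn s).+1 => // i /=.
  rewrite in_itv/= -ler_norml (@le_trans _ _ s)//.
    by rewrite /s (bigD1 i)//= lerDl sumr_ge0.
  exact/ltW/truncnS_gt.
move=> k; split; first by apply: (@measurable_box N (fun=> `[- k%:R, k%:R]%classic)) => i; exact: measurable_itv.
rewrite (@lebesgue_Rn_box R N (fun=> `[- k%:R, k%:R]%classic)); last first.
  by move=> i; exact: measurable_itv.
set u := (X in (X < _)%E); suff /andP[] : (0 <= u < +oo)%E by [].
rewrite /u; elim/big_ind: _ => [||i _].
- by rewrite lee01 ltry.
- by move=> x y /andP[x0 xy] /andP[y0 yy]; rewrite mule_ge0//= lte_mul_pinfty// ge0_fin_numE.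
- rewrite measure_ge0/= lebesgue_measure_itv/=; case: ifPn => // _.
  by rewrite -EFinB ltry.
Qed.
End lebesgue_measure_Rn.

(* An alias of lebesgue_Rn, whose head is a fixpoint, to which the
   sigma-finite instance can be attached. *)
Definition leb (R : realType) N : set (Rn R N) -> \bar R := lebesgue_Rn N.

Section leb_measure.
Context {R : realType} (N : nat).
Let leb0 : @leb R N set0 = 0%E := measure0 (lebesgue_Rn N).
Let leb_ge0 A : (0 <= @leb R N A)%E := measure_ge0 (lebesgue_Rn N) A.
Let leb_sigma_additive : semi_sigma_additive (@leb R N) :=
  @measure_semi_sigma_additive _ _ _ (lebesgue_Rn N).
HB.instance Definition _ := isMeasure.Build _ _ _ (@leb R N)
  leb0 leb_ge0 leb_sigma_additive.
HB.instance Definition _ := @Measure_isSigmaFinite.Build _ _ R (@leb R N)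
  (@lebesgue_Rn_sigma_finite R N).
End leb_measure.

Section leb_theory.
Context {R : realType}.
Implicit Types N : nat.
Local Notation leb1 := (@lebesgue_measure R).
Local Open Scope ereal_scope.

Lemma Lnorm_leb N p (f : Rn R N -> \bar R) :
  Lnorm (lebesgue_Rn N) p f = Lnorm (@leb R N) p f.
Proof. by rewrite unlock. Qed.

Lemma ge0_integral_leb0 (f : Rn R 0 -> \bar R) :
  measurable_fun [set: Rn R 0] f ->
  \int[@leb R 0]_x f x = f [tuple].
Proof. by move=> mf; rewrite [LHS]integral_dirac// diracT mul1e. Qed.

Lemma ge0_integral_lebS N (f : Rn R N.+1 -> \bar R) :
  measurable_fun [set: Rn R N.+1] f -> (forall x, 0 <= f x) ->
  \int[@leb R N.+1]_x f x =
  \int[@leb R N]_x \int[leb1]_y f (cons_coord (x, y)).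
Proof.
move=> mf f0.
have mc := @measurable_cons_coord R N.
(* At a successor, [leb] is convertible to the pushforward of a product measure; the coordinate
   split off is the head of the tuple. *)
transitivity (\int[pushforward (@leb R N \x leb1) (@cons_coord R N)]_x f x).
  by [].
rewrite ge0_integral_pushforward//= preimage_setT.
rewrite (@fubini_tonelli1 _ _ _ _ _ (@leb R N) leb1 (f \o @cons_coord R N))//.
  exact: measurableT_comp.
by move=> x; exact: f0.
Qed.

(** Reduces to dimension one both the mass of the Gaussian and the radial singularity |y|^(- c). *)
Lemma ge0_integral_leb_prod N (f : 'I_N -> measurableTypeR R -> R) :
  (forall i, measurable_fun setT (f i)) -> (forall i x, (0 <= f i x)%R) ->
  \int[@leb R N]_x (\prod_(i < N) f i (tnth x i))%:E =
  \prod_(i < N) \int[leb1]_x (f i x)%:E.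
Proof.
move=> mf f0; elim: N => [|N IH] in f mf f0 *.
  under eq_integral do rewrite big_ord0.
  by rewrite ge0_integral_leb0 ?big_ord0//; exact: measurable_cst.
have mprod k (g : 'I_k -> measurableTypeR R -> R) :
  (forall i, measurable_fun setT (g i)) ->
  measurable_fun [set: Rn R k] (fun x => \prod_(i < k) g i (tnth x i))%R.
  move=> mg; apply: measurable_prod => i _.
  apply: measurableT_comp => //; exact: measurable_tnth.
rewrite ge0_integral_lebS; last 2 first.
  by apply/measurable_EFinP; exact: mprod.
  by move=> x; rewrite lee_fin prodr_ge0.
have prod_cons (x : Rn R N) (y : R) :
    (\prod_(i < N.+1) f i (tnth (cons_coord (x, y)) i) =
     (\prod_(i < N) f (lift ord0 i) (tnth x i)) * f ord0 y)%R.
  rewrite big_ord_recl mulrC; congr (_ * _)%R.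
  by apply: eq_bigr => i _; rewrite tnthS.
under eq_integral => x _.
  under eq_integral => y _ do rewrite prod_cons EFinM.
  rewrite ge0_integralZl//; last 3 first.
  - by apply/measurable_EFinP; exact: mf.
  - by move=> y _; rewrite lee_fin.
  - by rewrite lee_fin prodr_ge0.
  over.
rewrite ge0_integralZr//; last 3 first.
- by apply/measurable_EFinP; apply: (mprod _ (fun i => f (lift ord0 i))).
- by move=> x _; rewrite lee_fin prodr_ge0.
- by apply: integral_ge0 => y _; rewrite lee_fin.
by rewrite big_ord_recl muleC (IH (fun i => f (lift ord0 i))).
Qed.

End leb_theory.

(** * Weighted power means and Minkowski's integral inequality *)

Section weighted_power_mean.
Context {R : realType}.
Local Open Scope ereal_scope.

(** The tangent inequality x^p >= m^p + p m^(p - 1) (x - m), solved for x. In this form it extends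
    to x = +oo and integrates without subtraction. *)
Lemma powR_tangent (p m x : R) : (1 <= p -> 0 < m -> 0 <= x ->
  x <= m `^ (1 - p) / p * x `^ p + (1 - p^-1) * m)%R.
Proof.
move=> p1 m0 x0; have p0 : (0 < p)%R by rewrite (lt_le_trans ltr01).
have [->|pN1] := eqVneq p 1%R.
  by rewrite subrr powRr0 invr1 mulr1 powRr1// subrr mul0r addr0 mul1r.
have p_gt1 : (1 < p)%R by rewrite lt_neqAle eq_sym pN1.
have c0 : (0 < 1 - p^-1)%R by rewrite subr_gt0 invf_lt1.
(* Young's inequality for x / m and 1, with exponent p and its conjugate (1 - 1/p)^-1. *)
have := @conjugate_powR R (x / m)%R 1%R p ((1 - p^-1)^-1)%R.
rewrite divr_ge0 ?(ltW m0)// => /(_ isT ler01 p0).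
rewrite invr_gt0 c0 invrK addrC subrK powR1 mul1r mulr1 => /(_ isT erefl).
rewrite ler_pdivrMr// => /le_trans; apply.
rewrite mulrDl lerD2r powRM ?invr_ge0 ?(ltW m0)//.
rewrite -(powR_inv1 (ltW m0)) -powRrM mulN1r.
rewrite powRB ?(gt_eqF m0) ?implybT// powRr1 ?(ltW m0)// powRN.
by rewrite le_eqVlt; apply/orP; left; apply/eqP; field;
  rewrite ?gt_eqF ?powR_gt0.
Qed.

Lemma le_poweR_tangent (p m : R) (x : \bar R) : (1 <= p)%R -> (0 < m)%R -> 0 <= x ->
  x <= (m `^ (1 - p) / p)%:E * x `^ p + ((1 - p^-1) * m)%:E.
Proof.
move=> p1 m0; have p0 : (0 < p)%R by rewrite (lt_le_trans ltr01).
case: x => [x||//] x0; first by rewrite -EFinM -EFinD lee_fin powR_tangent.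
by rewrite /= gt_eqF// gt0_muley ?lte_fin ?divr_gt0 ?powR_gt0.
Qed.

Context d (T : measurableType d) (mu : {measure set T -> \bar R}).
Implicit Types (k : T -> R) (f : T -> \bar R).

Lemma measurable_poweR_comp f p : measurable_fun setT f ->
  measurable_fun setT (fun x => f x `^ p).
Proof. exact: (measurableT_comp (measurable_poweR p)). Qed.

(* The tangent at B of the convex function x |-> x ^ p is integrated. *)
Lemma integral_weight_le k f (p K B : R) : (1 <= p)%R -> (0 < B)%R ->
  measurable_fun setT k -> (forall x, (0 <= k x)%R) ->
  measurable_fun setT f -> (forall x, 0 <= f x) ->
  \int[mu]_x (k x)%:E <= K%:E ->
  \int[mu]_x ((k x)%:E * f x `^ p) <= (K * B `^ p)%:E ->
  \int[mu]_x ((k x)%:E * f x) <= (K * B)%:E.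
Proof.
move=> p1 B0 mk k0 mf f0 Kk Kf; have p0 : (0 < p)%R by rewrite (lt_le_trans ltr01).
have mkE : measurable_fun setT (EFin \o k) by apply/measurable_EFinP.
have mfp : measurable_fun setT (fun x => (k x)%:E * f x `^ p).
  by apply: emeasurable_funM => //; exact: measurable_poweR_comp.
have c0 : (0 <= (1 - p^-1) * B)%R.
  by rewrite mulr_ge0 ?(ltW B0)// subr_ge0 invf_le1.
have b0 : (0 <= B `^ (1 - p) / p)%R by rewrite divr_ge0 ?powR_ge0// ltW.
apply: (@le_trans _ _ (\int[mu]_x ((B `^ (1 - p) / p)%:E * ((k x)%:E * f x `^ p)
   + ((1 - p^-1) * B)%:E * (k x)%:E))).
  apply: ge0_le_integral => //.
  - by move=> x _; rewrite mule_ge0 ?lee_fin.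
  - by apply: emeasurable_funM.
  - apply: emeasurable_funD; apply: emeasurable_funM => //; exact: measurable_cst.
  - move=> x _; rewrite muleCA [X in _ <= _ + X]muleC -ge0_muleDr//.
    + by rewrite lee_wpmul2l ?lee_fin// le_poweR_tangent.
    + by rewrite mule_ge0 ?lee_fin// poweR_ge0.
rewrite ge0_integralD//; last 4 first.
- by move=> x _; rewrite !mule_ge0 ?lee_fin// poweR_ge0.
- by apply: emeasurable_funM => //; exact: measurable_cst.
- by move=> x _; rewrite !mule_ge0 ?lee_fin.
- by apply: emeasurable_funM => //; exact: measurable_cst.
rewrite !ge0_integralZl//; last 2 first.
- by move=> x _; rewrite lee_fin.
- by move=> x _; rewrite !mule_ge0 ?lee_fin// poweR_ge0.
apply: (@le_trans _ _ ((B `^ (1 - p) / p)%:E * (K * B `^ p)%:E + ((1 - p^-1) * B)%:E * K%:E)).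
  by rewrite leeD// lee_wpmul2l ?lee_fin.
rewrite -!EFinM -EFinD lee_fin.
rewrite powRB ?(gt_eqF B0) ?implybT// powRr1 ?(ltW B0)//.
by rewrite le_eqVlt; apply/orP; left; apply/eqP; field; rewrite ?gt_eqF ?powR_gt0.
Qed.

(** Jensen's inequality for a measure of mass at most K. With I the integral on the right and J that
    on the left, the preceding lemma gives J <= K B for every B with I <= K B^p; the best choice is
    B = (I / K)^(1 / p), and if I = 0 arbitrarily small B are used. It serves below wherever
    Hölder's inequality would be expected. *)
Lemma integral_weight_powR k f (p K : R) : (1 <= p)%R -> (0 < K)%R ->
  measurable_fun setT k -> (forall x, (0 <= k x)%R) ->
  measurable_fun setT f -> (forall x, 0 <= f x) ->
  \int[mu]_x (k x)%:E <= K%:E ->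
  (\int[mu]_x ((k x)%:E * f x)) `^ p <=
  (K `^ (p - 1))%:E * \int[mu]_x ((k x)%:E * f x `^ p).
Proof.
move=> p1 K0 mk k0 mf f0 Kk; have p0 : (0 < p)%R by rewrite (lt_le_trans ltr01).
set I := \int[mu]_x (_ * _ `^ _).
have : 0 <= I by apply: integral_ge0 => x _; rewrite mule_ge0 ?lee_fin ?poweR_ge0.
set J := \int[mu]_x _.
have J0 : 0 <= J by apply: integral_ge0 => x _; rewrite mule_ge0 ?lee_fin.
have H B : (0 < B)%R -> I <= (K * B `^ p)%:E -> J <= (K * B)%:E.
  by move=> B0; exact: integral_weight_le.
case: I H => [i||//] H I0; last first.
  by rewrite gt0_muley ?leey// lte_fin powR_gt0.
move: I0; rewrite lee_fin le_eqVlt => /predU1P[i0|i0].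
- have -> : J = 0.
    apply/eqP; rewrite eq_le J0 andbT; apply/lee_addgt0Pr => e e0.
    rewrite add0e (_ : e = K * (e / K))%R; last by field; rewrite gt_eqF.
    apply: H; first by rewrite divr_gt0.
    by rewrite -i0 lee_fin mulr_ge0 ?powR_ge0// ltW.
  by rewrite poweR0r ?gt_eqF// -EFinM lee_fin -i0 mulr0.
- have B0 : (0 < (i / K) `^ p^-1)%R by rewrite powR_gt0// divr_gt0.
  have := H _ B0; rewrite -powRrM mulVf ?gt_eqF// powRr1 ?divr_ge0 ?(ltW i0) ?(ltW K0)//.
  rewrite mulrCA divff ?gt_eqF// mulr1 lexx => /(_ isT) HJ.
  apply: (@le_trans _ _ ((K * (i / K) `^ p^-1)%:E `^ p)).
    apply: gt0_ler_poweR => //; rewrite ?in_itv/= ?andbT ?leey ?J0//; first exact: ltW.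
    by rewrite lee_fin mulr_ge0 // ltW.
  rewrite poweR_EFin -EFinM lee_fin powRM ?(ltW K0) ?(ltW B0)//.
  rewrite -powRrM mulVf ?gt_eqF// powRr1 ?divr_ge0 ?(ltW i0) ?(ltW K0)//.
  rewrite powRB ?(gt_eqF K0) ?implybT// powRr1 ?(ltW K0)//.
  by rewrite le_eqVlt; apply/orP; left; apply/eqP; field; rewrite gt_eqF.
Qed.

End weighted_power_mean.

(** * Lebesgue norms of extended real functions *)

Section Lnorm_bounds.
Context {R : realType} d (T : measurableType d) (mu : {measure set T -> \bar R}).
Local Open Scope ereal_scope.
Implicit Types (f g : T -> \bar R).

Lemma poweR_le_swap (p : R) (x y : \bar R) : (0 < p)%R -> 0 <= x -> 0 <= y ->
  (x `^ p <= y `^ p) = (x <= y).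
Proof.
move=> p0 x0 y0; apply/idP/idP => [|xy]; last first.
  by apply: gt0_ler_poweR => //; rewrite ?in_itv/= ?leey ?x0 ?y0// ltW.
move=> xpyp; have pV : (0 <= p^-1)%R by rewrite invr_ge0 ltW.
have : (x `^ p) `^ p^-1 <= (y `^ p) `^ p^-1.
  by apply: gt0_ler_poweR => //; rewrite ?in_itv/= ?leey ?poweR_ge0.
by rewrite -!poweRrM divff ?gt_eqF// !poweRe1.
Qed.

Lemma Lnorm_fin_leP f (p : R) (K : \bar R) : (0 < p)%R -> 0 <= K ->
  (Lnorm mu p%:E f <= K) = (\int[mu]_x `|f x| `^ p <= K `^ p).
Proof.
by move=> p0 K0; rewrite -(poweR_le_swap p0)// ?Lnorm_ge0// poweR_Lnorm// gt_eqF.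
Qed.

Lemma Lnorm_infty_leP f (K : \bar R) : 0 <= K ->
  Lnorm mu +oo f <= K <-> {ae mu, forall x, `|f x| <= K}.
Proof.
move=> K0; rewrite unlock /=; case: ifPn => [muT|]; first by split => /ess_supP.
(* If the whole space is null, the norm is 0 by definition and the whole space serves as exceptional
   set. *)
rewrite -leNgt => muT; split=> // _.
exists setT; split=> //; apply/eqP; rewrite eq_le muT/=; exact: measure_ge0.
Qed.

Lemma Lnorm_infty_ae f : {ae mu, forall x, `|f x| <= Lnorm mu +oo f}.
Proof. by apply/(Lnorm_infty_leP f (Lnorm_ge0 mu +oo f)). Qed.

Lemma le_Lnorm (p : \bar R) f g : 0 < p ->
  measurable_fun setT f -> measurable_fun setT g ->
  {ae mu, forall x, `|f x| <= `|g x|} -> Lnorm mu p f <= Lnorm mu p g.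
Proof.
case: p => [p||//] p0 mf mg fg.
  rewrite Lnorm_fin_leP ?Lnorm_ge0// poweR_Lnorm ?gt_eqF//.
  apply: ae_ge0_le_integral => //.
  - by move=> x _; exact: poweR_ge0.
  - by apply: measurable_poweR_comp; exact: measurableT_comp.
  - by move=> x _; exact: poweR_ge0.
  - by apply: measurable_poweR_comp; exact: measurableT_comp.
  - by apply: filterS fg => x fgx _; rewrite poweR_le_swap.
apply/Lnorm_infty_leP; first exact: Lnorm_ge0.
by apply: filterS2 fg (Lnorm_infty_ae g) => x; exact: le_trans.
Qed.

Lemma LnormZ_le (p : \bar R) f (k : R) : 0 < p -> (0 <= k)%R ->
  measurable_fun setT f ->
  Lnorm mu p (fun x => k%:E * f x) <= k%:E * Lnorm mu p f.
Proof.
move=> p0 k0 mf; have kN : 0 <= k%:E * Lnorm mu p f.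
  by rewrite mule_ge0 ?lee_fin// Lnorm_ge0.
case: p p0 kN => [p||//] p0 kN.
  rewrite Lnorm_fin_leP// poweRM ?lee_fin ?Lnorm_ge0// poweR_Lnorm ?gt_eqF//.
  rewrite poweR_EFin -ge0_integralZl_EFin//; last 3 first.
  - by move=> x _; exact: poweR_ge0.
  - by apply: measurable_poweR_comp; exact: measurableT_comp.
  - exact: powR_ge0.
  - apply: ge0_le_integral => //.
    + by move=> x _; exact: poweR_ge0.
    + by apply: measurable_poweR_comp; apply: measurableT_comp => //;
        exact: measurable_funeM.
    + apply: measurable_funeM; apply: measurable_poweR_comp.
      exact: measurableT_comp.
    + by move=> x _; rewrite abseM poweRM//= ger0_norm.
apply/Lnorm_infty_leP => //.
by apply: filterS (Lnorm_infty_ae f) => x fx; rewrite abseM/= ger0_norm// lee_wpmul2l.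
Qed.

(** The functions may take infinite values, where f + g is delicate. If both norms are finite, f and
    g are finite almost everywhere and can be replaced by their real parts [fine], to which
    Minkowski's inequality applies. *)
Lemma LnormD_le (p : \bar R) f g : 1 <= p ->
  measurable_fun setT f -> measurable_fun setT g ->
  Lnorm mu p (fun x => f x + g x) <= Lnorm mu p f + Lnorm mu p g.
Proof.
move=> p1 mf mg.
have p0 : 0 < p by rewrite (lt_le_trans _ p1)// lte_fin.
have [fy|] := eqVneq (Lnorm mu p f) +oo.
  by rewrite fy addye ?leey// -ltNye (lt_le_trans _ (Lnorm_ge0 _ _ _)).
rewrite -ltey => fy.
have [gy|] := eqVneq (Lnorm mu p g) +oo.
  by rewrite gy addey ?leey// -ltNye (lt_le_trans _ (Lnorm_ge0 _ _ _)).
rewrite -ltey => gy.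
have aefin (h : T -> \bar R) : measurable_fun setT h -> Lnorm mu p h < +oo ->
    {ae mu, forall x, h x \is a fin_num}.
  case: p p0 {p1 fy gy} => [p||//] p0 mh hy.
    have /integrable_ae : mu.-integrable setT (fun x => `|h x| `^ p).
      apply/integrableP; split.
        by apply: measurable_poweR_comp; exact: measurableT_comp.
      under eq_integral do rewrite gee0_abs ?poweR_ge0//.
      by rewrite -poweR_Lnorm ?gt_eqF// poweR_lty.
    move=> /(_ measurableT); apply: filterS => x /(_ I).
    by case: (h x) => //=; rewrite gt_eqF.
  apply: filterS (Lnorm_infty_ae h) => x /le_lt_trans/(_ hy).
  by case: (h x).
have -> : Lnorm mu p f + Lnorm mu p g =
    Lnorm mu p (EFin \o (fine \o f)) + Lnorm mu p (EFin \o (fine \o g)).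
  have eqN h : measurable_fun setT h -> Lnorm mu p h < +oo ->
      Lnorm mu p h = Lnorm mu p (EFin \o (fine \o h)).
    move=> mh hy; apply/eqP; rewrite eq_le.
    have mh' : measurable_fun setT (EFin \o (fine \o h)).
      by apply/measurable_EFinP; exact: measurableT_comp.
    by apply/andP; split; apply: le_Lnorm => //;
      apply: filterS (aefin _ mh hy) => x /fineK hx; rewrite /comp hx.
  by congr (_ + _); exact: eqN.
apply: (le_trans _ (eminkowski mu _ _ p1)); last 2 first.
- exact: measurableT_comp.
- exact: measurableT_comp.
apply: le_Lnorm => //.
- exact: emeasurable_funD.
- by apply/measurable_EFinP/measurable_funD; exact: measurableT_comp.
- apply: filterS2 (aefin _ mf fy) (aefin _ mg gy) => x /fineK fx /fineK gx.
  by rewrite /comp EFinD fx gx.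
Qed.

End Lnorm_bounds.

Section Minkowski_integral.
Context {R : realType} d1 d2 (S : measurableType d1) (T : measurableType d2).
Variables (nu : {sigma_finite_measure set S -> \bar R}).
Variables (mu : {sigma_finite_measure set T -> \bar R}).
Local Open Scope ereal_scope.

(** Minkowski's integral inequality, with the norms of the slices replaced by a measurable majorant
    kappa. For finite p, write g = kappa f and apply Jensen to the measure kappa ds, of mass at most
    K; Tonelli then leaves slices f (s, .) of norm at most 1. No duality enters. *)
Lemma Lnorm_integral_le (p : \bar R) (g : S * T -> \bar R) (kappa : S -> R) (K : R) :
  1 <= p -> measurable_fun [set: S * T] g -> (forall z, 0 <= g z) ->
  measurable_fun setT kappa -> (forall s, (0 <= kappa s)%R) ->
  (forall s, kappa s = 0%R -> forall x, g (s, x) = 0) ->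
  (forall s, Lnorm mu p (fun x => g (s, x)) <= (kappa s)%:E) ->
  (0 < K)%R -> \int[nu]_s (kappa s)%:E <= K%:E ->
  Lnorm mu p (fun x => \int[nu]_s g (s, x)) <= K%:E.
Proof.
move=> p1 mg g0 mk k0 kg gk K0 kK.
have mint : measurable_fun setT (fun x => \int[nu]_s g (s, x)).
  exact: (measurable_fun_fubini_tonelli_G (m1 := nu) _ mg g0).

have mgx x : measurable_fun setT (fun s => g (s, x)) by exact: measurable_fun_pair1.
have mgs s : measurable_fun setT (fun x => g (s, x)) by exact: measurable_fun_pair2.
have int0 x : 0 <= \int[nu]_s g (s, x) by exact: integral_ge0.
case: p p1 gk => [p||//] p1 gk; last first.
  (* The excess of g over kappa. It vanishes for every s at almost every x; Tonelli exchanges the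
     quantifiers, so that its integral in s vanishes for almost every x. *)
  pose h (z : S * T) := maxe (g z - (kappa z.1)%:E) 0.
  have mh : measurable_fun [set: S * T] h.
    apply: measurable_maxe; last exact: measurable_cst.
    apply: emeasurable_funB => //; apply/measurable_EFinP.
    exact: measurableT_comp.
  have h0 z : 0 <= h z by rewrite /h le_max lexx orbT.
  have : \int[mu]_x \int[nu]_s h (s, x) = 0.
    rewrite -(fubini_tonelli h mh h0); apply: integral0_eq => s _.
    have := Lnorm_infty_leP mu (fun x => g (s, x)) (K := (kappa s)%:E).
    rewrite lee_fin => /(_ (k0 s)) [/(_ (gk s)) gks _].
    transitivity (\int[mu]_x (cst 0 x)); last exact: integral0.
    apply: ge0_ae_eq_integral => //; first exact: measurable_fun_pair2.
    apply: filterS gks => x; rewrite gee0_abs// => gks _.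
    by apply/max_idPr; rewrite leeBlDr// add0e.
  have mhx : measurable_fun setT (fun x => \int[nu]_s h (s, x)).
    exact: (measurable_fun_fubini_tonelli_G (m1 := nu) _ mh h0).
  have h0x x : 0 <= \int[nu]_s h (s, x) by exact: integral_ge0.
  move=> H; apply/Lnorm_infty_leP; first by rewrite lee_fin ltW.
  have : \int[mu]_x `|\int[nu]_s h (s, x)| = 0.
    by rewrite -[RHS]H; apply: eq_integral => x _; rewrite gee0_abs.
  move=> /(ae_eq_integral_abs _ measurableT mhx); apply: filterS => x /(_ I) /= hx.
  rewrite gee0_abs// -[leRHS]adde0 -hx.
  apply: (@le_trans _ _ (\int[nu]_s ((kappa s)%:E + h (s, x)))).
    apply: ge0_le_integral => //.
    + apply: emeasurable_funD; first by apply/measurable_EFinP.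
      exact: measurable_fun_pair1.
    + move=> s _; rewrite /h /= -leeBlDl// le_max.
      by rewrite lexx.
  rewrite ge0_integralD//.
  - by rewrite leeD2r.
  - by move=> s _; rewrite lee_fin.
  - by apply/measurable_EFinP.
  - exact: measurable_fun_pair1.
have p0 : (0 < p)%R by rewrite (lt_le_trans ltr01).
rewrite Lnorm_fin_leP ?lee_fin ?(ltW K0)//.
under eq_integral do rewrite gee0_abs//.
(* Since 0^-1 = 0, this is 0 where kappa vanishes; g = kappa f still holds there because g is
   assumed to vanish with kappa. *)
pose f (z : S * T) := ((kappa z.1)^-1)%:E * g z.
have f0 z : 0 <= f z by rewrite mule_ge0// lee_fin invr_ge0.
have mf : measurable_fun [set: S * T] f.
  apply: emeasurable_funM => //; apply/measurable_EFinP.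
  under eq_fun do rewrite -(powR_inv1 (k0 _)).
  apply: (measurableT_comp (measurable_powR (- 1))).
  exact: measurableT_comp.
have gE s x : g (s, x) = (kappa s)%:E * f (s, x).
  have [k0s|k0s] := eqVneq (kappa s) 0%R; first by rewrite k0s mul0e kg.
  by rewrite /f /= muleA -EFinM divff// mul1e.
have mfx x : measurable_fun setT (fun s => f (s, x)) by exact: measurable_fun_pair1.
have mfs s : measurable_fun setT (fun x => f (s, x)) by exact: measurable_fun_pair2.
have mkf : measurable_fun [set: S * T] (fun z => (kappa z.1)%:E * f z `^ p).
  apply: emeasurable_funM; last exact: measurable_poweR_comp.
  by apply/measurable_EFinP; exact: measurableT_comp.
have kf0 z : 0 <= (kappa z.1)%:E * f z `^ p.
  by rewrite mule_ge0 ?lee_fin ?poweR_ge0.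
apply: (@le_trans _ _ (\int[mu]_x ((K `^ (p - 1))%:E *
    \int[nu]_s ((kappa s)%:E * f (s, x) `^ p)))).
  apply: ge0_le_integral => //.
  - by move=> x _; exact: poweR_ge0.
  - exact: measurable_poweR_comp.
  - apply: measurable_funeM.
    exact: (measurable_fun_fubini_tonelli_G (m1 := nu) _ mkf kf0).
  - move=> x _; under eq_integral do rewrite gE.
    exact: integral_weight_powR.
rewrite ge0_integralZl//; last 3 first.
- exact: (measurable_fun_fubini_tonelli_G (m1 := nu) _ mkf kf0).
- by move=> x _; apply: integral_ge0 => s _; exact: (kf0 (s, x)).
- by rewrite lee_fin powR_ge0.
have := fubini_tonelli (m1 := nu) (m2 := mu) _ mkf kf0; rewrite /= => <-.
apply: (@le_trans _ _ ((K `^ (p - 1))%:E * K%:E)); last first.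
  rewrite -EFinM lee_fin powRB ?(gt_eqF K0) ?implybT// powRr1 ?(ltW K0)//.
  by rewrite divfK ?gt_eqF.
rewrite lee_wpmul2l ?lee_fin ?powR_ge0//.
apply: le_trans kK; apply: ge0_le_integral => //.
- by move=> s _; apply: integral_ge0 => x _; exact: (kf0 (s, x)).
- exact: (measurable_fun_fubini_tonelli_F (m2 := mu) _ mkf kf0).
- by apply/measurable_EFinP.
move=> s _; rewrite ge0_integralZl//; last 3 first.
- exact: measurable_poweR_comp.
- by move=> x _; exact: poweR_ge0.
- by rewrite lee_fin.
have [->|k0s] := eqVneq (kappa s) 0%R; first by rewrite mul0e.
rewrite -[leRHS]mule1 lee_wpmul2l ?lee_fin//.
under eq_integral do rewrite /f /= poweRM ?lee_fin ?invr_ge0//.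
rewrite ge0_integralZl//; last 3 first.
- exact: measurable_poweR_comp.
- by move=> x _; exact: poweR_ge0.
- by rewrite lee_fin powR_ge0.
have := gk s; rewrite Lnorm_fin_leP ?lee_fin// => gks.
apply: (@le_trans _ _ (((kappa s)^-1 `^ p)%:E * ((kappa s) `^ p)%:E)).
  rewrite lee_wpmul2l ?lee_fin ?powR_ge0//; apply: le_trans gks.
  by under [in leRHS]eq_integral do rewrite gee0_abs//.
by rewrite -EFinM -powRM ?invr_ge0// mulVf// powR1.
Qed.

End Minkowski_integral.

(** * Beta integrals *)

Section power_integrals.
Context {R : realType}.
Local Notation leb1 := (@lebesgue_measure R).

Lemma ge0_integral_exhaust d (T : measurableType d)
    (mu : {measure set T -> \bar R}) (F : (set T)^nat) (f : T -> \bar R) (K : \bar R) :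
  nondecreasing_seq F -> (forall n, measurable (F n)) ->
  (forall n, measurable_fun (F n) f) -> (forall x, (0 <= f x)%E) ->
  (forall n, \int[mu]_(x in F n) f x <= K)%E ->
  (\int[mu]_(x in \bigcup_n F n) f x <= K)%E.
Proof.
move=> ndF mF mf f0 FK.
have := @ge0_nondecreasing_set_cvg_integral _ _ _ F f mu ndF mF mf
  (fun _ x _ => f0 x).
by move=> /cvg_lim <-//; apply: lime_le => //;
  [apply/cvg_ex; eexists; apply: ge0_nondecreasing_set_cvg_integral|exact: nearW].
Qed.

(** The fundamental theorem for integrands that may blow up at both ends: the open interval is
    exhausted by compact ones, on which the increments of the primitive are bounded by M. *)
Lemma ge0_integral_derive_le (f P : R -> R) (t M : R) : 0 < t -> 0 <= M ->
  measurable_fun setT f -> (forall s, 0 <= f s) ->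
  (forall s, 0 < s < t -> {for s, continuous f}) ->
  (forall s : R, 0 < s < t -> is_derive s 1 P (f s)) ->
  (forall x y, 0 < x < t -> 0 < y < t -> P y - P x <= M) ->
  (\int[leb1]_(s in `]0%R, t[) (f s)%:E <= M%:E)%E.
Proof.
move=> t0 M0 mf f0 cf dP PM.
pose F n : set R := `[t / n.+2%:R, t - t / n.+2%:R]%classic.
have mF n : measurable (F n) by exact: measurable_itv.
have tn n : 0 < t / n.+2%:R by rewrite divr_gt0.
have tnt n : t - t / n.+2%:R < t by rewrite ltrBlDr ltrDl.
have -> : `]0%R, t[%classic = \bigcup_n F n.
  apply/seteqP; split => s.
    rewrite /= in_itv/= => /andP[s0 st].
    have m0 : 0 < Num.min s (t - s) by rewrite lt_min s0 subr_gt0.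
    have [m tm] : exists m, t / m.+2%:R <= Num.min s (t - s).
      exists (Num.truncn (t / Num.min s (t - s))).
      rewrite ler_pdivrMr// mulrC -ler_pdivrMr//.
      apply: le_trans (ltW (truncnS_gt _)) _.
      by rewrite ler_nat.
    exists m => //; rewrite /F /= in_itv/=; move: tm; rewrite le_min => /andP[-> h].
    by rewrite lerBrDl -lerBrDr.
  move=> [n _]; rewrite /F /= !in_itv /= => /andP[h1 h2].
  by rewrite (lt_le_trans (tn n))//= (le_lt_trans h2).
have mfE D : measurable D -> measurable_fun D (fun s : R => (f s)%:E).
  by move=> mD; apply/measurable_EFinP/measurable_funTS.
apply: ge0_integral_exhaust => //.
- move=> m n mn; apply/subsetPset => s; rewrite /F /= !in_itv /= => /andP[h1 h2].
  have : t / n.+2%:R <= t / m.+2%:R.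
    by rewrite ler_pM2l// lef_pV2 ?posrE// ler_nat !ltnS.
  by move=> h; rewrite (le_trans h h1) (le_trans h2)// lerB.
- by move=> n; exact: mfE.
move=> n; have := tn n; have := tnt n; rewrite /F.
set a := t / n.+2%:R; set c := t - a => ct a0.
(* For n = 0 the compact interval degenerates to the point t / 2, which the fundamental theorem does
   not cover. *)
have [ac|ca] := ltP a c; last first.
  rewrite (_ : `[a, c]%classic = if a == c then [set a] else set0).
    by case: ifPn => _; rewrite ?integral_set1 ?integral_set0 lee_fin.
  case: ifPn => [/eqP <-|ac]; first by rewrite set_itv1.
  by rewrite set_itv_ge// bnd_simp -ltNge lt_neqAle eq_sym ac.
have in0t s : s \in `[a, c] -> 0 < s < t.
  by rewrite in_itv/= => /andP[h1 h2]; rewrite (lt_le_trans a0 h1) (le_lt_trans h2 ct).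
have cP (s : R) : s \in `[a, c] -> {for s, continuous P}.
  by move=> /in0t s0; apply/differentiable_continuous/derivable1_diffP; have [] := dP _ s0.
have aI : a \in `[a, c] by rewrite in_itv/= lexx ltW.
have cI : c \in `[a, c] by rewrite in_itv/= lexx ltW.
rewrite (@continuous_FTC2 _ _ P)//.
- by rewrite -EFinB lee_fin PM// in0t.
- by apply: continuous_in_subspaceT => s; rewrite inE/= => /in0t; exact: cf.
- split.
  + by move=> s /subset_itv_oo_cc /in0t s0; have [] := dP _ s0.
  + by apply: cvg_at_right_filter; exact: cP.
  + by apply: cvg_at_left_filter; exact: cP.
- move=> s /subset_itv_oo_cc /in0t s0.
  by rewrite derive1E; apply: derive_val; exact: dP.
Qed.

Lemma is_derive_powR_antiderivative (b s : R) : b < 1 -> 0 < s ->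
  is_derive s 1 (fun x : R => x `^ (1 - b) / (1 - b)) (s `^ (- b)).
Proof.
move=> b1 s0; have c0 : 0 < 1 - b by rewrite subr_gt0.
have -> : s `^ (- b) = (1 - b)^-1 *: ((1 - b) * s `^ (1 - b - 1)).
  rewrite [_ *: _]mulrA mulVf ?gt_eqF// mul1r; congr (_ `^ _); ring.
rewrite (_ : (fun _ => _) = (1 - b)^-1 \*: (fun x : R => x `^ (1 - b))); last first.
  by apply/funext => x; rewrite mulrC.
by apply: is_deriveZ; exact: is_derive1_powR.
Qed.

Let antiderivative_bound (b t x y : R) : b < 1 -> 0 < x < t -> 0 < y < t ->
  y `^ (1 - b) / (1 - b) - x `^ (1 - b) / (1 - b) <= t `^ (1 - b) / (1 - b).
Proof.
move=> b1 /andP[x0 xt] /andP[y0 yt]; have c0 : 0 < 1 - b by rewrite subr_gt0.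
apply: (@le_trans _ _ (y `^ (1 - b) / (1 - b))).
  by rewrite gerBl divr_ge0 ?powR_ge0// ltW.
rewrite ler_pM2r ?invr_gt0//; apply: ge0_ler_powR; rewrite ?nnegrE ?(ltW c0)// ltW//.
exact: lt_trans yt.
Qed.

Lemma integral_powR_itvoo (b t : R) : b < 1 -> 0 < t ->
  (\int[leb1]_(s in `]0%R, t[) (s `^ (- b))%:E <= (t `^ (1 - b) / (1 - b))%:E)%E.
Proof.
move=> b1 t0; have c0 : 0 < 1 - b by rewrite subr_gt0.
apply: (@ge0_integral_derive_le _ (fun x => x `^ (1 - b) / (1 - b))) => //.
- by rewrite divr_ge0 ?powR_ge0// ltW.
- by move=> s; exact: powR_ge0.
- move=> s /andP[s0 _]; apply/differentiable_continuous/derivable1_diffP.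
  by have [] := @is_derive1_powR _ (- b) s s0.
- by move=> s /andP[s0 _]; exact: is_derive_powR_antiderivative.
- by move=> x y xt yt; exact: antiderivative_bound.
Qed.

Lemma integral_powR_itvoo_refl (b t : R) : b < 1 -> 0 < t ->
  (\int[leb1]_(s in `]0%R, t[) ((t - s) `^ (- b))%:E <=
   (t `^ (1 - b) / (1 - b))%:E)%E.
Proof.
move=> b1 t0; have c0 : 0 < 1 - b by rewrite subr_gt0.
have refl s : 0 < s < t -> 0 < t - s < t.
  by move=> /andP[s0 st]; rewrite subr_gt0 st ltrBlDr ltrDl.
have dP (s : R) : 0 < s < t ->
    is_derive s 1 (fun x : R => - ((t - x) `^ (1 - b) / (1 - b))) ((t - s) `^ (- b)).
  move=> /refl /andP[s0 _].
  have dts : is_derive s 1 (fun x : R => t - x) (- 1).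
    by rewrite -[- 1]add0r; apply: is_deriveB.
  have := is_derive_powR_antiderivative b1 s0.
  move=> dQ; have h := @is_derive1_comp _ _ (fun x : R => t - x) s _ _ dQ dts.
  rewrite (_ : _ `^ _ = - ((t - s) `^ (- b) * (- 1))); last by rewrite mulrN1 opprK.
  exact: is_deriveN.
have mts : measurable_fun setT (fun s : R => t - s) by exact: measurable_funB.
apply: (@ge0_integral_derive_le _ (fun x => - ((t - x) `^ (1 - b) / (1 - b)))) => //.
- by rewrite divr_ge0 ?powR_ge0// ltW.
- exact: (measurableT_comp (measurable_powR (- b))).
- by move=> s; exact: powR_ge0.
- move=> s /refl /andP[s0 _]; apply: (@continuous_comp _ _ _ (fun x : R => t - x) (fun x : R => x `^ (- b))).
    by apply: cvgB; [exact: cvg_cst|exact: cvg_id].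
  apply/differentiable_continuous/derivable1_diffP.
  by have [] := @is_derive1_powR _ (- b) _ s0.
- by move=> x y /refl xt /refl yt; rewrite opprK addrC; exact: antiderivative_bound.
Qed.

(* At most one of the two factors is singular: either s or t - s exceeds t / 2. *)
Lemma integral_beta_le (a b : R) : 0 <= a -> a < 1 -> 0 <= b -> b < 1 ->
  exists2 B : R, 0 < B & forall t, 0 < t ->
  (\int[leb1]_s (if 0 < s < t then (t - s) `^ (- a) * s `^ (- b) else 0)%:E <=
   (B * t `^ (1 - a - b))%:E)%E.
Proof.
move=> a0 a1 b0 b1.
have a'0 : 0 < 1 - a by rewrite subr_gt0.
have b'0 : 0 < 1 - b by rewrite subr_gt0.
exists (2^-1 `^ (- a) / (1 - b) + 2^-1 `^ (- b) / (1 - a)).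
  by rewrite addr_gt0// divr_gt0// powR_gt0// invr_gt0.
move=> t t0; have t20 : 0 < t / 2 by rewrite divr_gt0.
have mI D c : measurable D -> measurable_fun D (fun s : R => (s `^ c)%:E).
  by move=> mD; apply/measurable_EFinP/measurable_funTS; exact: measurable_powR.
have mIt D c : measurable D -> measurable_fun D (fun s : R => ((t - s) `^ c)%:E).
  move=> mD; apply/measurable_EFinP/measurable_funTS.
  by apply: (measurableT_comp (measurable_powR c)); exact: measurable_funB.
have -> : (\int[leb1]_s (if 0 < s < t then (t - s) `^ (- a) * s `^ (- b) else 0)%:E =
  \int[leb1]_(s in `]0%R, t[) ((t - s) `^ (- a) * s `^ (- b))%:E)%E.
  rewrite [RHS]integral_mkcond; apply: eq_integral => s _.
  by rewrite patchE mem_setE in_itv/=; case: ifP.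
apply: (@le_trans _ _ (\int[leb1]_(s in `]0%R, t[) (((t / 2) `^ (- a))%:E * (s `^ (- b))%:E
    + ((t / 2) `^ (- b))%:E * ((t - s) `^ (- a))%:E))%E).
  apply: ge0_le_integral => //.
  - by move=> s _; rewrite lee_fin mulr_ge0 ?powR_ge0.
  - apply/measurable_EFinP; apply: measurable_funM; apply/measurable_EFinP; [exact: mIt|exact: mI].
  - apply: emeasurable_funD; apply: measurable_funeM; [exact: mI|exact: mIt].
  move=> s /=; rewrite in_itv/= => /andP[s0 st]; rewrite -!EFinM -EFinD lee_fin.
  have ts0 : 0 < t - s by rewrite subr_gt0.
  have powRle (c x : R) : 0 <= c -> t / 2 <= x -> x `^ (- c) <= (t / 2) `^ (- c).
    move=> c0 tx; rewrite !powRN lef_pV2 ?posrE ?powR_gt0//; last exact: lt_le_trans tx.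
    by apply: ge0_ler_powR; rewrite ?nnegrE// ltW//; exact: lt_le_trans tx.
  have [ts|ts] := leP (t / 2) s.
    apply: ler_wpDl; first by rewrite mulr_ge0 ?powR_ge0.
    by rewrite mulrC ler_wpM2r ?powR_ge0// powRle.
  apply: ler_wpDr; first by rewrite mulr_ge0 ?powR_ge0.
  by rewrite ler_wpM2r ?powR_ge0// powRle//; lra.
rewrite ge0_integralD//; last 4 first.
- by move=> s _; rewrite mule_ge0 ?lee_fin ?powR_ge0.
- by apply: measurable_funeM; exact: mI.
- by move=> s _; rewrite mule_ge0 ?lee_fin ?powR_ge0.
- by apply: measurable_funeM; exact: mIt.
rewrite !ge0_integralZl ?lee_fin ?powR_ge0//; last 4 first.
- exact: mIt.
- by move=> s _; rewrite lee_fin powR_ge0.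
- exact: mI.
- by move=> s _; rewrite lee_fin powR_ge0.
apply: (@le_trans _ _ (((t / 2) `^ (- a))%:E * (t `^ (1 - b) / (1 - b))%:E +
    ((t / 2) `^ (- b))%:E * (t `^ (1 - a) / (1 - a))%:E)%E).
  by apply: leeD; rewrite lee_wpmul2l ?lee_fin ?powR_ge0//;
    [exact: integral_powR_itvoo|exact: integral_powR_itvoo_refl].
rewrite -!EFinM -EFinD lee_fin !powRM ?invr_ge0 ?(ltW t0)//.
have -> : t `^ (1 - a - b) = t `^ (- a) * t `^ (1 - b).
  by rewrite -powRD ?(gt_eqF t0) ?implybT//; congr (_ `^ _); ring.
have -> : t `^ (- b) * 2^-1 `^ (- b) * (t `^ (1 - a) / (1 - a)) =
    2^-1 `^ (- b) / (1 - a) * (t `^ (- a) * t `^ (1 - b)).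
  rewrite -powRD ?(gt_eqF t0) ?implybT//.
  have -> : t `^ (- a + (1 - b)) = t `^ (- b) * t `^ (1 - a).
    by rewrite -powRD ?(gt_eqF t0) ?implybT//; congr (_ `^ _); ring.
  ring.
by rewrite le_eqVlt; apply/orP; left; apply/eqP; ring.
Qed.

End power_integrals.

(** * The heat kernel *)

Section heat_kernel_bounds.
Context {R : realType} {N : nat}.
Implicit Types (x y z : Rn R N) (t : R).

Lemma enorm_ge0 x : 0 <= enorm x.
Proof. exact: sqrtr_ge0. Qed.

Lemma enorm_sqr x : enorm x ^+ 2 = \sum_(i < N) (tnth x i : R) ^+ 2.
Proof. by rewrite sqr_sqrtr// sumr_ge0// => i _; exact: sqr_ge0. Qed.

Lemma tnth_rnsub x y i : tnth (rnsub x y) i = (tnth x i : R) - tnth y i.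
Proof. by rewrite tnth_mktuple. Qed.

Lemma heat_kernel_sym t x y :
  heat_kernel t (rnsub x y) = heat_kernel t (rnsub y x).
Proof.
have E : enorm (rnsub x y) ^+ 2 = enorm (rnsub y x) ^+ 2.
  by rewrite !enorm_sqr; apply: eq_bigr => i _; rewrite !tnth_rnsub -sqrrN opprB.
by rewrite /heat_kernel E.
Qed.

Lemma heat_kernel_ge0 t z : 0 <= heat_kernel t z.
Proof. by rewrite mulr_ge0 ?powR_ge0 ?expR_ge0. Qed.

Lemma heat_kernel_le t z : 0 < t -> heat_kernel t z <= (4 * pi * t) `^ (- (N%:R / 2)).
Proof.
move=> t0; rewrite ler_piMr ?powR_ge0// -expR0 ler_expR oppr_le0.
by rewrite divr_ge0 ?exprn_ge0 ?enorm_ge0// mulr_ge0// ltW.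
Qed.

(** In each coordinate the kernel is the normal density of variance 2 t, so its total mass comes
    from that of [normal_pdf]. *)
Lemma heat_kernel_prod t x y : 0 < t -> heat_kernel t (rnsub x y) =
  \prod_(i < N) normal_pdf (tnth x i : R) (Num.sqrt (2 * t)) (tnth y i).
Proof.
move=> t0; have s0 : Num.sqrt (2 * t) != 0 by rewrite gt_eqF// sqrtr_gt0 mulr_gt0.
under eq_bigr do rewrite normal_pdfE//.
rewrite big_split/= prodr_const card_ord; congr (_ * _).
  rewrite /normal_peak sqr_sqrtr ?mulr_ge0 ?(ltW t0)//.
  have -> : 2 * t * pi *+ 2 = 4 * pi * t by rewrite -mulr_natr; ring.
  have p0 : 0 <= 4 * pi * t by rewrite !mulr_ge0 ?pi_ge0 ?(ltW t0).
  rewrite exprVn -powR12_sqrt// -powR_mulrn ?powR_ge0// -powRrM powRN.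
  by congr (_^-1); congr (_ `^ _); rewrite mulrC.
rewrite -expR_sum; congr expR; rewrite enorm_sqr mulr_suml -sumrN.
apply: eq_bigr => i _; rewrite tnth_rnsub sqr_sqrtr ?mulr_ge0 ?(ltW t0)//.
rewrite -sqrrN opprB mulNr; congr (- (_ / _)).
by rewrite -mulr_natr; ring.
Qed.

Local Open Scope ereal_scope.

Lemma integral_heat_kernel t x : (0 < t)%R ->
  \int[@leb R N]_y (heat_kernel t (rnsub x y))%:E = 1.
Proof.
move=> t0; under eq_integral do rewrite heat_kernel_prod//.
rewrite (@ge0_integral_leb_prod _ N (fun i => normal_pdf (tnth x i : R) (Num.sqrt (2 * t)))).
- by under eq_bigr do rewrite integral_normal_pdf; rewrite big1.
- by move=> i; exact: measurable_normal_pdf.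
- by move=> i y; exact: normal_pdf_ge0.
Qed.

Lemma integral_heat_kernel_sym t y : (0 < t)%R ->
  \int[@leb R N]_x (heat_kernel t (rnsub x y))%:E = 1.
Proof.
by move=> t0; under eq_integral do rewrite heat_kernel_sym; exact: integral_heat_kernel.
Qed.

Local Close Scope ereal_scope.

(** A substitute for the triangle inequality, up to a constant: in each coordinate the difference of
    the two sides is (a - 2 b)^2. *)
Lemma enorm_sqr_le2 x y : enorm x ^+ 2 <= 2 * enorm (rnsub x y) ^+ 2 + 2 * enorm y ^+ 2.
Proof.
rewrite !enorm_sqr !mulr_sumr -big_split/=; apply: ler_sum => i _.
rewrite tnth_rnsub; set a : R := tnth x i; set b : R := tnth y i.
have := sqr_ge0 (a - 2 * b); nra.
Qed.

Lemma powR_enorm x (c : R) : enorm x `^ c = (enorm x ^+ 2) `^ (c / 2).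
Proof.
by rewrite -powR_mulrn ?enorm_ge0// -powRrM mulrCA divff ?mulr1.
Qed.

Lemma enorm_powR_le x y (c : R) : 0 <= c ->
  enorm x `^ c <= 2 `^ c * (enorm (rnsub x y) `^ c + enorm y `^ c).
Proof.
move=> c0; have c20 : 0 <= c / 2 by rewrite divr_ge0.
rewrite !powR_enorm; set a := enorm (rnsub x y) ^+ 2; set b := enorm y ^+ 2.
have a0 : 0 <= a by rewrite sqr_ge0. have b0 : 0 <= b by rewrite sqr_ge0.
have -> : 2 `^ c = 4 `^ (c / 2) :> R.
  have -> : 4 = 2 `^ 2 :> R by rewrite powR_mulrn// expr2 -natrM.
  by rewrite -powRrM; congr (_ `^ _); field.
have m0 : 0 <= Num.max a b by rewrite le_max a0.
apply: (@le_trans _ _ ((4 * Num.max a b) `^ (c / 2))).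
  apply: ge0_ler_powR => //; rewrite ?nnegrE ?sqr_ge0 ?mulr_ge0//.
  apply: le_trans (enorm_sqr_le2 x y) _; rewrite -/a -/b.
  have : a <= Num.max a b by rewrite le_max lexx.
  have : b <= Num.max a b by rewrite le_max lexx orbT.
  lra.
rewrite powRM// ler_wpM2l ?powR_ge0//.
by rewrite maxEle; case: ifPn => _; rewrite ?lerDl ?lerDr powR_ge0.
Qed.

Lemma peak_double t : 0 < t ->
  (4 * pi * t) `^ (- (N%:R / 2)) = 2 `^ (N%:R / 2) * (4 * pi * (2 * t)) `^ (- (N%:R / 2)).
Proof.
move=> t0; have p0 : 0 < 4 * pi * t :> R by rewrite !mulr_gt0 ?pi_gt0.
have -> : 4 * pi * (2 * t) = 2 * (4 * pi * t) :> R by ring.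
rewrite [(2 * _) `^ _]powRM ?(ltW p0)// mulrA -powRD ?pnatr_eq0 ?implybT//.
by rewrite subrr powRr0 mul1r.
Qed.

Lemma heat_kernel_double t z : 0 < t ->
  heat_kernel t z <= 2 `^ (N%:R / 2) * heat_kernel (2 * t) z.
Proof.
move=> t0; rewrite /heat_kernel peak_double// -[leLHS]mulrA ler_wpM2l ?powR_ge0//.
rewrite ler_wpM2l ?powR_ge0// ler_expR lerN2.
rewrite ler_wpM2l ?sqr_ge0// lef_pV2 ?posrE ?mulr_gt0//; lra.
Qed.

(** The inequality v / c <= exp (v / c), raised to the power c. *)
Lemma powR_le_expR (c v : R) : 0 < c -> 0 <= v -> v `^ c <= c `^ c * expR v.
Proof.
move=> c0 v0.
have vc : v <= c * expR (v / c).
  rewrite mulrC -ler_pdivrMr//; apply: le_trans (expR_ge1Dx _); lra.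
apply: (@le_trans _ _ ((c * expR (v / c)) `^ c)).
  apply: ge0_ler_powR; rewrite ?nnegrE ?(ltW c0)//.
  by rewrite mulr_ge0 ?expR_ge0// ltW.
rewrite powRM ?expR_ge0 ?(ltW c0)// -expRM mulfVK ?gt_eqF//.
Qed.

(** With v = |z|^2 / (8 t) the kernel at time t contains exp (- v) twice. One factor absorbs v^(c /
    2), the other is the exponential of the kernel at time 2 t. Polynomial weights thus cost a power
    of t and a doubling of time. *)
Lemma heat_kernel_weight (c : R) : 0 < c -> exists2 C : R, 0 < C &
  forall t z, 0 < t ->
  enorm z `^ c * heat_kernel t z <= C * t `^ (c / 2) * heat_kernel (2 * t) z.
Proof.
move=> c0; have c20 : 0 < c / 2 by rewrite divr_gt0.
exists (8 `^ (c / 2) * (c / 2) `^ (c / 2) * 2 `^ (N%:R / 2)).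
  by rewrite !mulr_gt0// powR_gt0.
move=> t z t0; pose v := enorm z ^+ 2 / (8 * t).
have v0 : 0 <= v by rewrite divr_ge0 ?sqr_ge0 ?mulr_ge0// ltW.
have t8 : 8 * t != 0 by rewrite mulf_neq0// gt_eqF.
have zE : enorm z `^ c = 8 `^ (c / 2) * t `^ (c / 2) * v `^ (c / 2).
  have vE : enorm z ^+ 2 = 8 * t * v by rewrite /v; field; rewrite gt_eqF.
  by rewrite powR_enorm vE (powRM _ (mulr_ge0 (ler0n R 8) (ltW t0)) v0) powRM// ltW.
rewrite zE /heat_kernel peak_double//.
have -> : enorm z ^+ 2 / (4 * t) = v + v by rewrite /v; field; rewrite gt_eqF.
have -> : enorm z ^+ 2 / (4 * (2 * t)) = v by rewrite /v; congr (_ / _); ring.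
rewrite opprD expRD; set P := _ `^ (- _).
have h : v `^ (c / 2) * expR (- v) <= (c / 2) `^ (c / 2).
  by rewrite expRN ler_pdivrMr ?expR_gt0//; exact: powR_le_expR.
set a8 := 8 `^ _; set tc := t `^ _; set n2 := 2 `^ _; set cc := (c / 2) `^ _.
have -> : a8 * tc * v `^ (c / 2) * (n2 * P * (expR (- v) * expR (- v))) =
   a8 * tc * n2 * P * expR (- v) * (v `^ (c / 2) * expR (- v)) by ring.
have -> : a8 * cc * n2 * tc * (P * expR (- v)) = a8 * tc * n2 * P * expR (- v) * cc by ring.
by rewrite ler_wpM2l// !mulr_ge0 ?powR_ge0 ?expR_ge0.
Qed.

Lemma Bernoulli (h : R) (n : nat) : 0 <= h -> h <= 1 -> 1 - n%:R * h <= (1 - h) ^+ n.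
Proof.
move=> h0 h1; elim: n => [|n IH]; first by rewrite mul0r subr0 expr0.
rewrite exprSr -natr1.
have p0 : 0 <= (1 - h) ^+ n by rewrite exprn_ge0// subr_ge0.
have nh : 0 <= n%:R * h * h by rewrite !mulr_ge0.
have : (1 - n%:R * h) * (1 - h) <= (1 - h) ^+ n * (1 - h) by rewrite ler_wpM2r// subr_ge0.
lra.
Qed.

(** Interpolates between a Lipschitz bound in the relative increment d = (t - s) / s and the trivial
    bound by the sum of the kernels. The exponent th below 1 tames the singularity of d at s = 0
    when the bound is integrated in time. *)
Lemma heat_kernel_timeB (th s t : R) z : 0 <= th -> th <= 1 -> 0 < s -> s <= t ->
  `|heat_kernel t z - heat_kernel s z| <=
  (1 + N%:R + 2 * 2 `^ (N%:R / 2)) * ((t - s) / s) `^ th *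
  (heat_kernel s z + heat_kernel t z + heat_kernel (2 * t) z).
Proof.
move=> th0 th1 s0 st; have t0 : 0 < t := lt_le_trans s0 st.
have oneE (r : R) : 1 = 1 `^ r by rewrite powR1.
move dE : ((t - s) / s) => d.
have d0 : 0 <= d by rewrite -dE divr_ge0 ?subr_ge0 ?(ltW s0).
set c2 := 2 `^ (N%:R / 2); have c20 : 0 <= c2 by exact: powR_ge0.
have ks := heat_kernel_ge0 s z; have kt := heat_kernel_ge0 t z.
have k2t := heat_kernel_ge0 (2 * t) z.
have C1 : 1 <= 1 + N%:R + 2 * c2 :> R by rewrite -addrA lerDl addr_ge0// mulr_ge0.
(* For d >= 1 the factor d^th is at least 1 and the triangle inequality suffices; for d < 1 one has
   d <= d^th, and the Lipschitz bound is enough. *)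
have [d1|d1] := leP 1 d.
  have dth : 1 <= d `^ th.
    by rewrite [leLHS](oneE th); apply: ge0_ler_powR; rewrite ?nnegrE.
  apply: (@le_trans _ _ (heat_kernel s z + heat_kernel t z + heat_kernel (2 * t) z)).
    by rewrite ler_norml; apply/andP; split; lra.
  rewrite ler_peMl ?addr_ge0//.
  by rewrite -[leLHS]mul1r ler_pM.
have dth : d <= d `^ th.
  have [->|dn0] := eqVneq d 0; first exact: powR_ge0.
  rewrite -[leLHS]powRr1//; apply: ger_powR => //.
  by rewrite lt_neqAle eq_sym dn0 d0 ltW.
apply: (@le_trans _ _ ((N%:R + 2 * c2) * d * (heat_kernel s z + heat_kernel (2 * t) z))); last first.
  have Nc0 : 0 <= N%:R + 2 * c2 by rewrite addr_ge0// mulr_ge0.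
  apply: ler_pM.
  - by rewrite mulr_ge0.
  - by rewrite addr_ge0.
  - by apply: ler_pM => //; lra.
  - lra.
pose A (r : R) := (4 * pi * r) `^ (- (N%:R / 2)).
pose e (r : R) := expR (- (enorm z ^+ 2 / (4 * r))).
have A0 r : 0 <= A r by exact: powR_ge0.
have e0 r : 0 <= e r by exact: expR_ge0.
have hkE r : heat_kernel r z = A r * e r by [].
have Ast : A t = A s * (s / t) `^ (N%:R / 2).
  rewrite /A; have p0 : 0 < 4 * pi * s :> R by rewrite !mulr_gt0 ?pi_gt0.
  have -> : 4 * pi * t = 4 * pi * s * (t / s) by field; rewrite gt_eqF.
  rewrite powRM ?divr_ge0 ?(ltW p0) ?(ltW s0) ?(ltW t0)//; congr (_ * _).
  rewrite -[s / t]invf_div -(powR_inv1 (divr_ge0 (ltW t0) (ltW s0))).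
  by rewrite -powRrM mulN1r.
have st1 : s / t <= 1 by rewrite ler_pdivrMr// mul1r.
have st0 : 0 < s / t by rewrite divr_gt0.
(* (s / t)^(N / 2) >= (s / t)^N >= 1 - N (1 - s / t) by Bernoulli, and 1 - s / t <= t / s - 1 = d.
   Raising the exponent to N avoids half-integers. *)
have stN : 1 - N%:R * d <= (s / t) `^ (N%:R / 2).
  apply: (@le_trans _ _ ((s / t) ^+ N)); last first.
    rewrite -powR_mulrn ?(ltW st0)//; apply: ger_powR; first by rewrite st0.
    by rewrite ler_pdivrMr// ler_peMr// (ler_nat _ 1 2).
  have := @Bernoulli (1 - s / t) N; rewrite subr_ge0 st1 => /(_ isT).
  rewrite gerBl (ltW st0) subKr => /(_ isT); apply: le_trans.
  rewrite lerB// ler_wpM2l// -dE mulrBl divff ?gt_eqF//.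
  rewrite lerBlDr -subr_ge0.
  have -> : t / s - 1 + s / t - 1 = (t - s) ^+ 2 / (s * t).
    by field; rewrite !gt_eqF.
  by rewrite divr_ge0 ?sqr_ge0// mulr_ge0// ltW.
have AtAs : A t <= A s.
  by rewrite Ast ler_piMr// [leRHS](oneE (N%:R / 2)); apply: ge0_ler_powR;
    rewrite ?nnegrE// ?divr_ge0// ltW.
have est : e s <= e t.
  rewrite ler_expR lerN2 ler_wpM2l ?sqr_ge0// lef_pV2 ?posrE ?mulr_gt0//; lra.
pose v := enorm z ^+ 2 / (8 * t).
have v0 : 0 <= v by rewrite divr_ge0 ?sqr_ge0 ?mulr_ge0// ltW.
have etE : e t = e (2 * t) * e (2 * t).
  by rewrite /e -expRD; congr expR; field; rewrite gt_eqF.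
have vE : e (2 * t) * v <= 1.
  rewrite /e (_ : _ / _ = v); last by rewrite /v; congr (_ / _); ring.
  by rewrite expRN mulrC ler_pdivrMr ?expR_gt0// mul1r; apply: le_trans (expR_ge1Dx _); lra.
(* The exponents at s and t differ by 2 d v. Writing [e t] as the square of [e (2 * t)], one factor
   compensates v and the other remains in the bound. *)
have ets : e t - e s <= 2 * d * e (2 * t).
  have -> : e s = e t * expR (- (2 * d * v)).
    rewrite /e -expRD; congr expR; rewrite /v -dE; field.
    by rewrite !gt_eqF.
  have h : 1 - expR (- (2 * d * v)) <= 2 * d * v.
    by have := expR_ge1Dx (- (2 * d * v)); lra.
  apply: (@le_trans _ _ (e t * (2 * d * v))).
    by rewrite -[X in X - _]mulr1 -mulrBr ler_wpM2l.
  have -> : e t * (2 * d * v) = (2 * d * e (2 * t)) * (e (2 * t) * v) by rewrite etE; ring.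
  by rewrite ler_piMr// !mulr_ge0.
(* The peak [A] decreases in time and the exponential [e] increases: the lower bound only loses the
   variation of [A], the upper bound only that of [e]. *)
rewrite !hkE ler_norml; apply/andP; split.
  have : A s * e s - A t * e t <= N%:R * d * (A s * e s).
    have : A t * e s <= A t * e t by rewrite ler_wpM2l.
    have : A s * e s * (1 - N%:R * d) <= A t * e s.
      by rewrite Ast [leRHS]mulrAC ler_wpM2l// mulr_ge0.
    lra.
  have : 0 <= N%:R * d * (A (2 * t) * e (2 * t)) by rewrite !mulr_ge0.
  have : 0 <= 2 * c2 * d * (A s * e s + A (2 * t) * e (2 * t)).
    by rewrite !(mulr_ge0, addr_ge0).
  lra.
have : A t * e t - A s * e s <= 2 * c2 * d * (A (2 * t) * e (2 * t)).
  have : A t * e s <= A s * e s by rewrite ler_wpM2r.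
  have : A t * (e t - e s) <= A t * (2 * d * e (2 * t)) by rewrite ler_wpM2l.
  have -> : A t * (2 * d * e (2 * t)) = 2 * c2 * d * (A (2 * t) * e (2 * t)).
    by rewrite [A t]peak_double// -/(A (2 * t)) -/c2; ring.
  lra.
have : 0 <= 2 * c2 * d * (A s * e s) by rewrite !mulr_ge0.
have : 0 <= N%:R * d * (A s * e s + A (2 * t) * e (2 * t)).
  by rewrite !(mulr_ge0, addr_ge0).
lra.
Qed.

End heat_kernel_bounds.

Section heat_op_measurability.
Context {R : realType} {N : nat} d (T : measurableType d).

Lemma measurable_invr : measurable_fun setT (fun x : R => x^-1).
Proof.
(* [powR] with exponent -1 is the inverse on nonnegative reals only, hence the square; at x = 0 both
   sides are 0. *)
rewrite (_ : (fun x => _) = (fun x : R => x * (x ^+ 2) `^ (- 1))).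
  apply: measurable_funM => //; apply: (measurableT_comp (measurable_powR (- 1))).
  exact: measurable_funX.
apply/funext => x; rewrite powR_inv1 ?sqr_ge0//.
have [->|x0] := eqVneq x 0; first by rewrite invr0 mul0r.
by rewrite expr2; field.
Qed.

Lemma measurable_enorm : measurable_fun [set: Rn R N] (@enorm R N).
Proof.
rewrite (_ : @enorm R N =
  (fun x : Rn R N => (\sum_(i < N) (tnth x i : R) ^+ 2) `^ 2^-1)).
  apply: (measurableT_comp (measurable_powR 2^-1)).
  apply: measurable_sum => i; apply: measurable_funX; exact: measurable_tnth.
by apply/funext => x; rewrite powR12_sqrt// sumr_ge0// => i _; exact: sqr_ge0.
Qed.

Lemma measurable_rnsub (f g : T -> Rn R N) :
  measurable_fun setT f -> measurable_fun setT g ->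
  measurable_fun setT (fun w => rnsub (f w) (g w) : Rn R N).
Proof.
move=> mf mg; apply/measurable_fun_tnthP => i.
rewrite (_ : _ \o _ = (fun w => (tnth (f w) i : R) - tnth (g w) i)).
  by apply: measurable_funB; apply: (measurableT_comp (measurable_tnth i)).
by apply/funext => w /=; rewrite tnth_rnsub.
Qed.

Lemma measurable_heat_kernel (f : T -> R) (g : T -> Rn R N) :
  measurable_fun setT f -> measurable_fun setT g ->
  measurable_fun setT (fun w => heat_kernel (f w) (g w)).
Proof.
move=> mf mg; apply: measurable_funM.
  apply: (measurableT_comp (measurable_powR (- (N%:R / 2)))).
  by apply: measurable_funM.
apply: measurableT_comp => //; apply: measurableT_comp => //.
apply: measurable_funM.
  by apply: measurable_funX; exact: (measurableT_comp measurable_enorm).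
by apply: (measurableT_comp measurable_invr); apply: measurable_funM.
Qed.

End heat_op_measurability.

(** * The heat semigroup on nonnegative functions and its unweighted smoothing bounds *)

Section heat_op.
Context {R : realType} {N : nat}.
Implicit Types (x y : Rn R N) (t : R) (f g : Rn R N -> \bar R) (p r : R).
Local Open Scope ereal_scope.

(** In contrast to [heat], it acts on [0, oo]-valued functions without integrability conditions, and
    it has no special case at t = 0, where it is in general not the identity. *)
Definition heat_op t f x : \bar R :=
  \int[@leb R N]_y ((heat_kernel t (rnsub x y))%:E * f y).

Lemma heat_op_ge0 t f x : (forall y, 0 <= f y) -> 0 <= heat_op t f x.
Proof.
by move=> f0; apply: integral_ge0 => y _; rewrite mule_ge0// lee_fin heat_kernel_ge0.
Qed.

Lemma measurable_heat_op_integrand t f : measurable_fun setT f ->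
  measurable_fun [set: Rn R N * Rn R N]
    (fun w => (heat_kernel t (rnsub w.1 w.2))%:E * f w.2).
Proof.
move=> mf; apply: emeasurable_funM; last exact: measurableT_comp.
apply/measurable_EFinP; apply: measurable_heat_kernel => //.
exact: measurable_rnsub.
Qed.

Lemma measurable_heat_op t f : measurable_fun setT f -> (forall y, 0 <= f y) ->
  measurable_fun setT (heat_op t f).
Proof.
move=> mf f0.
apply: (measurable_fun_fubini_tonelli_F (m2 := @leb R N) _ (measurable_heat_op_integrand t mf)).
by move=> w; rewrite mule_ge0// lee_fin heat_kernel_ge0.
Qed.

Lemma measurable_heat_kernel_section t x :
  measurable_fun setT (fun y : Rn R N => heat_kernel t (rnsub x y)).
Proof. by apply: measurable_heat_kernel => //; exact: measurable_rnsub. Qed.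

Lemma measurable_heat_op_section t f x : measurable_fun setT f ->
  measurable_fun setT (fun y => (heat_kernel t (rnsub x y))%:E * f y).
Proof.
move=> mf; apply: emeasurable_funM => //.
by apply/measurable_EFinP; exact: measurable_heat_kernel_section.
Qed.

Lemma integral_heat_op t f : (0 < t)%R -> measurable_fun setT f ->
  (forall y, 0 <= f y) ->
  \int[@leb R N]_x heat_op t f x = \int[@leb R N]_y f y.
Proof.
move=> t0 mf f0; rewrite /heat_op.
rewrite (fubini_tonelli (m1 := @leb R N) (m2 := @leb R N) _
  (measurable_heat_op_integrand t mf)); last first.
  by move=> w; rewrite mule_ge0// lee_fin heat_kernel_ge0.
apply: eq_integral => y _ /=.
rewrite ge0_integralZr//; first by rewrite integral_heat_kernel_sym// mul1e.
- apply/measurable_EFinP; apply: measurable_heat_kernel => //.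
  exact: measurable_rnsub.
- by move=> x _; rewrite lee_fin heat_kernel_ge0.
Qed.

Lemma heat_op_le_sup t f x : (0 < t)%R -> measurable_fun setT f ->
  (forall y, 0 <= f y) ->
  heat_op t f x <= ((4 * pi * t) `^ (- (N%:R / 2)))%:E * \int[@leb R N]_y f y.
Proof.
move=> t0 mf f0; rewrite -ge0_integralZl ?lee_fin ?powR_ge0//.
apply: ge0_le_integral => //.
- by move=> y _; rewrite mule_ge0// lee_fin heat_kernel_ge0.
- exact: measurable_heat_op_section.
- exact: measurable_funeM.
- by move=> y _; rewrite lee_wpmul2r// lee_fin heat_kernel_le.
Qed.

Lemma heat_op_powR_le p t f x : (1 <= p)%R -> (0 < t)%R -> measurable_fun setT f ->
  (forall y, 0 <= f y) -> heat_op t f x `^ p <= heat_op t (fun y => f y `^ p) x.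
Proof.
move=> p1 t0 mf f0.
have := @integral_weight_powR R _ _ (@leb R N) _ f p 1%R p1 ltr01 (measurable_heat_kernel_section t x)
  (fun y => heat_kernel_ge0 t _) mf f0.
by rewrite integral_heat_kernel// lexx powR1 mul1e => /(_ isT).
Qed.

(** Write E for the operator. By Jensen (E f)^r <= (E f^p)^(r / p), and all but one power of E f^p
    is bounded by its supremum M, so that (E f)^r <= M^(r / p - 1) E f^p. Integrating, with
    conservation of mass, gives the smoothing rate without Young's convolution inequality. *)
Lemma Lnorm_heat_op_fin p r t f : (1 <= p)%R -> (p <= r)%R -> (0 < t)%R ->
  measurable_fun setT f -> (forall y, 0 <= f y) ->
  Lnorm (@leb R N) r%:E (heat_op t f) <=
  ((4 * pi * t) `^ (- (N%:R / 2 * (p^-1 - r^-1))))%:E * Lnorm (@leb R N) p%:E f.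
Proof.
move=> p1 pr t0 mf f0.
have p0 : (0 < p)%R by rewrite (lt_le_trans ltr01).
have r0 : (0 < r)%R by rewrite (lt_le_trans p0).
set S := (4 * pi * t)%R; have S0 : (0 < S)%R by rewrite !mulr_gt0 ?pi_gt0.
have [Ay|] := eqVneq (Lnorm (@leb R N) p%:E f) +oo.
  by rewrite Ay gt0_muley ?leey// lte_fin powR_gt0.
rewrite -ltey => Ay; have A0 := Lnorm_ge0 (@leb R N) p%:E f.
have AE : \int[@leb R N]_y f y `^ p = Lnorm (@leb R N) p%:E f `^ p.
  by rewrite poweR_Lnorm ?gt_eqF//; apply: eq_integral => y _; rewrite gee0_abs.
move: Ay A0 AE; case: (Lnorm _ _ _) => [A| |]//= _; rewrite lee_fin => A0 AE.
rewrite Lnorm_fin_leP//; last by rewrite mule_ge0 ?lee_fin ?powR_ge0.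
have mfp : measurable_fun setT (fun y => f y `^ p) by exact: measurable_poweR_comp.
have fp0 y : 0 <= f y `^ p by exact: poweR_ge0.
have I0 x : 0 <= heat_op t (fun y => f y `^ p) x by exact: heat_op_ge0.
pose M : R := (S `^ (- (N%:R / 2)) * A `^ p)%R.
have M0 : (0 <= M)%R by rewrite mulr_ge0 ?powR_ge0.
have rp1 : (0 <= r / p - 1)%R by rewrite subr_ge0 ler_pdivlMr// mul1r.
have mI : measurable_fun setT (heat_op t (fun y => f y `^ p)).
  exact: measurable_heat_op.
apply: (@le_trans _ _ (\int[@leb R N]_x
    ((M `^ (r / p - 1))%:E * heat_op t (fun y => f y `^ p) x))).
  apply: ge0_le_integral => //.
  - by move=> x _; exact: poweR_ge0.
  - apply: measurable_poweR_comp; apply: measurableT_comp => //.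
    exact: measurable_heat_op.
  - exact: measurable_funeM.
  move=> x _; rewrite gee0_abs ?heat_op_ge0//.
  have IM : heat_op t (fun y => f y `^ p) x <= M%:E.
    by have := heat_op_le_sup x t0 mfp fp0; rewrite AE -EFinM.
  have := heat_op_powR_le x p1 t0 mf f0.
  move: IM (I0 x); case: (heat_op _ _ x) => [i| |]//; rewrite !lee_fin => iM i0 Hi.
  have -> : r = (p * (r / p))%R by field; rewrite gt_eqF.
  rewrite poweRrM.
  apply: (@le_trans _ _ (i%:E `^ (r / p))).
    by rewrite poweR_le_swap// ?divr_gt0// poweR_ge0.
  rewrite mulrCA divff ?gt_eqF// mulr1.
  rewrite -EFinM lee_fin.
  have [->|iN0] := eqVneq i 0%R.
    by rewrite powR0 ?mulr0// gt_eqF// divr_gt0.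
  have -> : (i `^ (r / p) = i `^ (r / p - 1) * i)%R.
    by rewrite -{3}(powRr1 i0) -powRD ?iN0 ?implybT// subrK.
  rewrite ler_wpM2r//.
  by apply: ge0_ler_powR; rewrite ?nnegrE.
rewrite ge0_integralZl//; last by rewrite lee_fin powR_ge0.
rewrite integral_heat_op// AE poweRM ?lee_fin ?powR_ge0//.
rewrite /M powRM ?powR_ge0// -!powRrM -[leLHS]mulrA.
apply: ler_pM; rewrite ?mulr_ge0 ?powR_ge0//.
  rewrite le_eqVlt; apply/orP; left; apply/eqP; congr (_ `^ _)%R; field.
  by rewrite !gt_eqF.
have [->|A_neq0] := eqVneq A 0%R.
  by rewrite [(0 `^ p)%R]powR0 ?gt_eqF// mulr0 powR_ge0.
rewrite -powRD ?A_neq0 ?implybT//.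
rewrite le_eqVlt; apply/orP; left; apply/eqP; congr (_ `^ _)%R; field.
by rewrite gt_eqF.
Qed.

Lemma Lnorm_heat_op_infty t f : (0 < t)%R -> measurable_fun setT f ->
  (forall y, 0 <= f y) ->
  Lnorm (@leb R N) +oo (heat_op t f) <= Lnorm (@leb R N) +oo f.
Proof.
move=> t0 mf f0; apply/Lnorm_infty_leP; first exact: Lnorm_ge0.
have fle := Lnorm_infty_ae (@leb R N) f.
apply: aeW => x; rewrite gee0_abs ?heat_op_ge0//.
set A := Lnorm _ _ _ in fle *.
have A0 : 0 <= A by exact: Lnorm_ge0.
apply: (@le_trans _ _ (\int[@leb R N]_y ((heat_kernel t (rnsub x y))%:E * A))).
  apply: ae_ge0_le_integral => //.
  - by move=> y _; rewrite mule_ge0// lee_fin heat_kernel_ge0.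
  - exact: measurable_heat_op_section.
  - by move=> y _; rewrite mule_ge0// lee_fin heat_kernel_ge0.
  - by apply: measurable_heat_op_section; exact: measurable_cst.
  - apply: filterS fle => y; rewrite gee0_abs// => fy _.
    by rewrite lee_wpmul2l// lee_fin heat_kernel_ge0.
rewrite ge0_integralZr//; first by rewrite integral_heat_kernel// mul1e.
- by apply/measurable_EFinP; exact: measurable_heat_kernel_section.
- by move=> y _; rewrite lee_fin heat_kernel_ge0.
Qed.

Lemma rinv_fin r : r != 0%R -> rinv r%:E = (r^-1)%R.
Proof. by move=> r0; rewrite /rinv inver (negbTE r0). Qed.

Lemma rinv_infty : rinv (+oo : \bar R) = 0%R.
Proof. by rewrite /rinv invey. Qed.

(** The passage from a finite p to r = +oo is left out: the target exponents that occur, rho and the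
    admissible r, are infinite only together with q. *)
Lemma Lnorm_heat_op (p r : \bar R) t f : 1 <= p -> p <= r -> (r = +oo -> p = +oo) ->
  (0 < t)%R -> measurable_fun setT f -> (forall y, 0 <= f y) ->
  Lnorm (@leb R N) r (heat_op t f) <=
  ((4 * pi * t) `^ (- (N%:R / 2 * (rinv p - rinv r))))%:E * Lnorm (@leb R N) p f.
Proof.
move=> p1 pr rp t0 mf f0; case: r pr rp => [r| |] pr rp; last first.
- by move: pr; rewrite leeNy_eq => /eqP pN; move: p1; rewrite pN.
- by rewrite rp// rinv_infty subrr mulr0 oppr0 powRr0 mul1e; exact: Lnorm_heat_op_infty.
case: p p1 pr {rp} => [p||] //; rewrite !lee_fin => p1 pr.
have p0 : (0 < p)%R by rewrite (lt_le_trans ltr01).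
have r0 : (0 < r)%R by rewrite (lt_le_trans p0).
by rewrite !rinv_fin ?gt_eqF//; exact: Lnorm_heat_op_fin.
Qed.

(** Meant for the part of a function near the origin, which the weighted norm controls in L^1 only;
    here r = +oo has to be reached as well. *)
Lemma Lnorm_heat_op1 (r : \bar R) t f : 1 <= r ->
  (0 < t)%R -> measurable_fun setT f -> (forall y, 0 <= f y) ->
  Lnorm (@leb R N) r (heat_op t f) <=
  ((4 * pi * t) `^ (- (N%:R / 2 * (1 - rinv r))))%:E * \int[@leb R N]_y f y.
Proof.
move=> r1 t0 mf f0; case: r r1 => [r||//] r1.
  have -> : \int[@leb R N]_y f y = Lnorm (@leb R N) 1 f.
    by rewrite Lnorm1; apply: eq_integral => y _; rewrite gee0_abs.
  have r0 : (0 < r)%R by rewrite (lt_le_trans ltr01).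
  rewrite rinv_fin ?gt_eqF// -[X in (X - r^-1)%R](@invr1 R).
  exact: Lnorm_heat_op_fin.
rewrite rinv_infty subr0 mulr1; apply/Lnorm_infty_leP.
  by rewrite mule_ge0 ?integral_ge0// lee_fin powR_ge0.
by apply: aeW => x; rewrite gee0_abs ?heat_op_ge0//; exact: heat_op_le_sup.
Qed.

End heat_op.

(** * Heat semigroup bounds in weighted Lebesgue spaces *)

Section singular_integral.
Context {R : realType} {N : nat}.
Implicit Types (x y : Rn R N).
Local Notation leb1 := (@lebesgue_measure R).

Lemma normr_tnth_le_enorm x i : `|tnth x i : R| <= enorm x.
Proof.
rewrite -sqrtr_sqr ler_sqrt; last by rewrite sumr_ge0// => j _; exact: sqr_ge0.
by rewrite (bigD1 i)//= lerDl sumr_ge0// => j _; exact: sqr_ge0.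
Qed.

Lemma ae_tnth_neq0 : {ae @leb R N, forall x, forall i, (tnth x i : R) != 0}.
Proof.
apply: filter_forall => i.
pose A (j : 'I_N) : set (measurableTypeR R) := if j == i then [set 0] else setT.
have mA j : measurable (A j) by rewrite /A; case: ifP.
exists [set x : Rn R N | forall j, A j (tnth x j)]; split.
- exact: measurable_box.
- rewrite [LHS](lebesgue_Rn_box mA) (bigD1 i)//=.
  by rewrite {1}/A eqxx lebesgue_measure_set1 mul0e.
- move=> x /= /negP; rewrite negbK => /eqP xi j; rewrite /A.
  by case: eqP => // ->.
Qed.

Lemma ae_enorm_gt0 : (0 < N)%N -> {ae @leb R N, forall x, 0 < enorm x}.
Proof.
move=> N0; apply: filterS ae_tnth_neq0 => x /(_ (Ordinal N0)).
by rewrite -normr_gt0 => /lt_le_trans; apply; exact: normr_tnth_le_enorm.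
Qed.

Lemma integral_powR_interval (c r : R) : c < 1 -> 0 < r ->
  (\int[leb1]_s (if (0 < `|s| < r)%R then `|s| `^ (- c) else 0)%:E <=
   (2 * (r `^ (1 - c) / (1 - c)))%:E)%E.
Proof.
move=> c1 r0; set f := fun s : R => if (0 < `|s| < r)%R then `|s| `^ (- c) else 0.
have f0 s : 0 <= f s by rewrite /f; case: ifP => // _; exact: powR_ge0.
have mf : measurable_fun setT f.
  apply: measurable_fun_if => //.
  - apply: measurable_and; exact: measurable_fun_ltr.
  - apply: measurable_funTS; apply: (measurableT_comp (measurable_powR (- c))).
    by [].
have mfE : measurable_fun setT (EFin \o f) by apply/measurable_EFinP.
have half : (\int[leb1]_(s in `[0%R, +oo[) (f s)%:E <= (r `^ (1 - c) / (1 - c))%:E)%E.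
  apply: le_trans (integral_powR_itvoo c1 r0).
  rewrite [X in (X <= _)%E]integral_mkcond [X in (_ <= X)%E]integral_mkcond.
  rewrite le_eqVlt; apply/orP; left; apply/eqP; apply: eq_integral => s _.
  rewrite !patchE !mem_setE !in_itv/= andbT /f.
  have [s0|s0] := leP 0 s; last by rewrite ltNge (ltW s0).
  by rewrite ger0_norm//; case: ifP.
rewrite -(setUv `[0%R, +oo[%classic) ge0_integral_setU//; last 4 first.
- exact: measurableC.
- by rewrite setUv.
- by move=> s _; exact: f0.
- by apply/disj_setPS; rewrite setICr.
rewrite mulr_natl mulr2n EFinD leeD//; apply: le_trans half.
have -> : (\int[leb1]_(s in `[0%R, +oo[) (f s)%:E =
    \int[leb1]_(s in `]-oo, 0%R]) (f s)%:E)%E.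
  have fE0 s : (0 <= (EFin \o f) s)%E by exact: f0.
  rewrite [LHS](ge0_integration_by_substitution0 mfE fE0).
  by apply: eq_integral => s _; rewrite /f /= normrN.
apply: ge0_subset_integral => //.
- exact: measurableC.
- exact: measurable_funTS.
- by move=> s _; exact: f0.
- by move=> s /=; rewrite !in_itv/= andbT => /negP; rewrite -ltNge => /ltW.
Qed.

(* [enorm y] dominates the geometric mean of the [|y_i|], so the radial
   singularity splits into integrable one-dimensional ones. *)
Lemma integral_ball_powR (c : R) : (0 < N)%N -> 0 <= c -> c < N%:R ->
  exists2 C : R, 0 < C & forall r, 0 < r ->
  (\int[@leb R N]_y (if enorm y < r then enorm y `^ (- c) else 0)%:E <=
   (C * r `^ (N%:R - c))%:E)%E.
Proof.
move=> N0 c0 cN; have Nr0 : 0 < N%:R :> R by rewrite ltr0n.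
(* The exponent is shared equally among the coordinates; c < N becomes e < 1, the condition of
   integrability on the line. *)
pose e := c / N%:R; have e0 : 0 <= e by rewrite divr_ge0.
have e1 : e < 1 by rewrite ltr_pdivrMr// mul1r.
have d0 : 0 < 1 - e by rewrite subr_gt0.
exists ((2 / (1 - e)) ^+ N); first by rewrite exprn_gt0// divr_gt0.
move=> r r0; pose f (s : R) : R := if 0 < `|s| < r then `|s| `^ (- e) else 0.
have f0 s : 0 <= f s by rewrite /f; case: ifP => // _; exact: powR_ge0.
have mf : measurable_fun setT f.
  apply: measurable_fun_if => //.
  - apply: measurable_and; exact: measurable_fun_ltr.
  - apply: measurable_funTS; apply: (measurableT_comp (measurable_powR (- e))).
    by [].
have fle (s : seq 'I_N) (y : Rn R N) : (forall i, 0 < `|tnth y i : R| < r) ->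
    (forall i, `|tnth y i : R| <= enorm y) ->
    (enorm y `^ (- e)) ^+ size s <= \prod_(i <- s) f (tnth y i).
  move=> yr ye; elim: s => [|i s IH]; first by rewrite big_nil expr0.
  rewrite big_cons exprS; apply: ler_pM; rewrite ?exprn_ge0 ?powR_ge0//.
  rewrite /f yr !powRN lef_pV2 ?posrE; last 2 first.
  - by rewrite powR_gt0//; have /andP[/lt_le_trans h _] := yr i; apply: h; exact: ye.
  - by rewrite powR_gt0//; have /andP[] := yr i.
  by apply: ge0_ler_powR; rewrite ?nnegrE ?enorm_ge0//; exact: ye.
apply: (@le_trans _ _ (\int[@leb R N]_y (\prod_(i < N) f (tnth y i))%:E)%E).
  apply: ae_ge0_le_integral => //.
  - by move=> y _; rewrite lee_fin; case: ifP => // _; exact: powR_ge0.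
  - apply/measurable_EFinP; apply: measurable_fun_if => //.
    + by apply: measurable_fun_ltr => //; exact: measurable_enorm.
    + apply: measurable_funTS; apply: (measurableT_comp (measurable_powR (- c))).
      exact: measurable_enorm.
  - by move=> y _; rewrite lee_fin prodr_ge0.
  - apply/measurable_EFinP; apply: measurable_prod => i _.
    by apply: (measurableT_comp mf); exact: measurable_tnth.
  - apply: filterS ae_tnth_neq0 => y y0 _; rewrite lee_fin; case: ifPn => [yr|_].
      have -> : enorm y `^ (- c) = (enorm y `^ (- e)) ^+ size (index_enum 'I_N).
        rewrite -sum1_size sum1_card card_ord.
        rewrite -powR_mulrn ?powR_ge0// -powRrM; congr (_ `^ _).
        by rewrite /e; field; rewrite gt_eqF.
      apply: fle => i; last exact: normr_tnth_le_enorm.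
      by rewrite normr_gt0 y0 (le_lt_trans (normr_tnth_le_enorm y i)).
    by rewrite prodr_ge0.
rewrite (@ge0_integral_leb_prod _ N (fun=> f))//.
have := integral_powR_interval e1 r0; rewrite -/f.
set I := (\int[_]_s _)%E => HI.
have I0 : (0 <= I)%E by apply: integral_ge0 => s _; exact: f0.
have IE : I = (fine I)%:E by rewrite fineK// ge0_fin_numE// (le_lt_trans HI)// ltry.
rewrite IE prodEFin lee_fin prodr_const card_ord.
apply: (@le_trans _ _ ((2 * (r `^ (1 - e) / (1 - e))) ^+ N)).
  apply: lerXn2r; rewrite ?nnegrE ?fine_ge0//; last by rewrite -lee_fin -IE.
  by rewrite mulr_ge0// divr_ge0 ?powR_ge0// ltW.
have -> : r `^ (N%:R - c) = (r `^ (1 - e)) ^+ N.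
  rewrite -powR_mulrn ?powR_ge0// -powRrM; congr (_ `^ _).
  by rewrite /e; field; rewrite gt_eqF.
rewrite -exprMn le_eqVlt; apply/orP; left; apply/eqP; congr (_ ^+ _); ring.
Qed.

End singular_integral.

Section weighted_heat.
Context {R : realType} {N : nat}.
Implicit Types (x y : Rn R N) (f : Rn R N -> \bar R) (gamma : R).
Local Open Scope ereal_scope.

(** [wnorm] for extended real functions: the majorants may be infinite on null sets, or everywhere
    before any bound is known. *)
Definition ewnorm (q : \bar R) gamma f : \bar R :=
  Lnorm (@leb R N) q (fun x => (enorm x `^ gamma)%:E * f x).

Lemma wnorm_ewnorm q gamma (f : Rn R N -> R) :
  wnorm q gamma f = ewnorm q gamma (EFin \o f).
Proof. exact: Lnorm_leb. Qed.

Lemma measurable_weight gamma f : measurable_fun setT f ->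
  measurable_fun setT (fun x => (enorm x `^ gamma)%:E * f x).
Proof.
move=> mf; apply: emeasurable_funM => //; apply/measurable_EFinP.
apply: (measurableT_comp (measurable_powR gamma)); exact: measurable_enorm.
Qed.

Lemma weight_ge0 gamma f x : (forall y, 0 <= f y) -> 0 <= (enorm x `^ gamma)%:E * f x.
Proof. by move=> f0; rewrite mule_ge0// lee_fin powR_ge0. Qed.

Lemma measurable_ball_patch f r : measurable_fun setT f ->
  measurable_fun setT (fun y : Rn R N => if (enorm y < r)%R then f y else 0).
Proof.
move=> mf; apply: measurable_fun_ifT => //.
by apply: measurable_fun_ltr => //; exact: measurable_enorm.
Qed.

(** Hölder's inequality on a ball: |y|^(- gamma) is of class L^q' there because gamma q' < N, q' the
    conjugate of q. This is the only access to the L^1 size of f near the origin, where the weight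
    degenerates. The power of r is the one given by scaling. *)
Lemma integral_ball_le (q : \bar R) gamma : (0 < N)%N -> 1 < q -> (0 < gamma)%R ->
  (gamma < N%:R * (1 - rinv q))%R ->
  exists2 C : R, (0 < C)%R & forall r f, (0 < r)%R ->
  measurable_fun setT f -> (forall x, 0 <= f x) ->
  \int[@leb R N]_y (if (enorm y < r)%R then f y else 0) <=
    (C * r `^ (N%:R * (1 - rinv q) - gamma))%:E * ewnorm q gamma f.
Proof.
move=> N0 q1 g0; case: q q1 => [q||//] q1; last first.
  rewrite rinv_infty subr0 mulr1 => gN.
  have [C C0 HC] := integral_ball_powR N0 (ltW g0) gN; exists C => // r f r0 mf f0.
  set G := ewnorm _ _ _; have G0 : 0 <= G by exact: Lnorm_ge0.
  have mball : measurable_fun setT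
      (fun y : Rn R N => (if (enorm y < r)%R then enorm y `^ (- gamma) else 0)%:E).
    apply/measurable_EFinP; apply: measurable_fun_ifT => //.
      by apply: measurable_fun_ltr => //; exact: measurable_enorm.
    apply: (measurableT_comp (measurable_powR (- gamma))); exact: measurable_enorm.
  have ball0 y : 0 <= (if (enorm y < r)%R then enorm y `^ (- gamma) else 0)%:E.
    by rewrite lee_fin; case: ifP => // _; exact: powR_ge0.
  apply: (@le_trans _ _ (\int[@leb R N]_y
      ((if (enorm y < r)%R then enorm y `^ (- gamma) else 0)%:E * G))); last first.
    by rewrite ge0_integralZr//; rewrite lee_wpmul2r// HC.
  apply: ae_ge0_le_integral => //.
  - by move=> y _; case: ifP.
  - exact: measurable_ball_patch.
  - by move=> y _; exact: mule_ge0.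
  - by apply: emeasurable_funM => //; exact: measurable_cst.
  have := Lnorm_infty_ae (@leb R N) (fun x => (enorm x `^ gamma)%:E * f x).
  rewrite -/(ewnorm _ _ _) -/G; apply: filterS2 (ae_enorm_gt0 N0) => y y0 fy _.
  case: ifP => _; last by rewrite mul0e.
  rewrite -[leLHS]mul1e -(mulVf (x := enorm y `^ gamma)) ?gt_eqF ?powR_gt0//.
  rewrite EFinM -muleA powRN lee_wpmul2l ?lee_fin ?invr_ge0 ?powR_ge0//.
  by apply: le_trans fy; rewrite gee0_abs// weight_ge0.
rewrite lte_fin in q1; have q0 : (0 < q)%R by rewrite (lt_trans ltr01).
rewrite rinv_fin ?gt_eqF// => gN.
have q10 : (0 < q - 1)%R by rewrite subr_gt0.
(* sg = gamma q'. Jensen is applied to |y|^sg f with respect to the weight |y|^(- sg); the integrand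
   becomes |y|^(sg q - sg) f^q, and sg (q - 1) = gamma q. *)
pose sg := (gamma * (q / (q - 1)))%R.
have sg0 : (0 < sg)%R by rewrite mulr_gt0// divr_gt0.
have sgN : (sg < N%:R)%R.
  rewrite /sg mulrA ltr_pdivrMr// -ltr_pdivlMr//.
  by apply: (lt_le_trans gN); rewrite le_eqVlt; apply/orP; left; apply/eqP; field; rewrite gt_eqF.
have [C C0 HC] := integral_ball_powR N0 (ltW sg0) sgN.
exists (C `^ ((q - 1) / q))%R; first by rewrite powR_gt0.
move=> r f r0 mf f0.
set G := ewnorm _ _ _; have G0 : 0 <= G by exact: Lnorm_ge0.
pose k (y : Rn R N) : R := if (enorm y < r)%R then (enorm y `^ (- sg))%R else 0%R.
pose K := (C * r `^ (N%:R - sg))%R.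
have K0 : (0 < K)%R by rewrite mulr_gt0// powR_gt0.
have mk : measurable_fun setT k.
  apply: measurable_fun_ifT => //.
    by apply: measurable_fun_ltr => //; exact: measurable_enorm.
  apply: (measurableT_comp (measurable_powR (- sg))); exact: measurable_enorm.
have k0 y : (0 <= k y)%R by rewrite /k; case: ifP => // _; exact: powR_ge0.
pose h y := (enorm y `^ sg)%:E * f y.
have mh : measurable_fun setT h by exact: measurable_weight.
have h0 y : 0 <= h y by exact: weight_ge0.
have := integral_weight_powR (ltW q1) K0 mk k0 mh h0 (HC r r0).
have -> : \int[@leb R N]_y ((k y)%:E * h y) =
    \int[@leb R N]_y (if (enorm y < r)%R then f y else 0).
  apply: ge0_ae_eq_integral => //.
  - by apply: emeasurable_funM => //; apply/measurable_EFinP.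
  - exact: measurable_ball_patch.
  - by move=> y _; rewrite mule_ge0 ?lee_fin.
  - by move=> y _; case: ifP.
  - apply: filterS (ae_enorm_gt0 N0) => y y0 _; rewrite /k /h.
    case: ifP => _; last by rewrite mul0e.
    by rewrite muleA -EFinM powRN mulVf ?mul1e// gt_eqF// powR_gt0.
move=> H; rewrite -(poweR_le_swap q0); last 2 first.
- by apply: integral_ge0 => y _; case: ifP.
- by rewrite mule_ge0// lee_fin mulr_ge0 ?powR_ge0.
apply: (le_trans H).
rewrite poweRM// ?lee_fin ?mulr_ge0 ?powR_ge0//.
have -> : G `^ q = \int[@leb R N]_y ((enorm y `^ gamma)%:E * f y) `^ q.
  rewrite /G /ewnorm poweR_Lnorm ?gt_eqF//; apply: eq_integral => y _.
  by rewrite gee0_abs// weight_ge0.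
apply: lee_pmul.
- by rewrite lee_fin powR_ge0.
- by apply: integral_ge0 => y _; rewrite mule_ge0 ?lee_fin ?poweR_ge0.
- rewrite lee_fin /K (powRM _ (ltW C0) (powR_ge0 r _)).
  rewrite (powRM _ (powR_ge0 C _) (powR_ge0 r _)) -!powRrM.
  rewrite divfK ?gt_eqF//.
  rewrite le_eqVlt; apply/orP; left; apply/eqP; congr (_ * _ `^ _)%R.
  by rewrite /sg; field; rewrite !gt_eqF.
apply: ge0_le_integral => //.
- by move=> y _; rewrite mule_ge0 ?lee_fin ?poweR_ge0.
- apply: emeasurable_funM; first by apply/measurable_EFinP.
  exact: measurable_poweR_comp.
- by apply: measurable_poweR_comp; exact: measurable_weight.
move=> y _; rewrite /k /h; case: ifP => _; last by rewrite mul0e poweR_ge0.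
(* 0 to a nonzero power is 0, so the weight vanishes at the origin instead of being infinite. *)
have [y0|y0] := eqVneq (enorm y) 0%R.
  by rewrite y0 powR0 ?oppr_eq0 ?gt_eqF// mul0e poweR_ge0.
rewrite !poweRM ?lee_fin ?powR_ge0// muleA poweR_EFin -EFinM -!powRrM -powRD ?y0 ?implybT//.
rewrite poweR_EFin -powRrM.
rewrite le_eqVlt; apply/orP; left; apply/eqP; congr (_%:E * _); congr (_ `^ _)%R.
by rewrite /sg; field; rewrite !gt_eqF.
Qed.

(** The weight at x is moved to y through |x|^gamma <= 2^gamma (|x - y|^gamma + |y|^gamma). The
    factor |x - y|^gamma turns into t^(gamma / 2) by doubling the time of the kernel, and t^(gamma /
    2) is at most |y|^gamma outside the ball of radius sqrt t. Inside that ball f is only known in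
    L^1, and the bound from L^1 to L^r takes over. *)
Lemma ewnorm_heat_op_le (q r : \bar R) gamma : (0 < N)%N -> 1 < q -> q <= r ->
  (r = +oo -> q = +oo) -> (0 < gamma)%R -> (gamma < N%:R * (1 - rinv q))%R ->
  exists2 C : R, (0 < C)%R & forall t f, (0 < t)%R ->
  measurable_fun setT f -> (forall x, 0 <= f x) ->
  ewnorm r gamma (heat_op t f) <=
    (C * t `^ (- (N%:R / 2 * (rinv q - rinv r))))%:E * ewnorm q gamma f.
Proof.
move=> N0 q1 qr rq g0 gN.
have r1 : 1 <= r by rewrite (le_trans (ltW q1)).
have r0 : 0 < r by rewrite (lt_le_trans _ r1)// lte_fin.
have [C1 C10 H1] := @heat_kernel_weight R N gamma g0.
have [C2 C20 H2] := integral_ball_le N0 q1 g0 gN.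
pose K := (2 `^ gamma * (C1 + 2 `^ (N%:R / 2)))%R.
have K0 : (0 < K)%R by rewrite mulr_gt0 ?powR_gt0// addr_gt0// powR_gt0.
pose e := (N%:R / 2 * (rinv q - rinv r))%R.
pose e1 := (N%:R / 2 * (1 - rinv r))%R.
pose C3 := ((8 * pi) `^ (- e) + (8 * pi) `^ (- e1) * C2)%R.
have p8 : (0 < 8 * pi :> R)%R by rewrite mulr_gt0 ?pi_gt0.
have C30 : (0 < C3)%R by rewrite addr_gt0 ?powR_gt0// mulr_gt0 ?powR_gt0.
exists (K * C3)%R; first exact: mulr_gt0.
move=> t f t0 mf f0; set G := ewnorm q gamma f.
have G0 : 0 <= G by exact: Lnorm_ge0.
have tg0 : (0 <= t `^ (gamma / 2))%R by exact: powR_ge0.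
pose g y := (enorm y `^ gamma)%:E * f y.
have mg : measurable_fun setT g by exact: measurable_weight.
have gE0 y : 0 <= g y by exact: weight_ge0.
(* The radius sqrt t is where |y|^gamma and t^(gamma / 2) balance. *)
pose b y := if (enorm y < Num.sqrt t)%R then f y else 0.
have mb : measurable_fun setT b by exact: measurable_ball_patch.
have b0 y : 0 <= b y by rewrite /b; case: ifP.
pose h y := (t `^ (gamma / 2))%:E * b y.
have mh : measurable_fun setT h by exact: measurable_funeM.
have h0 y : 0 <= h y by rewrite mule_ge0.
have fgh y : (t `^ (gamma / 2))%:E * f y <= g y + h y.
  rewrite /h /b; case: ifPn => [_|]; first by rewrite leeDr.
  rewrite -leNgt mule0 adde0 /g => ty; rewrite lee_wpmul2r// lee_fin powR_enorm.
  have t2 : (t <= enorm y ^+ 2)%R.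
    by rewrite -(sqr_sqrtr (ltW t0)) lerXn2r// nnegrE ?sqrtr_ge0 ?enorm_ge0.
  by apply: ge0_ler_powR; rewrite ?nnegrE ?sqr_ge0 ?divr_ge0// ltW.
have t20 : (0 < 2 * t)%R by rewrite mulr_gt0.
have mgh : measurable_fun setT (fun y => g y + h y) by exact: emeasurable_funD.
have gh0 y : 0 <= g y + h y by exact: adde_ge0.
have mHg : measurable_fun setT (heat_op (2 * t) g) by exact: measurable_heat_op.
have mHh : measurable_fun setT (heat_op (2 * t) h) by exact: measurable_heat_op.
have Hle x : (enorm x `^ gamma)%:E * heat_op t f x <=
    K%:E * (heat_op (2 * t) g x + heat_op (2 * t) h x).
  have -> : heat_op (2 * t) g x + heat_op (2 * t) h x =
      heat_op (2 * t) (fun y => g y + h y) x.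
    rewrite /heat_op -ge0_integralD//.
    - by apply: eq_integral => y _; rewrite ge0_muleDr.
    - by move=> y _; rewrite mule_ge0// lee_fin heat_kernel_ge0.
    - exact: measurable_heat_op_section.
    - by move=> y _; rewrite mule_ge0// lee_fin heat_kernel_ge0.
    - exact: measurable_heat_op_section.
  have hk0 s y : (0 <= heat_kernel s (rnsub x y))%R by exact: heat_kernel_ge0.
  rewrite /heat_op -!ge0_integralZl ?lee_fin ?powR_ge0 ?(ltW K0)//; last 4 first.
  - exact: measurable_heat_op_section.
  - by move=> y _; rewrite mule_ge0// lee_fin.
  - exact: measurable_heat_op_section.
  - by move=> y _; rewrite mule_ge0// lee_fin.
  apply: ge0_le_integral => //.
  - by move=> y _; rewrite !mule_ge0 ?lee_fin ?powR_ge0.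
  - by apply: measurable_funeM; exact: measurable_heat_op_section.
  - by apply: measurable_funeM; exact: measurable_heat_op_section.
  move=> y _; have gy0 := gE0 y; have hy0 := h0 y; have fy0 := f0 y.
  set k2 := heat_kernel (2 * t) (rnsub x y).
  have k20 : (0 <= k2)%R by exact: heat_kernel_ge0.
  have kk : (enorm x `^ gamma * heat_kernel t (rnsub x y) <=
      2 `^ gamma * (C1 * k2 * t `^ (gamma / 2) + 2 `^ (N%:R / 2) * k2 * enorm y `^ gamma))%R.
    have := enorm_powR_le x y (ltW g0).
    move=> /(ler_wpM2r (hk0 t y)) /le_trans; apply.
    rewrite -[leLHS]mulrA ler_wpM2l ?powR_ge0// mulrDl lerD//.
      by apply: le_trans (H1 t (rnsub x y) t0) _; rewrite -/k2 mulrAC.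
    rewrite mulrC ler_wpM2r ?powR_ge0//; exact: heat_kernel_double.
  apply: (@le_trans _ _ ((2 `^ gamma)%:E * ((C1 * k2)%:E * ((t `^ (gamma / 2))%:E * f y)
      + (2 `^ (N%:R / 2) * k2)%:E * g y))).
    rewrite muleA -EFinM; apply: (@le_trans _ _ ((2 `^ gamma * (C1 * k2 * t `^ (gamma / 2) +
       2 `^ (N%:R / 2) * k2 * enorm y `^ gamma))%:E * f y)).
      by rewrite lee_wpmul2r// lee_fin.
    rewrite EFinM -muleA EFinD ge0_muleDl ?lee_fin ?mulr_ge0 ?powR_ge0 ?(ltW C10)//.
    by rewrite /g !muleA -!EFinM !mulrA.
  rewrite [in leRHS]/K [in leRHS]EFinM -[leRHS]muleA lee_wpmul2l ?lee_fin ?powR_ge0//.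
  rewrite EFinD ge0_muleDl ?lee_fin ?powR_ge0 ?(ltW C10)//.
  rewrite (EFinM C1 k2) (EFinM _ k2) -!muleA; apply: leeD.
    by do 2 (rewrite lee_wpmul2l ?lee_fin ?(ltW C10)//).
  by rewrite lee_wpmul2l ?lee_fin ?powR_ge0// lee_wpmul2l ?lee_fin// leeDl.
have Ig : Lnorm (@leb R N) r (heat_op (2 * t) g) <=
    ((8 * pi) `^ (- e) * t `^ (- e))%:E * G.
  have := Lnorm_heat_op (ltW q1) qr rq t20 mg gE0.
  rewrite -/e (_ : (4 * pi * (2 * t) = 8 * pi * t)%R); last by ring.
  by rewrite powRM ?(ltW p8) ?(ltW t0).
have Ih : Lnorm (@leb R N) r (heat_op (2 * t) h) <=
    ((8 * pi) `^ (- e1) * C2 * t `^ (- e))%:E * G.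
  have := Lnorm_heat_op1 r1 t20 mh h0.
  rewrite -/e1 (_ : (4 * pi * (2 * t) = 8 * pi * t)%R); last by ring.
  rewrite powRM ?(ltW p8) ?(ltW t0)// => /le_trans; apply.
  rewrite /h ge0_integralZl//.
  have st0 : (0 < Num.sqrt t)%R by rewrite sqrtr_gt0.
  have := H2 _ _ st0 mf f0; rewrite -/G => Hb.
  apply: (@le_trans _ _ (((8 * pi) `^ (- e1) * t `^ (- e1))%:E * ((t `^ (gamma / 2))%:E *
      ((C2 * Num.sqrt t `^ (N%:R * (1 - rinv q) - gamma))%:E * G)))).
    by rewrite lee_wpmul2l ?lee_fin ?mulr_ge0 ?powR_ge0// lee_wpmul2l ?lee_fin.
  rewrite !muleA -!EFinM lee_wpmul2r// lee_fin.
  rewrite -powR12_sqrt ?(ltW t0)// -powRrM.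
  have -> : ((8 * pi) `^ (- e1) * t `^ (- e1) * t `^ (gamma / 2) *
    (C2 * t `^ (2^-1 * (N%:R * (1 - rinv q) - gamma))) =
    (8 * pi) `^ (- e1) * C2 * (t `^ (- e1) * t `^ (gamma / 2) *
    t `^ (2^-1 * (N%:R * (1 - rinv q) - gamma))))%R by ring.
  rewrite -!powRD ?(gt_eqF t0) ?implybT//.
  (* The powers of t combine as - e1 + gamma / 2 + (N (1 - 1/q) - gamma) / 2 = - e: the inner part
     has the same rate as the outer one. *)
  rewrite le_eqVlt; apply/orP; left; apply/eqP; congr (_ * _ `^ _)%R.
  by rewrite /e1 /e; field.
apply: (@le_trans _ _ (Lnorm (@leb R N) r (fun x =>
    K%:E * (heat_op (2 * t) g x + heat_op (2 * t) h x)))).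
  apply: le_Lnorm => //.
  - by apply: measurable_weight; exact: measurable_heat_op.
  - by apply: measurable_funeM; exact: emeasurable_funD.
  - apply: aeW => x; rewrite !gee0_abs//.
    + by rewrite mule_ge0 ?lee_fin ?(ltW K0)// adde_ge0// heat_op_ge0.
    + by rewrite weight_ge0// => y; exact: heat_op_ge0.
apply: (le_trans (LnormZ_le _ r0 (ltW K0) _)); first exact: emeasurable_funD.
rewrite -(mulrA K C3) (EFinM K) -[leRHS]muleA lee_wpmul2l ?lee_fin ?(ltW K0)//.
apply: (le_trans (LnormD_le _ r1 mHg mHh)).
apply: (le_trans (leeD Ig Ih)); rewrite -/e.
rewrite -ge0_muleDl ?lee_fin ?mulr_ge0 ?powR_ge0 ?(ltW C20)//.
by rewrite -EFinD -mulrDl.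
Qed.

End weighted_heat.

(** * The Duhamel operator *)

Section monotone_limits.
Context {R : realType}.
Local Open Scope ereal_scope.

Lemma ereal_nondecreasing_le_limn (u : (\bar R)^nat) n :
  nondecreasing_seq u -> u n <= limn u.
Proof.
move=> ndu; rewrite (cvg_lim _ (ereal_nondecreasing_cvgn ndu))//.
by apply: ereal_sup_ubound; exists n.
Qed.

(** The power is an order isomorphism of [0, oo] with inverse the power 1 / p, so it commutes with
    increasing limits; no continuity at +oo has to be discussed. *)
Lemma poweR_limn (u : (\bar R)^nat) (p : R) : (0 < p)%R -> (forall n, 0 <= u n) ->
  nondecreasing_seq u -> (limn u) `^ p = limn (fun n => u n `^ p).
Proof.
move=> p0 u0 ndu.
have ndup : nondecreasing_seq (fun n => u n `^ p).
  by move=> m n mn; rewrite poweR_le_swap//; exact: ndu.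
have cu := ereal_nondecreasing_is_cvgn ndu.
have cup := ereal_nondecreasing_is_cvgn ndup.
have L0 : 0 <= limn u by apply: lime_ge => //; exact: nearW.
have Lp0 : 0 <= limn (fun n => u n `^ p).
  by apply: lime_ge => //; apply: nearW => n; exact: poweR_ge0.
apply/eqP; rewrite eq_le; apply/andP; split; last first.
  apply: lime_le => //; apply: nearW => n; rewrite poweR_le_swap//.
  exact: ereal_nondecreasing_le_limn.
set L := limn (fun n => u n `^ p); have pV0 : (0 < p^-1)%R by rewrite invr_gt0.
have -> : L = (L `^ p^-1) `^ p by rewrite -poweRrM mulVf ?gt_eqF// poweRe1.
rewrite poweR_le_swap ?poweR_ge0//; apply: lime_le => //; apply: nearW => n /=.
have -> : u n = (u n `^ p) `^ p^-1 by rewrite -poweRrM divff ?gt_eqF// poweRe1.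
by rewrite poweR_le_swap ?poweR_ge0//; exact: ereal_nondecreasing_le_limn.
Qed.

Lemma mule_limn (u : (\bar R)^nat) (c : R) : nondecreasing_seq u ->
  c%:E * limn u = limn (fun n => c%:E * u n).
Proof.
move=> ndu; apply/esym/cvg_lim => //; apply: cvgeZl => //.
exact: ereal_nondecreasing_is_cvgn.
Qed.

Lemma Lnorm_limn_le d (T : measurableType d) (mu : {measure set T -> \bar R})
    (p : \bar R) (f : (T -> \bar R)^nat) (K : \bar R) : 0 < p -> 0 <= K ->
  (forall n, measurable_fun setT (f n)) -> (forall n x, 0 <= f n x) ->
  (forall x, nondecreasing_seq (f ^~ x)) ->
  (forall n, Lnorm mu p (f n) <= K) -> Lnorm mu p (fun x => limn (f ^~ x)) <= K.
Proof.
move=> p0 K0 mf f0 ndf fK.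
have L0 x : 0 <= limn (f ^~ x).
  by apply: lime_ge; [exact: ereal_nondecreasing_is_cvgn|exact: nearW].
case: p p0 fK => [p||//] p0 fK; last first.
  apply/Lnorm_infty_leP => //.
  have : {ae mu, forall x, forall n, `|f n x| <= K}.
    by apply: ae_foralln => n; apply/Lnorm_infty_leP.
  apply: filterS => x fxK; rewrite gee0_abs//; apply: lime_le.
    exact: ereal_nondecreasing_is_cvgn.
  by apply: nearW => n; rewrite -[leLHS]gee0_abs.
rewrite Lnorm_fin_leP//.
under eq_integral do rewrite gee0_abs// poweR_limn//.
have ndfp x : nondecreasing_seq (fun n => f n x `^ p).
  by move=> m n mn; rewrite poweR_le_swap//; exact: ndf.
have mfp n : measurable_fun setT (fun x => f n x `^ p) by exact: measurable_poweR_comp.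
have := @cvg_monotone_convergence _ _ _ mu setT measurableT
  (fun n x => f n x `^ p) mfp (fun n x _ => poweR_ge0 _ _) (fun x _ => ndfp x).
move=> /cvg_lim <-//; apply: lime_le.
  apply: ereal_nondecreasing_is_cvgn => m n mn.
  by apply: ge0_le_integral => //; [move=> x _; exact: poweR_ge0|move=> x _; exact: ndfp].
apply: nearW => n; have := fK n; rewrite Lnorm_fin_leP//; apply: le_trans.
by rewrite le_eqVlt; apply/orP; left; apply/eqP; apply: eq_integral => x _; rewrite gee0_abs.
Qed.

(* Kleene iteration from 0; the invariant [good] is passed to the limit. *)
Lemma monotone_fixpoint (T : Type) (Phi : (T -> \bar R) -> T -> \bar R)
    (good : (T -> \bar R) -> Prop) :
  (forall u, good u -> forall x, 0 <= u x) ->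
  good (fun=> 0) ->
  (forall u, good u -> good (Phi u)) ->
  (forall u v, good u -> good v -> (forall x, u x <= v x) ->
    forall x, Phi u x <= Phi v x) ->
  (forall u_ : (T -> \bar R)^nat, (forall n, good (u_ n)) ->
    (forall x, nondecreasing_seq (u_ ^~ x)) ->
    good (fun x => limn (u_ ^~ x)) /\
    forall x, Phi (fun x => limn (u_ ^~ x)) x = limn (fun n => Phi (u_ n) x)) ->
  exists2 u, good u & forall x, u x = Phi u x.
Proof.
move=> good0 good_0 goodPhi ndPhi contPhi.
pose u_ n := iter n Phi (fun=> 0).
have gu n : good (u_ n) by elim: n => // n; exact: goodPhi.
have ndu1 n x : u_ n x <= u_ n.+1 x.
  elim: n x => [|n IH] x; first exact: good0 (gu 1%N) x.
  by apply: ndPhi => //; exact: (gu n.+1).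
have ndu x : nondecreasing_seq (u_ ^~ x).
  by apply/nondecreasing_seqP => n; exact: ndu1.
have [gl Pl] := contPhi u_ gu ndu.
exists (fun x => limn (u_ ^~ x)) => // x; rewrite Pl.
have cu := ereal_nondecreasing_is_cvgn (ndu x).
apply/esym/cvg_lim => //.
by have := cu; rewrite -(cvg_shiftS (u_ ^~ x)).
Qed.

End monotone_limits.

(** A name for the product measure, to which a sigma-finite structure is attached, so that Tonelli
    applies with space-time as one of the factors. *)
Definition leb_spacetime (R : realType) N : set (measurableTypeR R * Rn R N) -> \bar R :=
  (@lebesgue_measure R \x @leb R N)%E.

Section leb_spacetime_measure.
Context {R : realType} (N : nat).
Local Notation prod := ((@lebesgue_measure R \x @leb R N)%E :
  {measure set (measurableTypeR R * Rn R N) -> \bar R}).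
Let mu0 : @leb_spacetime R N set0 = 0%E := measure0 prod.
Let mu_ge0 A : (0 <= @leb_spacetime R N A)%E := measure_ge0 prod A.
Let mu_sigma_additive : semi_sigma_additive (@leb_spacetime R N) :=
  @measure_semi_sigma_additive _ _ _ prod.
HB.instance Definition _ := isMeasure.Build _ _ _ (@leb_spacetime R N)
  mu0 mu_ge0 mu_sigma_additive.
Let mu_sigma_finite : sigma_finite setT (@leb_spacetime R N).
Proof.
have /sigma_finiteP[F [TF ndF Foo]] := sigma_finiteT (@lebesgue_measure R).
have /sigma_finiteP[G [TG ndG Goo]] := sigma_finiteT (@leb R N).
exists (fun n => F n `*` G n).
  rewrite -setXTT TF TG; apply/seteqP; split => -[x y] /=.
    move=> [[n _ Fnx] [k _ Gky]]; exists (maxn n k) => //; split.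
    - by move: x Fnx; exact/subsetPset/ndF/leq_maxl.
    - by move: y Gky; exact/subsetPset/ndG/leq_maxr.
  by move=> [n _ []/= ? ?]; split; exists n.
move=> k; have [? ?] := Foo k; have [? ?] := Goo k; split; first exact: measurableX.
by rewrite [ltLHS]product_measure1E// lte_mul_pinfty// ge0_fin_numE.
Qed.
HB.instance Definition _ := @Measure_isSigmaFinite.Build _ _ R (@leb_spacetime R N)
  mu_sigma_finite.
End leb_spacetime_measure.

Section duhamel.
Context {R : realType} {N : nat}.
Local Notation spacetime := (measurableTypeR R * Rn R N)%type.
Local Notation mu := (@leb_spacetime R N).
Implicit Types (w z : spacetime) (g : spacetime -> \bar R) (x y : Rn R N).

(** With the cut-off 0 < s < t inside the kernel, the Duhamel term is a single integral over all of
    space-time, jointly measurable in (t, x), and involves the source at positive times only. *)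
Definition duhamel_kernel w z : R :=
  if (0 < z.1 < w.1)%R then heat_kernel (w.1 - z.1) (rnsub w.2 z.2) else 0%R.

Local Open Scope ereal_scope.

Definition duhamel g w : \bar R := \int[mu]_z ((duhamel_kernel w z)%:E * g z).

Lemma duhamel_kernel_ge0 w z : (0 <= duhamel_kernel w z)%R.
Proof. by rewrite /duhamel_kernel; case: ifP => // _; exact: heat_kernel_ge0. Qed.

Lemma measurable_duhamel_kernel :
  measurable_fun [set: spacetime * spacetime] (fun v => duhamel_kernel v.1 v.2).
Proof.
have m1 : measurable_fun [set: spacetime * spacetime] (fun v => v.1.1 : R).
  exact: (measurableT_comp measurable_fst).
have m2 : measurable_fun [set: spacetime * spacetime] (fun v => v.2.1 : R).
  exact: (measurableT_comp measurable_fst).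
have n1 : measurable_fun [set: spacetime * spacetime] (fun v => v.1.2).
  exact: (measurableT_comp measurable_snd).
have n2 : measurable_fun [set: spacetime * spacetime] (fun v => v.2.2).
  exact: (measurableT_comp measurable_snd).
apply: measurable_fun_ifT => //.
  by apply: measurable_and; exact: measurable_fun_ltr.
apply: measurable_heat_kernel; first exact: measurable_funB.
exact: measurable_rnsub.
Qed.

Lemma measurable_duhamel_kernel_section w :
  measurable_fun [set: spacetime] (duhamel_kernel w).
Proof. exact: (measurable_fun_pair2 w measurable_duhamel_kernel). Qed.

Lemma measurable_duhamel_integrand g w : measurable_fun setT g ->
  measurable_fun [set: spacetime] (fun z => (duhamel_kernel w z)%:E * g z).
Proof.
move=> mg; apply: emeasurable_funM => //; apply/measurable_EFinP.
exact: measurable_duhamel_kernel_section.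
Qed.

Lemma duhamel_integrand_ge0 g w z : (forall z, 0 <= g z) ->
  0 <= (duhamel_kernel w z)%:E * g z.
Proof. by move=> g0; rewrite mule_ge0// lee_fin duhamel_kernel_ge0. Qed.

Lemma duhamel_ge0 g w : (forall z, 0 <= g z) -> 0 <= duhamel g w.
Proof. by move=> g0; apply: integral_ge0 => z _; exact: duhamel_integrand_ge0. Qed.

Lemma measurable_duhamel g : measurable_fun setT g -> (forall z, 0 <= g z) ->
  measurable_fun setT (duhamel g).
Proof.
move=> mg g0.
have mI : measurable_fun [set: spacetime * spacetime]
    (fun v => (duhamel_kernel v.1 v.2)%:E * g v.2).
  apply: emeasurable_funM; last exact: measurableT_comp.
  by apply/measurable_EFinP; exact: measurable_duhamel_kernel.
have I0 v : 0 <= (duhamel_kernel v.1 v.2)%:E * g v.2 by exact: duhamel_integrand_ge0.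
have H := measurable_fun_fubini_tonelli_F (m2 := mu) _ mI I0.
exact: H.
Qed.

Lemma le_duhamel f g w : measurable_fun setT f -> measurable_fun setT g ->
  (forall z, 0 <= f z) -> (forall z, f z <= g z) -> duhamel f w <= duhamel g w.
Proof.
move=> mf mg f0 fg; apply: ge0_le_integral => //.
- by move=> z _; exact: duhamel_integrand_ge0.
- exact: measurable_duhamel_integrand.
- exact: measurable_duhamel_integrand.
- by move=> z _; rewrite lee_wpmul2l// lee_fin duhamel_kernel_ge0.
Qed.

Lemma duhamel_limn (g : (spacetime -> \bar R)^nat) w :
  (forall n, measurable_fun setT (g n)) -> (forall n z, 0 <= g n z) ->
  (forall z, nondecreasing_seq (g ^~ z)) ->
  duhamel (fun z => limn (g ^~ z)) w = limn (fun n => duhamel (g n) w).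
Proof.
move=> mg g0 ndg; rewrite /duhamel.
under eq_integral do rewrite mule_limn//.
apply/esym/cvg_lim => //.
apply: (cvg_monotone_convergence measurableT) => //.
- by move=> n; exact: measurable_duhamel_integrand.
- by move=> n z _; exact: duhamel_integrand_ge0.
- move=> z _ m n mn; rewrite lee_wpmul2l ?lee_fin ?duhamel_kernel_ge0//.
  exact: ndg.
Qed.

Lemma duhamelE g t x : measurable_fun setT g -> (forall z, 0 <= g z) ->
  duhamel g (t, x) =
  \int[@lebesgue_measure R]_s
    (if (0 < s < t)%R then heat_op (t - s) (fun y => g (s, y)) x else 0).
Proof.
move=> mg g0; rewrite [LHS](fubini_tonelli1 (m1 := @lebesgue_measure R) (m2 := @leb R N)); last 2 first.
- exact: measurable_duhamel_integrand.
- by move=> z; exact: duhamel_integrand_ge0.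
apply: eq_integral => s _; rewrite /fubini_F /duhamel_kernel /=.
case: ifP => _ //; by under eq_integral do rewrite mul0e; rewrite integral0.
Qed.

End duhamel.

(** * Weighted norms of the Duhamel term and of its time increments *)

Section duhamel_norm.
Context {R : realType} {N : nat}.
Local Notation spacetime := (measurableTypeR R * Rn R N)%type.
Local Notation mu := (@leb_spacetime R N).
Variables (q : \bar R) (gamma : R).
Hypotheses (N0 : (0 < N)%N) (q1 : (1 < q)%E) (gamma0 : 0 < gamma)
  (gammaN : gamma < N%:R * (1 - rinv q)).
Implicit Types (g : spacetime -> \bar R).
Local Open Scope ereal_scope.

Let measurable_time_itv (t : R) :
  measurable_fun [set: spacetime] (fun z => (0 < (z.1 : R) < t)%R).
Proof. by apply: measurable_and; exact: measurable_fun_ltr. Qed.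

Let measurable_kappa (c t a b : R) : measurable_fun setT
  (fun s : R => if (0 < s < t)%R then (c * ((t - s) `^ (- a) * s `^ (- b)))%R else 0%R).
Proof.
apply: measurable_fun_ifT => //; first by apply: measurable_and; exact: measurable_fun_ltr.
apply: measurable_funM => //; apply: measurable_funM; last exact: measurable_powR.
by apply: (measurableT_comp (measurable_powR (- a))); exact: measurable_funB.
Qed.

Let integral_kappa (c t a b : R) : (0 <= c)%R ->
  \int[@lebesgue_measure R]_s
    (if (0 < s < t)%R then (c * ((t - s) `^ (- a) * s `^ (- b)))%R else 0%R)%:E =
  c%:E * \int[@lebesgue_measure R]_s
    (if (0 < s < t)%R then ((t - s) `^ (- a) * s `^ (- b))%R else 0%R)%:E.
Proof.
move=> c0; rewrite -ge0_integralZl//.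
- by apply: eq_integral => s _; case: ifP => // _; rewrite ?mulr0 ?mule0.
- apply/measurable_EFinP; have := measurable_kappa 1 t a b.
  by under eq_fun do rewrite mul1r.
- by move=> s _; rewrite lee_fin; case: ifP => // _; rewrite mulr_ge0 ?powR_ge0.
Qed.

(** Minkowski's integral inequality in time with kappa (s) = C G (t - s)^(- e) s^(- b), e being the
    smoothing rate from L^q to L^r; the Beta integral of kappa produces t^(1 - e - b). *)
Lemma ewnorm_duhamel_le (r : \bar R) (b : R) : q <= r -> (r = +oo -> q = +oo) ->
  (N%:R / 2 * (rinv q - rinv r) < 1)%R -> (rinv r <= rinv q)%R ->
  (0 <= b)%R -> (b < 1)%R ->
  exists2 C : R, (0 < C)%R & forall g (G t : R), (0 < G)%R -> (0 < t)%R ->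
  measurable_fun setT g -> (forall z, 0 <= g z) ->
  (forall s : R, (0 < s < t)%R ->
    ewnorm q gamma (fun y => g (s, y)) <= (G * s `^ (- b))%:E) ->
  ewnorm r gamma (fun x => duhamel g (t, x)) <=
    (C * G * t `^ (1 - N%:R / 2 * (rinv q - rinv r) - b))%:E.
Proof.
move=> qr rq e1 rqi b0 b1; set e := (N%:R / 2 * (rinv q - rinv r))%R in e1 *.
have e0 : (0 <= e)%R by rewrite mulr_ge0 ?subr_ge0// divr_ge0.
have [C C0 HC] := ewnorm_heat_op_le N0 q1 qr rq gamma0 gammaN.
have [B B0 HB] := integral_beta_le e0 e1 b0 b1.
have r1 : 1 <= r by rewrite (le_trans (ltW q1)).
exists (C * B)%R; first exact: mulr_gt0.
move=> g G t G0 t0 mg g0 gG.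
pose kappa (s : R) : R :=
  if (0 < s < t)%R then (C * G * ((t - s) `^ (- e) * s `^ (- b)))%R else 0%R.
have CG0 : (0 <= C * G)%R by rewrite mulr_ge0// ltW.
pose J (z : spacetime) := (enorm z.2 `^ gamma)%:E *
  (if (0 < z.1 < t)%R then heat_op (t - z.1) (fun y => g (z.1, y)) z.2 else 0).
have mgs s : measurable_fun setT (fun y => g (s, y)) by exact: measurable_fun_pair2.
have mH : measurable_fun [set: spacetime]
    (fun z => heat_op (t - z.1) (fun y => g (z.1, y)) z.2).
  have mI : measurable_fun [set: spacetime * Rn R N]
    (fun v => (heat_kernel (t - v.1.1) (rnsub v.1.2 v.2))%:E * g (v.1.1, v.2)).
    have m1 : measurable_fun [set: spacetime * Rn R N] (fun v => v.1.1 : R).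
      exact: (measurableT_comp measurable_fst).
    have m2 : measurable_fun [set: spacetime * Rn R N] (fun v => v.1.2).
      exact: (measurableT_comp measurable_snd).
    apply: emeasurable_funM.
      apply/measurable_EFinP; apply: measurable_heat_kernel.
        exact: measurable_funB.
      exact: measurable_rnsub.
    exact: (measurableT_comp mg (measurable_fun_pair m1 measurable_snd)).
  apply: (measurable_fun_fubini_tonelli_F (m2 := @leb R N) _ mI) => v.
  by rewrite mule_ge0// lee_fin heat_kernel_ge0.
have mJ : measurable_fun [set: spacetime] J.
  apply: emeasurable_funM; last exact: measurable_fun_ifT.
  apply/measurable_EFinP; apply: (measurableT_comp (measurable_powR gamma)).
  exact: (measurableT_comp measurable_enorm).
have J0 z : 0 <= J z.
  rewrite mule_ge0 ?lee_fin ?powR_ge0//; case: ifP => // _; exact: heat_op_ge0.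
have K0 : (0 < C * B * G * t `^ (1 - e - b))%R by rewrite !mulr_gt0// powR_gt0.
have := Lnorm_integral_le (nu := @lebesgue_measure R) (mu := @leb R N) (p := r)
  (kappa := kappa) r1 mJ J0 (measurable_kappa _ _ _ _) _ _ _ K0.
have -> : (fun x => \int[@lebesgue_measure R]_s J (s, x)) =
    (fun x => (enorm x `^ gamma)%:E * duhamel g (t, x)).
  apply/funext => x; rewrite /J /= duhamelE// ge0_integralZl ?lee_fin ?powR_ge0//.
    apply: measurable_fun_ifT => //; first by apply: measurable_and; exact: measurable_fun_ltr.
    exact: (measurable_fun_pair1 x mH).
  by move=> s _; case: ifP => // _; exact: heat_op_ge0.
apply.
- by move=> s; rewrite /kappa; case: ifP => // _; rewrite !mulr_ge0 ?powR_ge0// ltW.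
- move=> s; rewrite /kappa /J /=; case: ifP => [/andP[s0 st] /eqP|_ _ x]; last by rewrite mule0.
  by rewrite gt_eqF// !mulr_gt0 ?powR_gt0 ?subr_gt0.
- move=> s; rewrite /kappa /J /=; case: ifP => [/andP[s0 st]|_].
    have ts : (0 < t - s)%R by rewrite subr_gt0.
    apply: (le_trans (HC _ _ ts (mgs s) (fun y => g0 (s, y)))).
    rewrite -/e; apply: (@le_trans _ _ ((C * (t - s) `^ (- e))%:E * (G * s `^ (- b))%:E)).
      by rewrite lee_wpmul2l ?lee_fin ?mulr_ge0 ?powR_ge0 ?(ltW C0)// gG// s0 st.
    by rewrite -EFinM lee_fin le_eqVlt; apply/orP; left; apply/eqP; ring.
  under eq_fun do rewrite mule0.
  by rewrite Lnorm0// gt_eqF// (lt_le_trans _ r1)// lte_fin.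
- rewrite integral_kappa//; apply: (@le_trans _ _ ((C * G)%:E * (B * t `^ (1 - e - b))%:E)).
    by rewrite lee_wpmul2l ?lee_fin// HB.
  by rewrite -EFinM lee_fin le_eqVlt; apply/orP; left; apply/eqP; ring.
Qed.

Lemma ewnormZ_le (p : \bar R) (f : Rn R N -> \bar R) (c : R) : 0 < p -> (0 <= c)%R ->
  measurable_fun setT f -> ewnorm p gamma (fun x => c%:E * f x) <= c%:E * ewnorm p gamma f.
Proof.
move=> p0 c0 mf; apply: le_trans (LnormZ_le _ p0 c0 (measurable_weight gamma mf)).
by under eq_Lnorm do rewrite muleCA.
Qed.

Lemma ewnormD_le (p : \bar R) (f g : Rn R N -> \bar R) : 1 <= p ->
  measurable_fun setT f -> measurable_fun setT g ->
  (forall x, 0 <= f x) -> (forall x, 0 <= g x) ->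
  ewnorm p gamma (fun x => f x + g x) <= ewnorm p gamma f + ewnorm p gamma g.
Proof.
move=> p1 mf mg f0 g0.
apply: le_trans (LnormD_le _ p1 (measurable_weight gamma mf) (measurable_weight gamma mg)).
by rewrite le_eqVlt; apply/orP; left; apply/eqP; apply: eq_Lnorm => x; rewrite ge0_muleDr.
Qed.

Lemma le_ewnorm (p : \bar R) (f g : Rn R N -> \bar R) : 0 < p ->
  measurable_fun setT f -> measurable_fun setT g ->
  {ae @leb R N, forall x, `|f x| <= g x} -> ewnorm p gamma f <= ewnorm p gamma g.
Proof.
move=> p0 mf mg fg; apply: le_Lnorm => //; [exact: measurable_weight..|].
apply: filterS fg => x fgx; rewrite !abseM lee_wpmul2l//.
by rewrite (le_trans fgx)// lee_abs.
Qed.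

Lemma ewnorm0 (p : \bar R) : 0 < p -> ewnorm p gamma (fun _ : Rn R N => 0) = 0.
Proof.
move=> p0; rewrite /ewnorm; under eq_fun do rewrite mule0.
by rewrite Lnorm0// gt_eqF.
Qed.

(** Hölder continuity in time of the Duhamel term, with th = (1 - b) / 2. The half keeps th below 1
    even if b = 0, that is for q = +oo, and leaves the exponent 1 - th - b = th nonnegative, so that
    the bound is uniform for s down to 0. The absolute value is inside the integral because the
    estimate is later used for a signed source dominated by g. *)
Lemma ewnorm_duhamel_timeB (b : R) : (0 <= b)%R -> (b < 1)%R ->
  exists2 C : R, (0 < C)%R & forall g (G s t T : R), (0 < G)%R -> (0 <= s)%R ->
  (s < t)%R -> (t <= T)%R -> measurable_fun setT g -> (forall z, 0 <= g z) ->
  (forall r : R, (0 < r < t)%R ->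
    ewnorm q gamma (fun y => g (r, y)) <= (G * r `^ (- b))%:E) ->
  ewnorm q gamma (fun x => \int[mu]_z
      (`|duhamel_kernel (t, x) z - duhamel_kernel (s, x) z|%:E * g z)) <=
    (C * G * T `^ ((1 - b) / 2) * (t - s) `^ ((1 - b) / 2))%:E.
Proof.
move=> b0 b1; set th := ((1 - b) / 2)%R.
have th0 : (0 <= th)%R by rewrite divr_ge0// subr_ge0 ltW.
have th1 : (th < 1)%R by rewrite ltr_pdivrMr//; lra.
have [C C0 HC'] := ewnorm_heat_op_le N0 q1 (lexx q) (fun h => h) gamma0 gammaN.
have HC (t : R) (f : Rn R N -> \bar R) : (0 < t)%R -> measurable_fun setT f -> (forall x, 0 <= f x) ->
    ewnorm q gamma (heat_op t f) <= C%:E * ewnorm q gamma f.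
  by have := HC' t f; rewrite subrr mulr0 oppr0 powRr0 mulr1.
have [B B0 HB] := integral_beta_le th0 th1 b0 b1.
have q0 : 0 < q by rewrite (lt_trans _ q1)// lte_fin.
pose C4 : R := (1 + N%:R + 2 * 2 `^ (N%:R / 2))%R.
have C40 : (0 < C4)%R by rewrite /C4 -addrA ltr_wpDr// addr_ge0// mulr_ge0 ?powR_ge0.
exists (C * B * (1 + 3 * C4))%R.
  by rewrite !mulr_gt0// ltr_wpDr// mulr_ge0// ltW.
move=> g G s t T G0 s0 st tT mg g0 gG.
have t0 : (0 < t)%R by rewrite (le_lt_trans s0).
have d0 : (0 < t - s)%R by rewrite subr_gt0.
pose kap (a c r : R) : R := (if (0 < r < a)%R then c * ((a - r) `^ (- th) * r `^ (- b)) else 0)%R.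
pose c2 := (C * G * (t - s) `^ th)%R.
pose c1 := (3 * C4 * c2)%R.
have c20 : (0 < c2)%R by rewrite !mulr_gt0// powR_gt0.
have c10 : (0 < c1)%R by rewrite mulr_gt0// mulr_gt0.
have kap0 a c r : (0 <= c)%R -> (0 <= kap a c r)%R.
  by move=> c0; rewrite /kap; case: ifP => // _; rewrite !mulr_ge0 ?powR_ge0.
pose dk (x : Rn R N) (z : spacetime) : R := `|duhamel_kernel (t, x) z - duhamel_kernel (s, x) z|%R.
have dk0 (x : Rn R N) (z : spacetime) : (0 <= dk x z)%R by exact: normr_ge0.
have mdk : measurable_fun [set: spacetime * Rn R N] (fun v => dk v.1.2 (v.1.1, v.2)).
  have m1 : measurable_fun [set: spacetime * Rn R N] (fun v => v.1.1).
    exact: (measurableT_comp measurable_fst).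
  have m2 : measurable_fun [set: spacetime * Rn R N] (fun v => v.1.2).
    exact: (measurableT_comp measurable_snd).
  have mk a : measurable_fun [set: spacetime * Rn R N]
      (fun v => duhamel_kernel ((a : measurableTypeR R), v.1.2) (v.1.1, v.2)).
    apply: (measurableT_comp (measurable_duhamel_kernel (R := R) (N := N))
      (measurable_fun_pair (measurable_fun_pair (measurable_cst a) m2)
        (measurable_fun_pair m1 measurable_snd))).
  by apply: measurableT_comp => //; exact: measurable_funB.
have mdkg : measurable_fun [set: spacetime * Rn R N]
    (fun v => (dk v.1.2 (v.1.1, v.2))%:E * g (v.1.1, v.2)).
  apply: emeasurable_funM; first by apply/measurable_EFinP.
  have m1 : measurable_fun [set: spacetime * Rn R N] (fun v => v.1.1).
    exact: (measurableT_comp measurable_fst).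
  exact: (measurableT_comp mg (measurable_fun_pair m1 measurable_snd)).
have dkg0 (x : Rn R N) (z : spacetime) : 0 <= (dk x z)%:E * g z by rewrite mule_ge0 ?lee_fin.
pose J (z : spacetime) : \bar R := \int[@leb R N]_y ((dk z.2 (z.1, y))%:E * g (z.1, y)).
have mJ : measurable_fun [set: spacetime] J.
  have I0 (v : spacetime * Rn R N) : 0 <= (dk v.1.2 (v.1.1, v.2))%:E * g (v.1.1, v.2).
    by rewrite mule_ge0 ?lee_fin.
  exact: (measurable_fun_fubini_tonelli_F (m2 := @leb R N) _ mdkg I0).
have J0 z : 0 <= J z by exact: integral_ge0.
have mJs r : measurable_fun setT (fun x => J (r, x)) by exact: measurable_fun_pair2.
have mgs r : measurable_fun setT (fun y => g (r, y)) by exact: measurable_fun_pair2.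
have mkap a c : measurable_fun setT (kap a c) by exact: measurable_kappa.
pose kappa r := (kap t c2 r + kap s c1 r)%R.
have kapE c r : (0 < r < t)%R -> kap t c r = (c * ((t - r) `^ (- th) * r `^ (- b)))%R.
  by move=> h; rewrite /kap h.
have kapS c r : (0 < r < s)%R -> kap s c r = (c * ((s - r) `^ (- th) * r `^ (- b)))%R.
  by move=> h; rewrite /kap h.
have Jkappa r : ewnorm q gamma (fun x => J (r, x)) <= (kappa r)%:E.
  have [rt|rt] := boolP (0 < r < t)%R; last first.
    rewrite (_ : (fun x => _) = (fun=> 0)) ?ewnorm0// ?lee_fin ?addr_ge0 ?kap0 ?ltW//.
    have rs : (0 < r < s)%R = false.
      by apply/negbTE; apply: contra rt => /andP[-> /lt_trans]; exact.
    apply/funext => x; rewrite /J /dk /duhamel_kernel /= (negbTE rt) rs.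
    by rewrite subrr normr0; under eq_integral do rewrite mul0e; rewrite integral0.
  have /andP[r0 r_lt_t] := rt.
  have tr0 : (0 < t - r)%R by rewrite subr_gt0.
  have rb0 : (0 <= r `^ (- b))%R by exact: powR_ge0.
  have HCr a : (0 < a)%R ->
      ewnorm q gamma (heat_op a (fun y => g (r, y))) <= (C * (G * r `^ (- b)))%:E.
    move=> a0; apply: (le_trans (HC _ _ a0 (mgs r) (fun y => g0 (r, y)))).
    by rewrite EFinM lee_wpmul2l ?lee_fin ?(ltW C0)// gG.
  have mHr a : measurable_fun setT (heat_op a (fun y => g (r, y))) by exact: measurable_heat_op.
  have Hr0 a x : 0 <= heat_op a (fun y => g (r, y)) x by exact: heat_op_ge0.
  (* For r >= s only the kernel at time t is present, and ((t - s) / (t - r))^th >= 1 supplies the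
     small factor at the price of an integrable singularity at r = t. For r < s the Hölder bound of
     the kernel in time is used, with the singularity at r = s. *)
  have [rs|sr] := ltP r s; last first.
    rewrite (_ : (fun x => _) = heat_op (t - r) (fun y => g (r, y))).
      apply: (le_trans (HCr _ tr0)); rewrite lee_fin.
      apply: (@le_trans _ _ (kap t c2 r)); last by rewrite lerDl kap0// ltW.
      rewrite kapE//.
      have -> : (c2 * ((t - r) `^ (- th) * r `^ (- b)) =
          C * (G * r `^ (- b)) * ((t - s) `^ th * (t - r) `^ (- th)))%R.
        by rewrite /c2; ring.
      rewrite ler_peMr ?mulr_ge0 ?(ltW C0) ?(ltW G0)//.
      rewrite powRN ler_pdivlMr ?powR_gt0// mul1r.
      by apply: ge0_ler_powR; rewrite ?nnegrE ?(ltW tr0) ?(ltW d0)// lerB.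
    apply/funext => x; apply: eq_integral => y _.
    rewrite /dk /duhamel_kernel /= rt r0 ltNge sr /= subr0 ger0_norm//.
    exact: heat_kernel_ge0.
  have rs' : (0 < r < s)%R by rewrite r0 rs.
  have sr0 : (0 < s - r)%R by rewrite subr_gt0.
  pose c := (C4 * ((t - s) / (s - r)) `^ th)%R.
  have c0 : (0 <= c)%R by rewrite mulr_ge0 ?powR_ge0// ltW.
  have tr20 : (0 < 2 * (t - r))%R by rewrite mulr_gt0.
  pose H x := heat_op (s - r) (fun y => g (r, y)) x +
    heat_op (t - r) (fun y => g (r, y)) x + heat_op (2 * (t - r)) (fun y => g (r, y)) x.
  have mH : measurable_fun setT H by do 2 apply: emeasurable_funD => //.
  have H0 x : 0 <= H x by apply: adde_ge0 => //; exact: adde_ge0.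
  have JH x : J (r, x) <= c%:E * H x.
    have mhs a := measurable_heat_op_section a x (mgs r).
    have hs0 a y : 0 <= (heat_kernel a (rnsub x y))%:E * g (r, y).
      by rewrite mule_ge0// lee_fin heat_kernel_ge0.
    rewrite /H /heat_op -!ge0_integralD//; last 2 first.
    - by move=> y _; rewrite adde_ge0.
    - exact: emeasurable_funD.
    rewrite -ge0_integralZl//; last 2 first.
    - by do 2 apply: emeasurable_funD => //.
    - by move=> y _; rewrite !adde_ge0.
    apply: ge0_le_integral => //.
    - exact: (measurable_fun_pair2 (r, x) mdkg).
    - by apply: measurable_funeM; do 2 apply: emeasurable_funD => //.
    move=> y _; have hk0 a : (0 <= heat_kernel a (rnsub x y))%R by exact: heat_kernel_ge0.
    rewrite -!ge0_muleDl ?lee_fin ?addr_ge0// muleA -EFinM.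
    rewrite lee_wpmul2r// lee_fin /dk /duhamel_kernel /= rt rs'.
    have srtr : (s - r <= t - r)%R by rewrite lerD2r ltW.
    have := @heat_kernel_timeB R N th (s - r) (t - r) (rnsub x y) th0 (ltW th1) sr0 srtr.
    by rewrite (_ : (t - r - (s - r) = t - s)%R)//; ring.
  apply: (@le_trans _ _ (c%:E * (C * (G * r `^ (- b)) + C * (G * r `^ (- b)) +
      C * (G * r `^ (- b)))%:E)).
    apply: (@le_trans _ _ (ewnorm q gamma (fun x => c%:E * H x))).
      apply: (le_ewnorm q0 (mJs r) (measurable_funeM c%:E mH)).
      by apply: aeW => x; rewrite gee0_abs.
    apply: (le_trans (ewnormZ_le q0 c0 mH)); rewrite lee_wpmul2l//.
    apply: (le_trans (ewnormD_le (ltW q1) _ (mHr _) _ (Hr0 _))).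
    - exact: emeasurable_funD.
    - by move=> x; rewrite adde_ge0.
    rewrite EFinD leeD ?HCr//.
    apply: (le_trans (ewnormD_le (ltW q1) (mHr _) (mHr _) (Hr0 _) (Hr0 _))).
    by rewrite EFinD leeD ?HCr.
  rewrite -EFinM lee_fin.
  apply: (@le_trans _ _ (kap s c1 r)); last by rewrite lerDr kap0// ltW.
  rewrite kapS// /c1 /c2 /c powRM ?invr_ge0 ?(ltW d0) ?(ltW sr0)//.
  rewrite -(powR_inv1 (ltW sr0)) -powRrM mulN1r.
  by rewrite le_eqVlt; apply/orP; left; apply/eqP; ring.
have K0 : (0 < C * B * (1 + 3 * C4) * G * T `^ th * (t - s) `^ th)%R.
  have T0 : (0 < T)%R by exact: lt_le_trans tT.
  have C41 : (0 < 1 + 3 * C4)%R by rewrite ltr_wpDr// mulr_ge0// ltW.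
  by rewrite !mulr_gt0// powR_gt0.
have := Lnorm_integral_le (nu := @lebesgue_measure R) (mu := @leb R N) (p := q)
  (g := fun z => (enorm z.2 `^ gamma)%:E * J z) (kappa := kappa) (ltW q1) _ _ _ _ _ _ K0.
have -> : (fun x => \int[@lebesgue_measure R]_r ((enorm (r, x).2 `^ gamma)%:E * J (r, x))) =
    (fun x => (enorm x `^ gamma)%:E * \int[mu]_z ((dk x z)%:E * g z)).
  apply/funext => x; have wx0 : 0 <= (enorm x `^ gamma)%:E by rewrite lee_fin powR_ge0.
  have mJx : measurable_fun setT (fun r => J (r, x)) by exact: measurable_fun_pair1.
  rewrite /= (ge0_integralZl _ measurableT mJx
    (fun r _ => J0 (r, x)) wx0).
  congr (_ * _); rewrite [RHS](fubini_tonelli1 (m1 := @lebesgue_measure R) (m2 := @leb R N))//.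
  apply: emeasurable_funM => //; apply/measurable_EFinP.
  apply: measurableT_comp => //; apply: measurable_funB;
    exact: measurable_duhamel_kernel_section.
apply.
- apply: emeasurable_funM => //; apply/measurable_EFinP.
  apply: (measurableT_comp (measurable_powR gamma)).
  exact: (measurableT_comp measurable_enorm).
- by move=> z; rewrite mule_ge0 ?lee_fin ?powR_ge0.
- by apply: measurable_funD; exact: mkap.
- by move=> r; rewrite addr_ge0 ?kap0 ?ltW.
- move=> r kr x; have [rt|rt] := boolP (0 < r < t)%R.
    move: kr => /eqP; rewrite gt_eqF// ltr_wpDr ?kap0 ?(ltW c10)// kapE//.
    by have /andP[r0 r_lt_t] := rt; rewrite !mulr_gt0 ?powR_gt0 ?subr_gt0.
  have rs : (0 < r < s)%R = false.
    by apply/negbTE; apply: contra rt => /andP[-> /lt_trans]; exact.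
  rewrite /J /dk /duhamel_kernel /= (negbTE rt) rs subrr normr0; under eq_integral do rewrite mul0e.
  by rewrite integral0 mule0.
- exact: Jkappa.
have intk a c : (0 < c)%R -> (0 <= a)%R -> (a <= T)%R ->
    \int[@lebesgue_measure R]_r (kap a c r)%:E <= (c * (B * T `^ th))%:E.
  move=> /ltW c0 a0 aT; rewrite (integral_kappa _ _ _ c0) EFinM lee_wpmul2l ?lee_fin//.
  move: a0; rewrite le_eqVlt => /predU1P[<-|a0].
    rewrite (eq_integral (cst 0)) ?integral0 ?lee_fin ?mulr_ge0 ?powR_ge0 ?(ltW B0)//.
    by move=> r _ /=; case: ifP => // /andP[r0 /(lt_trans r0)]; rewrite ltxx.
  apply: (le_trans (HB a a0)); rewrite lee_fin ler_wpM2l ?(ltW B0)//.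
  rewrite (_ : (1 - th - b = th)%R); last by rewrite /th; field.
  by apply: ge0_ler_powR; rewrite ?nnegrE ?(ltW a0)// (le_trans (ltW a0)).
under eq_integral do rewrite EFinD.
rewrite ge0_integralD//; last 4 first.
- by move=> r _; rewrite lee_fin kap0// ltW.
- by apply/measurable_EFinP; exact: mkap.
- by move=> r _; rewrite lee_fin kap0// ltW.
- by apply/measurable_EFinP; exact: mkap.
apply: (le_trans (leeD (intk _ _ c20 (ltW t0) tT) (intk _ _ c10 s0 (ltW (lt_le_trans st tT))))).
rewrite -EFinD lee_fin /c1 /c2 le_eqVlt; apply/orP; left; apply/eqP; ring.
Qed.

End duhamel_norm.

(** * Monotone iteration for the mild equation *)

Section signed_power.
Context {R : realType} (alpha : R).
Hypothesis alpha0 : 0 < alpha.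
Implicit Types x y : R.

Definition spow x : R := `|x| `^ alpha * x.

Lemma spowN x : spow (- x) = - spow x.
Proof. by rewrite /spow normrN mulrN. Qed.

Lemma spow0 : spow 0 = 0.
Proof. by rewrite /spow mulr0. Qed.

Lemma spow_ge0E x : 0 <= x -> spow x = x `^ (alpha + 1).
Proof.
move=> x0; rewrite /spow ger0_norm//.
have [->|xN0] := eqVneq x 0; first by rewrite mulr0 powR0// gt_eqF// addr_gt0.
by rewrite powRD ?xN0 ?implybT// powRr1.
Qed.

Lemma spow_ge0 x : 0 <= x -> 0 <= spow x.
Proof. by move=> x0; rewrite mulr_ge0 ?powR_ge0. Qed.

Lemma normr_spow x : `|spow x| = spow `|x|.
Proof. by rewrite /spow normrM normr_id ger0_norm ?powR_ge0. Qed.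

Lemma le_spow x y : x <= y -> spow x <= spow y.
Proof.
move=> xy; have p0 : 0 <= alpha + 1 by rewrite addr_ge0// ltW.
have le0 a b : 0 <= a -> a <= b -> spow a <= spow b.
  move=> a0 ab; have b0 := le_trans a0 ab.
  by rewrite !spow_ge0E//; apply: ge0_ler_powR.
have [x0|x0] := leP 0 x; first exact: le0.
have [y0|y0] := leP 0 y.
  apply: (@le_trans _ _ 0); last exact: spow_ge0.
  by rewrite -[x]opprK spowN oppr_le0 spow_ge0// oppr_ge0 ltW.
rewrite -[x]opprK -[y]opprK !(spowN (- _)) lerN2; apply: le0; last by rewrite lerN2.
by rewrite oppr_ge0 ltW.
Qed.

(** Provides the continuity of the nonlinearity along the signed iteration. On the half-line it is
    the tangent inequality at the larger point; for values of opposite sign, both are compared with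
    0. *)
Lemma spow_lipschitz (B x y : R) : `|x| <= B -> `|y| <= B -> x <= y ->
  spow y - spow x <= (alpha + 1) * B `^ alpha * (y - x).
Proof.
move=> xB yB xy; have B0 : 0 <= B := le_trans (normr_ge0 _) xB.
have p1 : 1 <= alpha + 1 by rewrite lerDr ltW.
have p0 : 0 < alpha + 1 by rewrite (lt_le_trans ltr01).
have monoB c : 0 <= c -> c <= B -> c `^ alpha <= B `^ alpha.
  by move=> c0 cB; apply: ge0_ler_powR; rewrite ?nnegrE// ltW.
have pos a b : 0 <= a -> a <= b -> b <= B ->
    spow b - spow a <= (alpha + 1) * B `^ alpha * (b - a).
  move=> a0 ab bB; have b0 : 0 <= b := le_trans a0 ab.
  have [b_eq0|bN0] := eqVneq b 0.
    have a_eq0 : a = 0 by apply/eqP; rewrite eq_le a0 -b_eq0 ab.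
    by rewrite a_eq0 b_eq0 !subrr mulr0.
  have b_gt0 : 0 < b by rewrite lt_neqAle eq_sym bN0.
  have := powR_tangent p1 b_gt0 a0.
  have -> : 1 - (alpha + 1) = - alpha by ring.
  rewrite powRN => h.
  have ba0 : 0 < b `^ alpha by rewrite powR_gt0.
  have h2 : (alpha + 1) * b `^ alpha * a <= a `^ (alpha + 1) + alpha * b `^ alpha * b.
    have := ler_wpM2l (ltW (mulr_gt0 p0 ba0)) h.
    rewrite (_ : (alpha + 1) * b `^ alpha * ((b `^ alpha)^-1 / (alpha + 1) * a `^ (alpha + 1) +
      (1 - (alpha + 1)^-1) * b) = a `^ (alpha + 1) + alpha * b `^ alpha * b)//.
    by field; rewrite !gt_eqF.
  apply: (@le_trans _ _ ((alpha + 1) * b `^ alpha * (b - a))).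
    rewrite (spow_ge0E a0) {1}/spow ger0_norm//; move: h2.
    set A := a `^ _; set D := b `^ _; lra.
  by rewrite ler_wpM2r ?subr_ge0// ler_wpM2l ?(ltW p0)// monoB.
have [x0|x0] := leP 0 x; first by apply: pos => //; rewrite (le_trans (ler_norm _)).
have [y0|y0] := leP y 0.
  have := @pos (- y) (- x); rewrite oppr_ge0 lerN2 !spowN => /(_ y0 xy).
  rewrite (le_trans (ler_norm _)) ?normrN// => /(_ isT).
  by rewrite !opprK addrC (addrC _ y).
have h1 : spow y <= (alpha + 1) * B `^ alpha * y.
  rewrite /spow (gtr0_norm y0) ler_wpM2r ?(ltW y0)//.
  apply: (@le_trans _ _ (B `^ alpha)).
    by apply: monoB; rewrite ?(ltW y0)// (le_trans (ler_norm _)).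
  by rewrite ler_peMl ?powR_ge0.
have h2 : - spow x <= (alpha + 1) * B `^ alpha * (- x).
  rewrite -spowN /spow normrN ler_wpM2r ?oppr_ge0 ?(ltW x0)//.
  apply: (@le_trans _ _ (B `^ alpha)); first exact: monoB.
  by rewrite ler_peMl ?powR_ge0.
lra.
Qed.

Lemma measurable_spow : measurable_fun setT spow.
Proof.
apply: measurable_funM => //.
by apply: (measurableT_comp (measurable_powR alpha)).
Qed.

End signed_power.

(** * The majorant equation and the shifted signed equation *)

Section mild_fixpoint.
Context {R : realType} {N : nat}.
Local Notation spacetime := (measurableTypeR R * Rn R N)%type.
Local Notation mu := (@leb_spacetime R N).
Variables (alpha l : R) (u0 : Rn R N -> R).
Hypotheses (alpha0 : 0 < alpha) (mu0 : measurable_fun setT u0).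
Implicit Types (w z : spacetime) (V W : spacetime -> \bar R).
Local Open Scope ereal_scope.

Lemma measurable_heat_op_joint (f : Rn R N -> \bar R) :
  measurable_fun setT f -> (forall x, 0 <= f x) ->
  measurable_fun [set: spacetime] (fun w => heat_op w.1 f w.2).
Proof.
move=> mf f0.
have mI : measurable_fun [set: spacetime * Rn R N]
    (fun v => (heat_kernel v.1.1 (rnsub v.1.2 v.2))%:E * f v.2).
  apply: emeasurable_funM; last exact: (measurableT_comp mf measurable_snd).
  apply/measurable_EFinP; apply: measurable_heat_kernel.
    exact: (measurableT_comp measurable_fst measurable_fst).
  apply: measurable_rnsub => //.
  exact: (measurableT_comp measurable_snd measurable_fst).
have I0 (v : spacetime * Rn R N) : 0 <= (heat_kernel v.1.1 (rnsub v.1.2 v.2))%:E * f v.2.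
  by rewrite mule_ge0// lee_fin heat_kernel_ge0.
exact: (measurable_fun_fubini_tonelli_F (m2 := @leb R N) _ mI I0).
Qed.

Definition enonlin W z : \bar R := (enorm z.2 `^ l)%:E * W z `^ (alpha + 1).

Let p0 : (0 < alpha + 1)%R. Proof. by rewrite addr_gt0. Qed.

Lemma enonlin_ge0 W z : 0 <= enonlin W z.
Proof. by rewrite mule_ge0 ?poweR_ge0// lee_fin powR_ge0. Qed.

Let measurable_weight_snd : measurable_fun [set: spacetime] (fun z => (enorm z.2 `^ l)%:E).
Proof.
apply/measurable_EFinP; apply: (measurableT_comp (measurable_powR l)).
exact: (measurableT_comp measurable_enorm).
Qed.

Lemma measurable_enonlin W : measurable_fun setT W -> measurable_fun setT (enonlin W).
Proof. by move=> mW; apply: emeasurable_funM => //; exact: measurable_poweR_comp. Qed.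

Definition majorant_op W w : \bar R :=
  heat_op w.1 (fun y => `|u0 y|%:E) w.2 + duhamel (enonlin W) w.

Let mabs : measurable_fun setT (fun y : Rn R N => `|u0 y|%:E).
Proof. by apply/measurable_EFinP; exact: measurableT_comp. Qed.

(** The length of the time interval enters only through the stability hypothesis on [majorant_op].
    The norm bound is part of the invariant and passes to the increasing limit by monotone
    convergence. *)
Lemma majorant_exists (p : \bar R) (gamma T : R) (kappa : R -> R) : 0 < p ->
  (forall t, (0 <= kappa t)%R) ->
  (forall W, measurable_fun setT W -> (forall z, 0 <= W z) ->
    (forall t : R, (0 < t <= T)%R ->
      ewnorm p gamma (fun x => W (t, x)) <= (kappa t)%:E) ->
    forall t : R, (0 < t <= T)%R ->
      ewnorm p gamma (fun x => majorant_op W (t, x)) <= (kappa t)%:E) ->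
  exists W, [/\ measurable_fun setT W, forall z, 0 <= W z,
    forall t : R, (0 < t <= T)%R -> ewnorm p gamma (fun x => W (t, x)) <= (kappa t)%:E
    & forall w, W w = majorant_op W w].
Proof.
move=> pp kap0 stable.
pose good W := [/\ measurable_fun setT W, forall z, 0 <= W z &
  forall t : R, (0 < t <= T)%R -> ewnorm p gamma (fun x => W (t, x)) <= (kappa t)%:E].
have [|||||W [mW W0 kW] WE] := @monotone_fixpoint R spacetime majorant_op good.
- by move=> W [].
- by split=> // t _; rewrite ewnorm0// lee_fin.
- move=> W [mW W0 kW]; split; last exact: stable.
    apply: emeasurable_funD; first exact: measurable_heat_op_joint.
    by apply: measurable_duhamel; [exact: measurable_enonlin|exact: enonlin_ge0].
  by move=> z; rewrite adde_ge0// ?heat_op_ge0// duhamel_ge0// => ?; exact: enonlin_ge0.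
- move=> v W [mv v0 _] [mW W0 _] vW x; rewrite leeD2l//.
  apply: le_duhamel; [exact: measurable_enonlin|exact: measurable_enonlin| |].
    exact: enonlin_ge0.
  by move=> z; rewrite lee_wpmul2l ?lee_fin ?powR_ge0// poweR_le_swap.
- move=> W_ gW ndW.
  have mW n : measurable_fun setT (W_ n) by have [] := gW n.
  have W0 n z : 0 <= W_ n z by have [_ + _] := gW n; exact.
  have cW z := ereal_nondecreasing_is_cvgn (ndW z).
  split.
    split.
    + by apply: (emeasurable_fun_cvg W_) => // z _; exact: cW.
    + by move=> z; apply: lime_ge => //; exact: nearW.
    + move=> t tT; rewrite /ewnorm.
      under eq_Lnorm do rewrite mule_limn//.
      apply: Lnorm_limn_le => //; rewrite ?lee_fin//.
      * by move=> n; exact: (measurable_weight gamma (measurable_fun_pair2 _ (mW n))).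
      * by move=> n x; rewrite mule_ge0 ?lee_fin ?powR_ge0.
      * by move=> x m n mn; rewrite lee_wpmul2l ?lee_fin ?powR_ge0//; exact: ndW.
      * by move=> n; have [_ _] := gW n; apply.
  move=> w; rewrite /majorant_op.
  have ndFz z : nondecreasing_seq (fun n => W_ n z `^ (alpha + 1)).
    by move=> m n mn; rewrite poweR_le_swap//; exact: ndW.
  have ndF z : nondecreasing_seq (fun n => enonlin (W_ n) z).
    by move=> m n mn; rewrite lee_wpmul2l ?lee_fin ?powR_ge0//; exact: ndFz.
  have -> : enonlin (fun z => limn (W_ ^~ z)) = (fun z => limn (fun n => enonlin (W_ n) z)).
    by apply/funext => z; rewrite /enonlin poweR_limn// mule_limn.
  rewrite duhamel_limn//; last 2 first.
  + by move=> n; exact: measurable_enonlin.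
  + by move=> n z; exact: enonlin_ge0.
  have ndD : nondecreasing_seq (fun n => duhamel (enonlin (W_ n)) w).
    move=> m n mn; apply: le_duhamel; [exact: measurable_enonlin|exact: measurable_enonlin| |].
      exact: enonlin_ge0.
    by move=> z; exact: ndF.
  apply/esym/cvg_lim => //; apply: cvgeD.
  + apply: ge0_adde_def; rewrite inE; first exact: heat_op_ge0.
    by apply: lime_ge; [exact: ereal_nondecreasing_is_cvgn|
      apply: nearW => n; exact: duhamel_ge0 (enonlin_ge0 _)].
  + exact: cvg_cst.
  + exact: ereal_nondecreasing_is_cvgn.
by exists W.
Qed.

Variable W : spacetime -> \bar R.
Hypotheses (mW : measurable_fun setT W) (W0 : forall z, 0 <= W z)
  (WE : forall w, W w = majorant_op W w).

(* The unknown is V = u + W, so that the signed equation for u becomes a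
   monotone equation between nonnegative functions. *)
Definition shifted_nonlin V z : \bar R := (enorm z.2 `^ l)%:E *
  (if W z < +oo then
     (spow alpha (fine (V z) - fine (W z)) + spow alpha (fine (W z)))%:E
   else 0).

Definition shifted_op V w : \bar R :=
  heat_op w.1 (fun y => (u0 y + `|u0 y|)%:E) w.2 + duhamel (shifted_nonlin V) w.

(** For u = V - W the conditions 0 <= V <= 2 W say that |u| <= W. *)
Let dominated V := [/\ measurable_fun setT V, forall z, 0 <= V z &
  forall z, V z <= 2%:E * W z].

Let dominated_fin V z : dominated V -> W z < +oo -> V z \is a fin_num.
Proof.
move=> [_ V0 VW] Wz; rewrite ge0_fin_numE//; apply: le_lt_trans (VW z) _.
by rewrite lte_mul_pinfty ?lee_fin.
Qed.

Let fine_le2 V z : dominated V -> W z < +oo -> (0 <= fine (V z) <= 2 * fine (W z))%R.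
Proof.
move=> dV Wz; have [_ V0 VW] := dV; rewrite fine_ge0//=.
have Wf : W z \is a fin_num by rewrite ge0_fin_numE.
by have Vf := dominated_fin dV Wz; rewrite -lee_fin EFinM !fineK.
Qed.

Let shift_bound V z : dominated V -> W z < +oo ->
  (`|fine (V z) - fine (W z)| <= fine (W z))%R.
Proof. by move=> dV Wz; have /andP[] := fine_le2 dV Wz; rewrite ler_norml; lra. Qed.

Let spow_shift V z : dominated V -> W z < +oo ->
  (`|spow alpha (fine (V z) - fine (W z))| <= spow alpha (fine (W z)))%R.
Proof. by move=> dV Wz; rewrite normr_spow; apply: le_spow => //; exact: shift_bound. Qed.

Let shifted_nonlin_ge0 V z : dominated V -> 0 <= shifted_nonlin V z.
Proof.
move=> dV; rewrite mule_ge0 ?lee_fin ?powR_ge0//; case: ifPn => // Wz.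
by have := spow_shift dV Wz; rewrite lee_fin ler_norml => /andP[]; lra.
Qed.

Lemma enonlinE z : W z < +oo ->
  enonlin W z = (enorm z.2 `^ l * spow alpha (fine (W z)))%:E.
Proof.
move=> Wz; have Wf : W z \is a fin_num by rewrite ge0_fin_numE.
by rewrite /enonlin -[in LHS](fineK Wf) poweR_EFin -EFinM spow_ge0E ?fine_ge0.
Qed.

Let shifted_nonlin_le V z : dominated V -> shifted_nonlin V z <= 2%:E * enonlin W z.
Proof.
move=> dV; rewrite /shifted_nonlin; case: ifPn => Wz; last first.
  by rewrite mule0 mule_ge0 ?lee_fin// enonlin_ge0.
rewrite enonlinE// -!EFinM lee_fin mulrCA ler_wpM2l ?powR_ge0//.
by have := spow_shift dV Wz; rewrite ler_norml => /andP[]; lra.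
Qed.

Let measurable_lty : measurable_fun setT (fun z : spacetime => W z < +oo).
Proof. by apply: measurable_fun_lte => //; exact: measurable_cst. Qed.

Let measurable_shifted_nonlin V : measurable_fun setT V ->
  measurable_fun setT (shifted_nonlin V).
Proof.
move=> mV; apply: emeasurable_funM => //; apply: measurable_fun_ifT => //.
apply/measurable_EFinP; apply: measurable_funD; apply: (measurableT_comp (measurable_spow alpha)).
  by apply: measurable_funB; exact: measurableT_comp.
exact: measurableT_comp.
Qed.

Let le_shifted_nonlin V V' z : dominated V -> dominated V' -> V z <= V' z ->
  shifted_nonlin V z <= shifted_nonlin V' z.
Proof.
move=> dV dV' VV'; rewrite /shifted_nonlin lee_wpmul2l ?lee_fin ?powR_ge0//.
case: ifPn => // Wz; rewrite lee_fin lerD2r; apply: le_spow => //.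
have Vf := dominated_fin dV Wz; have V'f := dominated_fin dV' Wz.
by rewrite lerD2r -lee_fin !fineK.
Qed.

(** Where W is finite the iterates converge in the reals and stay within distance W of W, so the
    local Lipschitz bound squeezes the nonlinear terms. Where W is infinite both sides are 0. *)
Let shifted_nonlin_limn (V_ : (spacetime -> \bar R)^nat) z :
  (forall n, dominated (V_ n)) -> nondecreasing_seq (V_ ^~ z) ->
  dominated (fun z => limn (V_ ^~ z)) ->
  shifted_nonlin (fun z => limn (V_ ^~ z)) z = limn (fun n => shifted_nonlin (V_ n) z).
Proof.
move=> dV ndV dL; rewrite /shifted_nonlin; case: ifPn => Wz; last first.
  by rewrite mule0 lim_cst.
set w := fine (W z); set a := fine _; pose an n := fine (V_ n z).
have an_a : an n @[n --> \oo] --> a.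
  apply: fine_cvg; rewrite fineK ?(dominated_fin dL)//.
  exact: ereal_nondecreasing_is_cvgn.
have an_le n : (an n <= a)%R.
  have Lf := dominated_fin dL Wz; have Vf := dominated_fin (dV n) Wz.
  rewrite /an /a -lee_fin !fineK//.
  exact: ereal_nondecreasing_le_limn.
apply/esym/cvg_lim => //; rewrite -EFinM.
have H : (spow alpha (an n - w) + spow alpha w)%R @[n --> \oo] -->
    (spow alpha (a - w) + spow alpha w)%R.
  apply: cvgD; last exact: cvg_cst.
  set K := ((alpha + 1) * w `^ alpha)%R.
  apply: (@squeeze_cvgr _ _ _ _ (fun n => spow alpha (a - w) - K * (a - an n))%R
    (fun=> spow alpha (a - w))).
  - apply: nearW => n; apply/andP; split; last first.
      by apply: le_spow => //; rewrite lerD2r.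
    rewrite lerBlDr -lerBlDl.
    have -> : (a - an n = (a - w) - (an n - w))%R by ring.
    apply: spow_lipschitz => //; [exact: (shift_bound (dV n))|exact: (shift_bound dL)|].
    by rewrite lerD2r.
  - rewrite -[X in _ --> X]subr0; apply: cvgB; first exact: cvg_cst.
    rewrite -[X in _ --> X](mulr0 K); apply: cvgM; first exact: cvg_cst.
    rewrite -[X in _ --> X](subrr a); apply: cvgB => //; exact: cvg_cst.
  - exact: cvg_cst.
by under eq_fun do rewrite -EFinM; apply: cvg_EFin; [exact: nearW|apply: cvgM => //; exact: cvg_cst].
Qed.

(** The bound V <= 2 W is preserved because W solves its own equation: u0 + |u0| <= 2 |u0|, and the
    shifted nonlinearity is at most twice that of W. *)
Lemma shifted_exists : exists V, [/\ measurable_fun setT V, forall z, 0 <= V z,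
  forall z, V z <= 2%:E * W z & forall w, V w = shifted_op V w].
Proof.
have mu0p : measurable_fun setT (fun y : Rn R N => (u0 y + `|u0 y|)%:E).
  by apply/measurable_EFinP; apply: measurable_funD => //; exact: measurableT_comp.
have u0p_ge0 y : 0 <= (u0 y + `|u0 y|)%:E.
  by rewrite lee_fin; have := ler_norm (- u0 y); rewrite normrN; lra.
have u0_ge0 y : 0 <= `|u0 y|%:E by rewrite lee_fin.
have [|||||V [mV V0 VW] VE] := @monotone_fixpoint R spacetime shifted_op dominated.
- by move=> V [].
- by split=> // z; rewrite mule_ge0 ?lee_fin.
- move=> V dV; have [mV V0 VW] := dV.
  have mS := measurable_shifted_nonlin mV.
  have S0 z := shifted_nonlin_ge0 z dV.
  split.
  + by apply: emeasurable_funD; [exact: measurable_heat_op_joint|exact: measurable_duhamel].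
  + by move=> w; rewrite adde_ge0 ?heat_op_ge0// duhamel_ge0.
  + move=> w; rewrite [in leRHS]WE /majorant_op ge0_muleDr ?heat_op_ge0 ?duhamel_ge0//; last first.
      exact: enonlin_ge0.
    apply: leeD.
      rewrite /heat_op -ge0_integralZl//; last 2 first.
      * exact: measurable_heat_op_section.
      * by move=> y _; rewrite mule_ge0// lee_fin heat_kernel_ge0.
      apply: ge0_le_integral => //.
      * by move=> y _; rewrite mule_ge0// lee_fin heat_kernel_ge0.
      * exact: measurable_heat_op_section.
      * by apply: measurable_funeM; exact: measurable_heat_op_section.
      * move=> y _; rewrite muleCA lee_wpmul2l ?lee_fin ?heat_kernel_ge0//.
        by rewrite mulr_natl mulr2n lerD2r ler_norm.
    rewrite /duhamel -ge0_integralZl//; last 2 first.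
    * by apply: measurable_duhamel_integrand; exact: measurable_enonlin.
    * by move=> z _; apply: duhamel_integrand_ge0; exact: enonlin_ge0.
    apply: ge0_le_integral => //.
    * by move=> z _; exact: duhamel_integrand_ge0.
    * exact: measurable_duhamel_integrand.
    * by apply: measurable_funeM; apply: measurable_duhamel_integrand; exact: measurable_enonlin.
    * move=> z _; rewrite [leRHS]muleCA lee_wpmul2l ?lee_fin ?duhamel_kernel_ge0//.
      exact: shifted_nonlin_le.
- move=> V V' dV dV' VV' w; rewrite leeD2l//.
  have [mV _ _] := dV; have [mV' _ _] := dV'.
  apply: le_duhamel; [exact: measurable_shifted_nonlin|exact: measurable_shifted_nonlin| |].
    by move=> z; exact: shifted_nonlin_ge0.
  by move=> z; exact: le_shifted_nonlin.
- move=> V_ dV ndV.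
  have mV n : measurable_fun setT (V_ n) by have [] := dV n.
  have V0 n z : 0 <= V_ n z by have [_ + _] := dV n; exact.
  have cV z := ereal_nondecreasing_is_cvgn (ndV z).
  have dL : dominated (fun z => limn (V_ ^~ z)).
    split.
    + by apply: (emeasurable_fun_cvg V_) => // z _; exact: cV.
    + by move=> z; apply: lime_ge => //; exact: nearW.
    + by move=> z; apply: lime_le => //; apply: nearW => n; have [_ _] := dV n; exact.
  split=> // w; rewrite /shifted_op.
  have ndS z : nondecreasing_seq (fun n => shifted_nonlin (V_ n) z).
    by move=> m n mn; apply: le_shifted_nonlin => //; exact: ndV.
  have -> : shifted_nonlin (fun z => limn (V_ ^~ z)) =
      (fun z => limn (fun n => shifted_nonlin (V_ n) z)).
    by apply/funext => z; exact: shifted_nonlin_limn.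
  rewrite duhamel_limn//; last 2 first.
  + by move=> n; exact: measurable_shifted_nonlin.
  + by move=> n z; exact: shifted_nonlin_ge0.
  have D0 n : 0 <= duhamel (shifted_nonlin (V_ n)) w.
    by apply: duhamel_ge0 => z; exact: shifted_nonlin_ge0.
  have ndD : nondecreasing_seq (fun n => duhamel (shifted_nonlin (V_ n)) w).
    move=> m n mn; apply: le_duhamel; [exact: measurable_shifted_nonlin|exact: measurable_shifted_nonlin| |].
      by move=> z; exact: shifted_nonlin_ge0.
    by move=> z; exact: ndS.
  apply/esym/cvg_lim => //; apply: cvgeD.
  + apply: ge0_adde_def; rewrite inE; first exact: heat_op_ge0.
    by apply: lime_ge; [exact: ereal_nondecreasing_is_cvgn|exact: nearW].
  + exact: cvg_cst.
  + exact: ereal_nondecreasing_is_cvgn.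
by exists V.
Qed.

(** The equation of W is subtracted from that of V. At a point where W is finite so are all its
    terms, which makes the subtraction legitimate and provides the integrability of the signed
    integrands. Where W is infinite, u is set to 0. *)
Lemma mild_exists : exists u : spacetime -> R, [/\ measurable_fun setT u,
  forall z, `|u z|%:E <= W z &
  forall w, W w < +oo ->
    [/\ (@leb R N).-integrable setT
          (fun y => (heat_kernel w.1 (rnsub w.2 y) * u0 y)%:E),
        mu.-integrable setT
          (fun z => (duhamel_kernel w z * (enorm z.2 `^ l * spow alpha (u z)))%:E) &
        (u w)%:E = \int[@leb R N]_y (heat_kernel w.1 (rnsub w.2 y) * u0 y)%:E +
          \int[mu]_z (duhamel_kernel w z * (enorm z.2 `^ l * spow alpha (u z)))%:E]].
Proof.
have [V [mV V0 VW VE]] := shifted_exists.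
have dV : dominated V by [].
pose u z : R := if W z < +oo then (fine (V z) - fine (W z))%R else 0%R.
have mu_ : measurable_fun setT u.
  apply: measurable_fun_ifT => //.
  by apply: measurable_funB; exact: measurableT_comp.
have uW z : `|u z|%:E <= W z.
  rewrite /u; case: ifPn => Wz; last by rewrite normr0.
  have Wf : W z \is a fin_num by rewrite ge0_fin_numE.
  by rewrite -[leRHS](fineK Wf) lee_fin shift_bound.
exists u; split=> // w Ww.
pose h z : R := (enorm z.2 `^ l * spow alpha (u z))%R.
have mh : measurable_fun setT h.
  apply: measurable_funM; first by apply/measurable_EFinP.
  exact: (measurableT_comp (measurable_spow alpha)).
have k0 z : (0 <= duhamel_kernel w z)%R by exact: duhamel_kernel_ge0.
have mk : measurable_fun setT (duhamel_kernel w) by exact: measurable_duhamel_kernel_section.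
have kle z : `|(duhamel_kernel w z * h z)%:E| <= (duhamel_kernel w z)%:E * enonlin W z.
  rewrite /= normrM (ger0_norm (k0 z)) EFinM lee_wpmul2l ?lee_fin//.
  rewrite /h /u; case: ifPn => Wz; last by rewrite spow0 mulr0 normr0 enonlin_ge0.
  rewrite enonlinE// lee_fin normrM ger0_norm ?powR_ge0// ler_wpM2l ?powR_ge0//.
  exact: spow_shift.
have mkF : measurable_fun setT (fun z => (duhamel_kernel w z)%:E * enonlin W z).
  by apply: measurable_duhamel_integrand; exact: measurable_enonlin.
have A0 : 0 <= heat_op w.1 (fun y => `|u0 y|%:E) w.2 by apply: heat_op_ge0 => y; rewrite lee_fin.
have B0 : 0 <= duhamel (enonlin W) w by apply: duhamel_ge0; exact: enonlin_ge0.
have [Ay By] : heat_op w.1 (fun y => `|u0 y|%:E) w.2 < +oo /\ duhamel (enonlin W) w < +oo.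
  have := Ww; rewrite WE /majorant_op; split.
    by apply: le_lt_trans Ww; rewrite WE /majorant_op leeDl.
  by apply: le_lt_trans Ww; rewrite WE /majorant_op leeDr.
have iF : mu.-integrable setT (fun z => (duhamel_kernel w z)%:E * enonlin W z).
  apply/integrableP; split=> //; apply: le_lt_trans By.
  rewrite le_eqVlt; apply/orP; left; apply/eqP; apply: eq_integral => z _.
  by rewrite gee0_abs// duhamel_integrand_ge0//; exact: enonlin_ge0.
have ih : mu.-integrable setT (fun z => (duhamel_kernel w z * h z)%:E).
  apply: (le_integrable measurableT _ _ iF).
    by apply/measurable_EFinP; exact: measurable_funM.
  move=> z _; apply: (le_trans (kle z)); exact: lee_abs.
have mhk : measurable_fun setT (fun y => heat_kernel w.1 (rnsub w.2 y)).
  exact: measurable_heat_kernel_section.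
have hk0 y : (0 <= heat_kernel w.1 (rnsub w.2 y))%R by exact: heat_kernel_ge0.
have iA : (@leb R N).-integrable setT
    (fun y => (heat_kernel w.1 (rnsub w.2 y))%:E * `|u0 y|%:E).
  apply/integrableP; split; first exact: measurable_heat_op_section.
  apply: le_lt_trans Ay; rewrite le_eqVlt; apply/orP; left; apply/eqP.
  by apply: eq_integral => y _; rewrite gee0_abs// mule_ge0 ?lee_fin.
have iu0 : (@leb R N).-integrable setT (fun y => (heat_kernel w.1 (rnsub w.2 y) * u0 y)%:E).
  apply: (le_integrable measurableT _ _ iA).
    by apply/measurable_EFinP; exact: measurable_funM.
  by move=> y _; rewrite -EFinM /= lee_fin !normrM normr_id.
split=> //.
have VE1 : heat_op w.1 (fun y => (u0 y + `|u0 y|)%:E) w.2 =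
    \int[@leb R N]_y (heat_kernel w.1 (rnsub w.2 y) * u0 y)%:E +
    heat_op w.1 (fun y => `|u0 y|%:E) w.2.
  rewrite /heat_op -integralD//; apply: eq_integral => y _.
  by rewrite -!EFinM -EFinD mulrDr.
have VE2 : duhamel (shifted_nonlin V) w =
    \int[mu]_z (duhamel_kernel w z * h z)%:E + duhamel (enonlin W) w.
  rewrite /duhamel -integralD//; apply: ae_eq_integral => //.
  - by apply: measurable_duhamel_integrand; exact: measurable_shifted_nonlin.
  - by apply: emeasurable_funD => //; apply/measurable_EFinP; exact: measurable_funM.
  (* The integrands may differ where W is infinite, but only on a null set: the integrand of the
     finite integral [duhamel (enonlin W) w] is finite almost everywhere, so where W is infinite the
     kernel or the weight is 0 and both sides vanish. *)
  have := integrable_ae measurableT iF; apply: filterS => z + _ => /(_ I).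
  rewrite /shifted_nonlin; have [Wz|Wz] := boolP (W z < +oo) => kF.
    rewrite enonlinE// -!EFinM -EFinD /h /u Wz; congr (_%:E); ring.
  rewrite mule0 mule0 /h /u (negbTE Wz) spow0 !mulr0 add0e.
  move: kF; rewrite /enonlin; have -> : W z = +oo by move: Wz; rewrite ltey negbK => /eqP.
  rewrite /= gt_eqF//.
  have [->|y0] := eqVneq (enorm z.2 `^ l)%R 0%R; first by rewrite mul0e mule0.
  have yl0 : (0 < enorm z.2 `^ l)%R by rewrite lt_neqAle eq_sym y0 powR_ge0.
  rewrite gt0_muley//; have [->|kN0] := eqVneq (duhamel_kernel w z) 0%R; first by rewrite mul0e.
  by rewrite gt0_muley// lte_fin lt_neqAle eq_sym kN0 k0.
have Vf : V w \is a fin_num by exact: dominated_fin.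
have Wf : W w \is a fin_num by rewrite ge0_fin_numE.
have -> : (u w)%:E = V w - W w by rewrite /u Ww EFinB !fineK.
rewrite VE /shifted_op VE1 VE2 WE /majorant_op.
have := integrable_fin_num measurableT iu0; have := integrable_fin_num measurableT ih.
have Af : heat_op w.1 (fun y => `|u0 y|%:E) w.2 \is a fin_num by rewrite ge0_fin_numE.
have Bf : duhamel (enonlin W) w \is a fin_num by rewrite ge0_fin_numE.
move: Af Bf; rewrite /h.
case: (heat_op _ _ _) => // a _; case: (duhamel _ _) => // b _.
case: (\int[_]_z _) => // i _; case: (\int[_]_y _) => // j _.
by rewrite -!EFinD -?EFinB; congr (_%:E); ring.
Qed.

End mild_fixpoint.

(** * The Duhamel term as an iterated integral in time *)

Section duhamel_time_integral.
Context {R : realType} {N : nat}.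
Local Notation spacetime := (measurableTypeR R * Rn R N)%type.
Local Notation mu := (@leb_spacetime R N).
Local Notation leb1 := (@lebesgue_measure R).
Local Open Scope ereal_scope.

(** Fubini turns the space-time integral into the time integral of the mild equation. The source is
    prescribed for 0 < s < t only: the end points of [[0, t]], where s = 0 sees the initial datum
    and s = t the identity [heat 0], form a null set. *)
Lemma duhamel_heatE (h : spacetime -> R) (f : R -> Rn R N -> R) (t : R) (x : Rn R N) :
  mu.-integrable setT (fun z => (duhamel_kernel (t, x) z * h z)%:E) ->
  (forall s, (0 < s < t)%R -> f s = (fun y => h (s, y))) ->
  leb1.-integrable `[0%R, t] (fun s => (heat (t - s) (f s) x)%:E) /\
  (\int[leb1]_(s in `[0%R, t]) heat (t - s) (f s) x)%R =
    fine (\int[mu]_z (duhamel_kernel (t, x) z * h z)%:E).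
Proof.
move=> ikh fh; set g := fun z : spacetime => _ in ikh *.
have ikh' : (leb1 \x @leb R N).-integrable setT g by [].
have iF := integrable_fubini_F ikh'; have EF := integral12_prod_meas1 ikh'.
set F := fubini_F _ _ in iF EF.
pose phi s := heat (t - s) (f s) x.
have phiE s : (0 < s < t)%R -> phi s = fine (F s).
  move=> st; have /andP[s0 slt] := st.
  rewrite /phi /heat subr_eq0 gt_eqF// /Rintegral fh//; congr fine.
  by apply: eq_integral => y _; rewrite /g /duhamel_kernel /= st.
have F0 s : ~~ (0 < s < t)%R -> F s = 0.
  move=> st; rewrite /F /fubini_F; apply: integral0_eq => y _.
  by rewrite /g /duhamel_kernel /= (negbTE st) mul0r.
have ifF : leb1.-integrable setT (EFin \o (fine \o F)).
  apply: (le_integrable measurableT _ _ iF).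
    apply/measurable_EFinP; apply: measurableT_comp => //.
    exact: (measurable_int _ iF).
  by move=> s _ /=; case: (F s) => [r| |]//=; rewrite normr0 leey.
have mitv : measurable (`]0%R, t[ : set R) by exact: measurable_itv.
have iphi : leb1.-integrable `]0%R, t[ (EFin \o phi).
  have H : leb1.-integrable `]0%R, t[ (EFin \o (fine \o F)) by exact: integrableS ifF.
  apply: eq_integrable H => //.
  by move=> s; rewrite inE /= in_itv/= => st; rewrite phiE.
have mphi : measurable_fun `]0%R, t[ phi by apply/measurable_EFinP; exact: (measurable_int _ iphi).
have mphic : measurable_fun `[0%R, t] phi by exact: measurable_fun_itv_cc mphi.
split.
  apply/integrableP; split; first by apply/measurable_EFinP.
  rewrite integral_itv_bndoo; last first.
    by apply: measurableT_comp => //; apply/measurable_EFinP.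
  by have /integrableP[] := iphi.
rewrite /Rintegral; congr fine.
rewrite integral_itv_bndoo; last by apply/measurable_EFinP.
transitivity (\int[leb1]_(s in `]0%R, t[) (EFin \o (fine \o F)) s).
  by apply: eq_integral => s; rewrite inE /= in_itv/= => st; rewrite -/(phi s) phiE.
transitivity (\int[leb1]_s F s); last exact: EF.
rewrite integral_mkcond; apply: ae_eq_integral => //.
- by apply/(measurable_restrictT _ mitv)/measurable_funTS; have /integrableP[] := ifF.
- exact: (measurable_int _ iF).
have := integrable_ae measurableT iF; apply: filterS => s /(_ I) Fs _.
rewrite patchE mem_setE in_itv/=; case: ifPn => [_|/F0 ->//].
by rewrite /comp fineK.
Qed.

End duhamel_time_integral.

(** * Approximate identities in L^1 *)

Section approximate_identity.
Local Open Scope ereal_scope.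

(** Dominates the L^1 distance between f and its average under k. Having a nonnegative integrand, it
    can be handled by Tonelli and splits along product spaces. *)
Definition oscillation d (X : measurableType d) (R : realType)
    (m : {measure set X -> \bar R}) (k : X * X -> R) (f : X -> R) : \bar R :=
  \int[m]_x \int[m]_y (k (x, y) * `|f y - f x|)%:E.

(** The density of a doubly stochastic kernel; the mass in the first variable makes averaging a
    contraction of L^1. *)
Record markov_kernel d (X : measurableType d) (R : realType)
    (m : {measure set X -> \bar R}) (k : X * X -> R) : Prop := MarkovKernel {
  markov_measurable : measurable_fun [set: X * X] k;
  markov_ge0 : forall z, (0 <= k z)%R;
  markov_right : forall x, \int[m]_y (k (x, y))%:E = 1;
  markov_left : forall y, \int[m]_x (k (x, y))%:E = 1
}.

Section oscillation_bounds.
Context d (X : measurableType d) (R : realType)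
  (m : {sigma_finite_measure set X -> \bar R}) (k : X * X -> R).
Hypothesis mk : markov_kernel m k.
Implicit Types f g : X -> R.

Let mkk := markov_measurable mk.
Let k0 := markov_ge0 mk.

Let mkx x : measurable_fun setT (fun y => (k (x, y))%:E).
Proof. by apply/measurable_EFinP; exact: measurable_fun_pair2. Qed.

Let mky y : measurable_fun setT (fun x => (k (x, y))%:E).
Proof. by apply/measurable_EFinP; exact: measurable_fun_pair1. Qed.

Lemma measurable_oscillation_integrand f : measurable_fun setT f ->
  measurable_fun [set: X * X] (fun z => (k z * `|f z.2 - f z.1|)%:E).
Proof.
move=> mf; apply/measurable_EFinP; apply: measurable_funM => //.
apply: measurableT_comp => //; apply: measurable_funB.
  exact: (measurableT_comp mf measurable_snd).
exact: (measurableT_comp mf measurable_fst).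
Qed.

Lemma oscillation_integrand_ge0 f z : 0 <= (k z * `|f z.2 - f z.1|)%:E.
Proof. by rewrite lee_fin mulr_ge0. Qed.

Lemma oscillation_ge0 f : 0 <= oscillation m k f.
Proof. by apply: integral_ge0 => x _; apply: integral_ge0 => y _; rewrite lee_fin mulr_ge0. Qed.

Lemma integral_markov_right (h : X -> \bar R) : measurable_fun setT h ->
  (forall x, 0 <= h x) -> \int[m]_x \int[m]_y ((k (x, y))%:E * h x) = \int[m]_x h x.
Proof.
move=> mh h0; apply: eq_integral => x _; rewrite ge0_integralZr//.
  by rewrite markov_right ?mul1e.
by move=> y _; rewrite lee_fin.
Qed.

Lemma integral_markov_left (h : X -> \bar R) : measurable_fun setT h ->
  (forall x, 0 <= h x) -> \int[m]_x \int[m]_y ((k (x, y))%:E * h y) = \int[m]_x h x.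
Proof.
move=> mh h0.
have mI : measurable_fun [set: X * X] (fun z => (k z)%:E * h z.2).
  apply: emeasurable_funM; first exact/measurable_EFinP.
  exact: (measurableT_comp mh measurable_snd).
have I0 z : 0 <= (k z)%:E * h z.2 by rewrite mule_ge0// lee_fin.
rewrite [LHS](fubini_tonelli (m1 := m) (m2 := m) _ mI I0).
apply: eq_integral => y _ /=; rewrite ge0_integralZr//.
  by rewrite markov_left ?mul1e.
by move=> x _; rewrite lee_fin.
Qed.

(** The difference |f - g| is counted twice, once at each variable, and the two mass conditions
    integrate the kernel out. It is used with g = 0 and M = 0 as an a priori bound, and with M = 1
    for density arguments. *)
Lemma oscillation_le f g (M : R) : measurable_fun setT f -> measurable_fun setT g ->
  (forall x y, `|f y - f x| <= M * `|g y - g x| + `|f y - g y| + `|f x - g x|)%R ->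
  (0 <= M)%R ->
  oscillation m k f <= M%:E * oscillation m k g + 2%:E * \int[m]_x `|f x - g x|%:E.
Proof.
move=> mf mg fg M0; set D := fun x => `|f x - g x|%:E.
have mD : measurable_fun setT D.
  by apply/measurable_EFinP; apply: measurableT_comp => //; exact: measurable_funB.
have D0 x : 0 <= D x by rewrite lee_fin.
have mDy : measurable_fun [set: X * X] (fun z => (k z)%:E * D z.2).
  apply: emeasurable_funM; first exact/measurable_EFinP.
  exact: (measurableT_comp mD measurable_snd).
have mDx : measurable_fun [set: X * X] (fun z => (k z)%:E * D z.1).
  apply: emeasurable_funM; first exact/measurable_EFinP.
  exact: (measurableT_comp mD measurable_fst).
have kD0 (z z' : X * X) x : 0 <= (k z)%:E * D x by rewrite mule_ge0// lee_fin.
have mg' : measurable_fun [set: X * X] (fun z => M%:E * (k z * `|g z.2 - g z.1|)%:E).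
  by apply: measurable_funeM; exact: measurable_oscillation_integrand.
have g'0 z : 0 <= M%:E * (k z * `|g z.2 - g z.1|)%:E.
  by rewrite mule_ge0 ?lee_fin// mulr_ge0.
have iter (h : X * X -> \bar R) : measurable_fun setT h -> (forall z, 0 <= h z) ->
    \int[m]_x \int[m]_y h (x, y) = \int[m \x m]_z h z.
  by move=> mh h0; rewrite [RHS](fubini_tonelli1 (m1 := m) (m2 := m) _ mh h0).
have -> : 2%:E * \int[m]_x D x = \int[m \x m]_z ((k z)%:E * D z.2) +
    \int[m \x m]_z ((k z)%:E * D z.1).
  rewrite -(iter (fun z => (k z)%:E * D z.2))//; last by move=> z; exact: kD0.
  rewrite -(iter (fun z => (k z)%:E * D z.1))//; last by move=> z; exact: kD0.
  by rewrite /= integral_markov_left// integral_markov_right// mule_natl.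
have -> : M%:E * oscillation m k g = \int[m \x m]_z (M%:E * (k z * `|g z.2 - g z.1|)%:E).
  rewrite (ge0_integralZl (m \x m) measurableT (measurable_oscillation_integrand mg)
    (fun z _ => oscillation_integrand_ge0 g z) _) ?lee_fin//.
  by rewrite -(iter _ (measurable_oscillation_integrand mg)
    (oscillation_integrand_ge0 g)).
rewrite -(ge0_integralD (m \x m) measurableT (fun z _ => kD0 z z z.2) mDy
  (fun z _ => kD0 z z z.1) mDx).
rewrite -(ge0_integralD (m \x m) measurableT (fun z _ => g'0 z) mg'
  (fun z _ => adde_ge0 (kD0 z z z.2) (kD0 z z z.1)) (emeasurable_funD mDy mDx)).
rewrite /oscillation (iter _ (measurable_oscillation_integrand mf)
    (oscillation_integrand_ge0 f)).
apply: ge0_le_integral => //.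
- by move=> z _; exact: oscillation_integrand_ge0.
- exact: measurable_oscillation_integrand.
- by do 2 apply: emeasurable_funD => //.
move=> [x y] _ /=; rewrite /D -!EFinM -!EFinD lee_fin.
by rewrite mulrCA -!mulrDr ler_wpM2l// addrA fg.
Qed.

End oscillation_bounds.

End approximate_identity.

Section oscillation_convergence.
Local Open Scope ereal_scope.

Lemma ge0_le_cvg0 (R : realType) (f h : nat -> \bar R) :
  (forall n, 0 <= f n) -> (forall n, f n <= h n) ->
  h n @[n --> \oo] --> 0 -> f n @[n --> \oo] --> 0.
Proof.
move=> f0 fh; apply: squeeze_cvge; last exact: cvg_cst.
by apply: nearW => n; rewrite f0 fh.
Qed.

Definition oscillation_vanishes d (X : measurableType d) (R : realType)
    (m : {measure set X -> \bar R}) (k : nat -> X * X -> R) : Prop :=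
  forall f : X -> R, m.-integrable setT (EFin \o f) ->
    oscillation m (k n) f @[n --> \oo] --> 0.

Lemma oscillation_le_integral d (X : measurableType d) (R : realType)
    (m : {sigma_finite_measure set X -> \bar R}) (k : X * X -> R) (f : X -> R) :
  markov_kernel m k -> measurable_fun setT f ->
  oscillation m k f <= 2%:E * \int[m]_x `|f x|%:E.
Proof.
move=> mk mf.
have := @oscillation_le _ _ _ m k mk f (cst 0%R) 0%R mf (measurable_cst _).
rewrite mul0e add0e => H; have {H} := H _ (lexx _).
under eq_integral do rewrite subr0.
by apply => x y /=; rewrite mul0r add0r !subr0 ler_normB.
Qed.

Lemma le_integralT d (T : measurableType d) (R : realType)
    (mu : {measure set T -> \bar R}) (f g : T -> \bar R) :
  (forall x, 0 <= f x) -> measurable_fun setT f -> measurable_fun setT g ->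
  (forall x, f x <= g x) -> \int[mu]_x f x <= \int[mu]_x g x.
Proof.
by move=> f0 mf mg fg; apply: ge0_le_integral => // x _; exact: fg.
Qed.

(** * Oscillation under product kernels *)

Section product.
Context d d' (X : measurableType d) (Y : measurableType d') (R : realType)
  (mX : {sigma_finite_measure set X -> \bar R})
  (mY : {sigma_finite_measure set Y -> \bar R}).

Section one_kernel.
Variables (k : X * X -> R) (l : Y * Y -> R).
Hypothesis mk : markov_kernel mX k.
Hypothesis ml : markov_kernel mY l.
Variable f : X * Y -> R.
Hypothesis mf : measurable_fun setT f.

Let mfx x : measurable_fun setT (fun y => f (x, y)).
Proof. exact: measurable_fun_pair2. Qed.

Let mfy y : measurable_fun setT (fun x => f (x, y)).
Proof. exact: measurable_fun_pair1. Qed.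

Let phi (z : X * Y) := \int[mY]_y' (l (z.2, y') * `|f (z.1, y') - f z|)%:E.
Let psi (z : X * Y) := \int[mX]_x' (k (z.1, x') * `|f (x', z.2) - f z|)%:E.

Let mphiI : measurable_fun [set: (X * Y) * Y]
  (fun w => (l (w.1.2, w.2) * `|f (w.1.1, w.2) - f w.1|)%:E).
Proof.
apply/measurable_EFinP; apply: measurable_funM.
  apply: (measurableT_comp (markov_measurable ml)).
  apply: measurable_fun_pair => //.
  exact: (measurableT_comp measurable_snd measurable_fst).
apply: measurableT_comp => //; apply: measurable_funB.
  apply: (measurableT_comp mf); apply: measurable_fun_pair => //.
  exact: (measurableT_comp measurable_fst measurable_fst).
exact: (measurableT_comp mf measurable_fst).
Qed.

Let mpsiI : measurable_fun [set: (X * Y) * X]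
  (fun w => (k (w.1.1, w.2) * `|f (w.2, w.1.2) - f w.1|)%:E).
Proof.
apply/measurable_EFinP; apply: measurable_funM.
  apply: (measurableT_comp (markov_measurable mk)).
  apply: measurable_fun_pair => //.
  exact: (measurableT_comp measurable_fst measurable_fst).
apply: measurableT_comp => //; apply: measurable_funB.
  apply: (measurableT_comp mf); apply: measurable_fun_pair => //.
  exact: (measurableT_comp measurable_snd measurable_fst).
exact: (measurableT_comp mf measurable_fst).
Qed.

Let phi0 z : 0 <= phi z.
Proof. by apply: integral_ge0 => y _; rewrite lee_fin mulr_ge0// (markov_ge0 ml). Qed.

Let psi0 z : 0 <= psi z.
Proof. by apply: integral_ge0 => y _; rewrite lee_fin mulr_ge0// (markov_ge0 mk). Qed.

Let mphi : measurable_fun setT phi.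
Proof.
apply: (measurable_fun_fubini_tonelli_F (m2 := mY) _ mphiI) => w.
by rewrite lee_fin mulr_ge0// (markov_ge0 ml).
Qed.

Let mpsi : measurable_fun setT psi.
Proof.
apply: (measurable_fun_fubini_tonelli_F (m2 := mX) _ mpsiI) => w.
by rewrite lee_fin mulr_ge0// (markov_ge0 mk).
Qed.

Lemma measurable_oscillation_left :
  measurable_fun setT (fun x => oscillation mY l (fun y => f (x, y))).
Proof. exact: (measurable_fun_fubini_tonelli_F (m2 := mY) _ mphi phi0). Qed.

Lemma measurable_oscillation_right :
  measurable_fun setT (fun y => oscillation mX k (fun x => f (x, y))).
Proof. exact: (measurable_fun_fubini_tonelli_G (m1 := mX) _ mpsi psi0). Qed.

Let mkphi3 : measurable_fun [set: (X * Y) * X]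
  (fun w => (k (w.1.1, w.2))%:E * phi (w.2, w.1.2)).
Proof.
apply: emeasurable_funM.
  apply/measurable_EFinP; apply: (measurableT_comp (markov_measurable mk)).
  apply: measurable_fun_pair => //.
  exact: (measurableT_comp measurable_fst measurable_fst).
apply: (measurableT_comp mphi); apply: measurable_fun_pair => //.
exact: (measurableT_comp measurable_snd measurable_fst).
Qed.

Let kphi0 x x' y : 0 <= (k (x, x'))%:E * phi (x', y).
Proof. by rewrite mule_ge0// lee_fin (markov_ge0 mk). Qed.

(** The path from (x, y) to (x', y') is taken through (x', y). The first part, a step in y' only,
    loses its dependence on x by the mass of k in its first variable; in the second, a step in x'
    only, y' is integrated out by the mass of l. *)
Lemma oscillation_prod_le :
  \int[mX]_x \int[mY]_y \int[mX]_x' \int[mY]_y'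
     (k (x, x') * l (y, y') * `|f (x', y') - f (x, y)|)%:E <=
  \int[mX]_x oscillation mY l (fun y => f (x, y)) +
  \int[mY]_y oscillation mX k (fun x => f (x, y)).
Proof.
pose Phi (z : X * Y) := \int[mX]_x' ((k (z.1, x'))%:E * phi (x', z.2)).
have Phi0 z : 0 <= Phi z by apply: integral_ge0 => x' _; exact: kphi0.
have mPhi : measurable_fun setT Phi.
  by apply: (measurable_fun_fubini_tonelli_F (m2 := mX) _ mkphi3) => w; exact: kphi0.
have -> : \int[mX]_x oscillation mY l (fun y => f (x, y)) =
    \int[mX]_x \int[mY]_y Phi (x, y).
  rewrite [RHS](fubini_tonelli (m1 := mX) (m2 := mY) _ mPhi Phi0).
  rewrite [LHS](fubini_tonelli (m1 := mX) (m2 := mY) phi mphi phi0).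
  apply: eq_integral => y _; rewrite /Phi /=.
  by rewrite -(integral_markov_left mk (measurable_fun_pair1 y mphi)).
have -> : \int[mY]_y oscillation mX k (fun x => f (x, y)) =
    \int[mX]_x \int[mY]_y psi (x, y).
  by rewrite [RHS](fubini_tonelli (m1 := mX) (m2 := mY) _ mpsi psi0).
rewrite -ge0_integralD//; first last.
- exact: (measurable_fun_fubini_tonelli_F (m2 := mY) _ mpsi psi0).
- by move=> x _; apply: integral_ge0.
- exact: (measurable_fun_fubini_tonelli_F (m2 := mY) _ mPhi Phi0).
- by move=> x _; apply: integral_ge0.
pose I4 (w : ((X * Y) * X) * Y) : \bar R := (k (w.1.1.1, w.1.2) * l (w.1.1.2, w.2) *
  `|f (w.1.2, w.2) - f w.1.1|)%:E.
have mI4 : measurable_fun setT I4.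
  have m1 : measurable_fun [set: ((X * Y) * X) * Y] (fun w => w.1.1).
    exact: (measurableT_comp measurable_fst measurable_fst).
  have m2 : measurable_fun [set: ((X * Y) * X) * Y] (fun w => w.1.2).
    exact: (measurableT_comp measurable_snd measurable_fst).
  apply/measurable_EFinP; apply: measurable_funM.
    apply: measurable_funM.
      apply: (measurableT_comp (markov_measurable mk)); apply: measurable_fun_pair => //.
      exact: (measurableT_comp measurable_fst m1).
    apply: (measurableT_comp (markov_measurable ml)); apply: measurable_fun_pair => //.
    exact: (measurableT_comp measurable_snd m1).
  apply: measurableT_comp => //; apply: measurable_funB; last exact: measurableT_comp.
  by apply: (measurableT_comp mf); apply: measurable_fun_pair.
have I40 w : 0 <= I4 w.
  by rewrite lee_fin mulr_ge0// mulr_ge0// ?(markov_ge0 mk) ?(markov_ge0 ml).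
pose I3 (w : (X * Y) * X) := \int[mY]_y' I4 (w, y').
have I30 w : 0 <= I3 w by apply: integral_ge0.
have mI3 : measurable_fun setT I3.
  exact: (measurable_fun_fubini_tonelli_F (m2 := mY) _ mI4 I40).
pose I2 (z : X * Y) := \int[mX]_x' I3 (z, x').
have I20 z : 0 <= I2 z by apply: integral_ge0.
have mI2 : measurable_fun setT I2.
  exact: (measurable_fun_fubini_tonelli_F (m2 := mX) _ mI3 I30).
have -> : \int[mX]_x \int[mY]_y \int[mX]_x' \int[mY]_y'
     (k (x, x') * l (y, y') * `|f (x', y') - f (x, y)|)%:E = \int[mX]_x \int[mY]_y I2 (x, y).
  by [].
apply: le_integralT.
- by move=> x; exact: integral_ge0.
- exact: (measurable_fun_fubini_tonelli_F (m2 := mY) _ mI2 I20).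
- by apply: emeasurable_funD;
    [exact: (measurable_fun_fubini_tonelli_F (m2 := mY) _ mPhi Phi0)
    |exact: (measurable_fun_fubini_tonelli_F (m2 := mY) _ mpsi psi0)].
move=> x; rewrite -(ge0_integralD mY measurableT (fun y _ => Phi0 (x, y))
  (measurable_fun_pair2 x mPhi) (fun y _ => psi0 (x, y)) (measurable_fun_pair2 x mpsi)).
apply: le_integralT => [y||| y].
- exact: I20.
- exact: (measurable_fun_pair2 x mI2).
- by apply: emeasurable_funD; [exact: (measurable_fun_pair2 x mPhi)|
    exact: (measurable_fun_pair2 x mpsi)].
rewrite /I2 /Phi /psi /=.
have mkx : measurable_fun setT (fun x' => k (x, x')).
  exact: (measurable_fun_pair2 x (markov_measurable mk)).
have mA : measurable_fun setT (fun x' => (k (x, x'))%:E * phi (x', y)).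
  by apply: emeasurable_funM; [exact/measurable_EFinP|exact: (measurable_fun_pair1 y mphi)].
have mB : measurable_fun setT (fun x' => (k (x, x') * `|f (x', y) - f (x, y)|)%:E).
  apply/measurable_EFinP; apply: measurable_funM => //.
  by apply: measurableT_comp => //; apply: measurable_funB.
have B0 x' : 0 <= (k (x, x') * `|f (x', y) - f (x, y)|)%:E.
  by rewrite lee_fin mulr_ge0// (markov_ge0 mk).
rewrite -(ge0_integralD mX measurableT (fun x' _ => kphi0 x x' y) mA (fun x' _ => B0 x') mB).
apply: le_integralT => [x'|||x'].
- exact: I30.
- exact: (measurable_fun_pair2 (x, y) mI3).
- exact: emeasurable_funD.
rewrite /I3 /phi /I4 /=.
have mly : measurable_fun setT (fun y' => l (y, y')).
  exact: (measurable_fun_pair2 y (markov_measurable ml)).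
have mC : measurable_fun setT (fun y' => (l (y, y') * `|f (x', y') - f (x', y)|)%:E).
  apply/measurable_EFinP; apply: measurable_funM => //.
  by apply: measurableT_comp => //; apply: measurable_funB.
have C0 y' : 0 <= (l (y, y') * `|f (x', y') - f (x', y)|)%:E.
  by rewrite lee_fin mulr_ge0// (markov_ge0 ml).
rewrite -(ge0_integralZl mY measurableT mC (fun y' _ => C0 y')); last first.
  by rewrite lee_fin (markov_ge0 mk).
have mD : measurable_fun setT
    (fun y' => (l (y, y'))%:E * (k (x, x') * `|f (x', y) - f (x, y)|)%:E).
  by apply: emeasurable_funM => //; exact/measurable_EFinP.
(* The mass 1 of l (y, .) is inserted, to bring the step in x' under the integral in y'. *)
rewrite -[X in _ <= _ + X]mul1e -(markov_right ml y) -ge0_integralZr//; first last.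
- by move=> y' _; rewrite lee_fin (markov_ge0 ml).
- exact/measurable_EFinP.
have mC' := measurable_funeM (k (x, x'))%:E mC.
have C'0 y' : 0 <= (k (x, x'))%:E * (l (y, y') * `|f (x', y') - f (x', y)|)%:E.
  by rewrite mule_ge0 ?C0// lee_fin (markov_ge0 mk).
have D0 y' : 0 <= (l (y, y'))%:E * (k (x, x') * `|f (x', y) - f (x, y)|)%:E.
  by rewrite mule_ge0 ?B0// lee_fin (markov_ge0 ml).
rewrite -(ge0_integralD mY measurableT (fun y' _ => C'0 y') mC' (fun y' _ => D0 y') mD).
apply: le_integralT => [y'|||y'].
- exact: (I40 (x, y, x', y')).
- exact: (measurable_fun_pair2 (x, y, x') mI4).
- exact: emeasurable_funD.
rewrite -!EFinM -EFinD lee_fin.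
rewrite [leRHS](_ : _ = k (x, x') * l (y, y') *
    (`|f (x', y') - f (x', y)| + `|f (x', y) - f (x, y)|))%R; last by ring.
rewrite ler_wpM2l//; last exact: ler_distD.
by rewrite mulr_ge0// ?(markov_ge0 mk) ?(markov_ge0 ml).
Qed.

End one_kernel.

(** Almost every slice of f is integrable, so the oscillation in one variable tends to 0 for almost
    every value of the other; twice the L^1 norm of the slice dominates. The conclusion stays in
    iterated form, as it will be transported to tuples by [cons_coord]. *)
Lemma oscillation_vanishes_prod (k : nat -> X * X -> R) (l : nat -> Y * Y -> R) :
  (forall n, markov_kernel mX (k n)) -> (forall n, markov_kernel mY (l n)) ->
  oscillation_vanishes mX k -> oscillation_vanishes mY l ->
  forall f : X * Y -> R, measurable_fun setT f ->
    \int[mX]_x \int[mY]_y `|f (x, y)|%:E < +oo ->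
    \int[mX]_x \int[mY]_y \int[mX]_x' \int[mY]_y'
     (k n (x, x') * l n (y, y') * `|f (x', y') - f (x, y)|)%:E @[n --> \oo] --> 0.
Proof.
move=> mk ml k0 l0 f mf foo.
have mfx x : measurable_fun setT (fun y => f (x, y)) by exact: (measurable_fun_pair2 x).
have mfy y : measurable_fun setT (fun x => f (x, y)) by exact: (measurable_fun_pair1 y).
have mF : measurable_fun setT (fun z => `|f z|%:E).
  by apply/measurable_EFinP; exact: measurableT_comp.
have F0 z : 0 <= `|f z|%:E by rewrite lee_fin.
have foo' : \int[mY]_y \int[mX]_x `|f (x, y)|%:E < +oo.
  by rewrite -(fubini_tonelli (m1 := mX) (m2 := mY) _ mF F0).
pose X1 x := \int[mY]_y `|f (x, y)|%:E.
pose Y1 y := \int[mX]_x `|f (x, y)|%:E.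
have mX1 : measurable_fun setT X1.
  exact: (measurable_fun_fubini_tonelli_F (m2 := mY) _ mF F0).
have mY1 : measurable_fun setT Y1.
  exact: (measurable_fun_fubini_tonelli_G (m1 := mX) _ mF F0).
have X10 x : 0 <= X1 x by apply: integral_ge0.
have Y10 y : 0 <= Y1 y by apply: integral_ge0.
have iX1 : mX.-integrable setT X1.
  by apply/integrableP; split => //; under eq_integral do rewrite gee0_abs//.
have iY1 : mY.-integrable setT Y1.
  by apply/integrableP; split => //; under eq_integral do rewrite gee0_abs//.
have hl : \int[mX]_x oscillation mY (l n) (fun y => f (x, y)) @[n --> \oo] --> 0.
  have [//||||||_ _] := @dominated_convergence _ _ _ mX setT _
    (fun n x => oscillation mY (l n) (fun y => f (x, y))) (cst 0) (fun x => 2%:E * X1 x).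
  - by move=> n; exact: measurable_oscillation_left.
  - exact: measurable_cst.
  - apply: filterS (integrable_ae measurableT iX1) => x /(_ I) X1x _.
    apply: l0; apply/integrableP; split; first exact/measurable_EFinP.
    by move: X1x; rewrite ge0_fin_numE.
  - exact: integrableZl.
  - apply: aeW => x n _; rewrite gee0_abs; last exact: oscillation_ge0.
    exact: oscillation_le_integral.
  by rewrite integral0.
have hk : \int[mY]_y oscillation mX (k n) (fun x => f (x, y)) @[n --> \oo] --> 0.
  have [//||||||_ _] := @dominated_convergence _ _ _ mY setT _
    (fun n y => oscillation mX (k n) (fun x => f (x, y))) (cst 0) (fun x => 2%:E * Y1 x).
  - by move=> n; exact: measurable_oscillation_right.
  - exact: measurable_cst.
  - apply: filterS (integrable_ae measurableT iY1) => x /(_ I) X1x _.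
    apply: k0; apply/integrableP; split; first exact/measurable_EFinP.
    by move: X1x; rewrite ge0_fin_numE.
  - exact: integrableZl.
  - apply: aeW => x n _; rewrite gee0_abs; last exact: oscillation_ge0.
    exact: oscillation_le_integral.
  by rewrite integral0.
have h := cvgeD (isT : (0 : \bar R) +? 0) hl hk; rewrite adde0 in h.
apply: (ge0_le_cvg0 _ _ (h _)) => n; last exact: oscillation_prod_le.
apply: integral_ge0 => x _; apply: integral_ge0 => y _.
apply: integral_ge0 => x' _; apply: integral_ge0 => y' _.
by rewrite lee_fin mulr_ge0// mulr_ge0// ?(markov_ge0 (mk n)) ?(markov_ge0 (ml n)).
Qed.

End product.
End oscillation_convergence.

Lemma ge0_cvge0P (R : realType) (T : Type) (F : set_system T) {FF : Filter F}
    (u : T -> \bar R) : (forall t, (0 <= u t)%E) ->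
  (u t @[t --> F] --> 0%E) <-> (forall e : R, 0 < e -> \forall t \near F, (u t <= e%:E)%E).
Proof.
move=> u0; split=> [/fine_cvgP[uf /cvgrPdist_le ul] e e0|ue].
  near=> t; have ut : u t \is a fin_num by near: t.
  rewrite -(fineK ut) lee_fin.
  have : `|0 - fine (u t)| <= e by near: t; exact: ul.
  by rewrite sub0r normrN ger0_norm// fine_ge0.
have uf : \forall t \near F, u t \is a fin_num.
  near=> t; rewrite ge0_fin_numE//; apply: (@le_lt_trans _ _ 1%:E); last exact: ltry.
  by near: t; exact: ue.
apply/fine_cvgP; split => //; apply/cvgrPdist_le => e e0; near=> t.
have ut : u t \is a fin_num by near: t.
rewrite sub0r normrN ger0_norm ?fine_ge0// -lee_fin fineK//.
by near: t; exact: ue.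
Unshelve. all: by end_near. Qed.

(** * Symmetric kernels on the line with vanishing variance *)

Section line_kernel.
Context {R : realType}.
Local Notation leb1 := (@lebesgue_measure R).
Local Open Scope ereal_scope.

Section vanishing.
Variables (k : nat -> measurableTypeR R * measurableTypeR R -> R) (v : nat -> R).
Hypothesis mk : forall n, markov_kernel leb1 (k n).
Hypothesis ksym : forall n a b, k n (a, b) = k n (b, a).
Hypothesis k2 : forall n a,
  \int[leb1]_b (k n (a, b) * (b - a) ^+ 2)%:E <= (v n)%:E.
Hypothesis v0 : v n @[n --> \oo] --> 0%R.

(** Chebyshev's argument: |f b - f a| is at most e / 2 within distance d of a, and at most 2 B (b -
    a)^2 / d^2 beyond, whose average is controlled by the second moment. *)
Lemma oscillation_near (f : measurableTypeR R -> R) (B : R) (a : measurableTypeR R) :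
  measurable_fun setT f -> (forall x, `|f x| <= B)%R -> {for a, continuous f} ->
  \int[leb1]_b (k n (a, b) * `|f b - f a|)%:E @[n --> \oo] --> 0.
Proof.
move=> mf fB fa.
have B0 : (0 <= B)%R by apply: le_trans (fB 0%R).
have m1 n : measurable_fun setT (fun b => k n (a, b)).
  exact: (measurable_fun_pair2 a (markov_measurable (mk n))).
have kab n b : (0 <= k n (a, b))%R by exact: markov_ge0.
have I0 n : 0 <= \int[leb1]_b (k n (a, b) * `|f b - f a|)%:E.
  by apply: integral_ge0 => b _; rewrite lee_fin mulr_ge0.
apply/(ge0_cvge0P I0) => e e0.
have e20 : (0 < e / 2)%R by rewrite divr_gt0.
move/cvgrPdist_le : fa => /(_ _ e20) [d /= d0 dP].
have c0 : (0 <= 2 * B / d ^+ 2)%R by rewrite divr_ge0 ?sqr_ge0// mulr_ge0.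
have kI n : \int[leb1]_b (k n (a, b) * `|f b - f a|)%:E <=
    (e / 2 + 2 * B / d ^+ 2 * v n)%:E.
  apply: (@le_trans _ _ (\int[leb1]_b ((e / 2)%:E * (k n (a, b))%:E +
      (2 * B / d ^+ 2)%:E * (k n (a, b) * (b - a) ^+ 2)%:E))).
    apply: le_integralT.
    - by move=> b; rewrite lee_fin mulr_ge0.
    - apply/measurable_EFinP; apply: measurable_funM => //.
      by apply: measurableT_comp => //; exact: measurable_funB.
    - apply: emeasurable_funD; apply: measurable_funeM; first exact/measurable_EFinP.
      apply/measurable_EFinP; apply: measurable_funM => //.
      by apply: measurable_funX; exact: measurable_funB.
    move=> b; rewrite -!EFinM -EFinD lee_fin mulrCA (mulrC (e / 2)%R) -mulrDr ler_wpM2l//.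
    have [ab|ab] := ltP `|a - b|%R d.
      rewrite ler_wpDr//; last by rewrite distrC; exact: dP.
      by rewrite mulr_ge0 ?sqr_ge0// divr_ge0 ?sqr_ge0// mulr_ge0.
    rewrite ler_wpDl ?(ltW e20)//; apply: (@le_trans _ _ (2 * B)%R).
      by rewrite (le_trans (ler_normB _ _))// mulr2n mulrDl mul1r lerD.
    rewrite -[leRHS]mulrA. apply: ler_peMr; first by rewrite mulr_ge0.
    rewrite mulrC ler_pdivlMr ?exprn_gt0// mul1r.
    by rewrite -(real_normK (num_real (b - a))) distrC lerXn2r ?nnegrE ?(ltW d0).
  rewrite ge0_integralD//; first last.
  - apply: measurable_funeM; apply/measurable_EFinP; apply: measurable_funM => //.
    by apply: measurable_funX; exact: measurable_funB.
  - by move=> b _; rewrite -EFinM lee_fin (mulr_ge0 c0)// mulr_ge0// sqr_ge0.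
  - by apply: measurable_funeM; exact/measurable_EFinP.
  - by move=> b _; rewrite mule_ge0// lee_fin// ltW.
  rewrite ge0_integralZl//; first last.
  - by rewrite lee_fin ltW.
  - by move=> b _; rewrite lee_fin.
  - exact/measurable_EFinP.
  rewrite (markov_right (mk n)) mule1 ge0_integralZl//; first last.
  - by move=> b _; rewrite lee_fin mulr_ge0 ?sqr_ge0.
  - apply/measurable_EFinP; apply: measurable_funM => //.
    by apply: measurable_funX; exact: measurable_funB.
  by rewrite EFinD; apply: leeD2l; rewrite [leRHS]EFinM; apply: lee_wpmul2l.
have /cvgrPdist_le/(_ _ e20) : (2 * B / d ^+ 2 * v n)%R @[n --> \oo] --> 0%R.
  by rewrite -(mulr0 (2 * B / d ^+ 2)%R); exact: cvgMr.
apply: filterS => n; rewrite sub0r normrN => vn.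
apply: le_trans (kI n) _; rewrite lee_fin.
by have := ler_norm (2 * B / d ^+ 2 * v n)%R; lra.
Qed.

(* By symmetry of the kernel it suffices to integrate over the support of f,
   where dominated convergence applies. *)
Lemma oscillation_symmetric_le n (f : measurableTypeR R -> R) (E : set (measurableTypeR R)) :
  measurable E -> measurable_fun setT f -> (forall x, ~ E x -> f x = 0%R) ->
  oscillation leb1 (k n) f <=
  2%:E * \int[leb1]_a ((\1_E a)%:E * \int[leb1]_b (k n (a, b) * `|f b - f a|)%:E).
Proof.
move=> mE mf fE.
pose I (z : measurableTypeR R * measurableTypeR R) := (k n z * `|f z.2 - f z.1|)%:E.
have mI : measurable_fun setT I by exact: (measurable_oscillation_integrand (mk n) mf).
have I0 z : 0 <= I z by exact: (oscillation_integrand_ge0 (mk n)).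
have mE1 : measurable_fun setT (fun a : measurableTypeR R => (\1_E a : R)%:E).
  by apply/measurable_EFinP; exact: measurable_indic.
have m1I : measurable_fun setT (fun z => (\1_E z.1)%:E * I z).
  by apply: emeasurable_funM => //; exact: (measurableT_comp mE1 measurable_fst).
have m2I : measurable_fun setT (fun z => (\1_E z.2)%:E * I z).
  by apply: emeasurable_funM => //; exact: (measurableT_comp mE1 measurable_snd).
have I10 z : 0 <= (\1_E z.1)%:E * I z by rewrite mule_ge0// lee_fin.
have I20 z : 0 <= (\1_E z.2)%:E * I z by rewrite mule_ge0// lee_fin.
have E1 : \int[leb1]_a ((\1_E a)%:E * \int[leb1]_b I (a, b)) =
    \int[leb1]_a \int[leb1]_b ((\1_E a)%:E * I (a, b)).
  apply: eq_integral => a _; rewrite ge0_integralZl//.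
  exact: (measurable_fun_pair2 a mI).
have E2 : \int[leb1]_a \int[leb1]_b ((\1_E a)%:E * I (a, b)) =
    \int[leb1]_a \int[leb1]_b ((\1_E b)%:E * I (a, b)).
  rewrite [RHS](fubini_tonelli (m1 := leb1) (m2 := leb1) _ m2I I20).
  apply: eq_integral => b _; apply: eq_integral => a _.
  by rewrite /I /= ksym distrC.
have mF1 := measurable_fun_fubini_tonelli_F (m2 := leb1) _ m1I I10.
have mF2 := measurable_fun_fubini_tonelli_F (m2 := leb1) _ m2I I20.
have F10 a : 0 <= \int[leb1]_b ((\1_E a)%:E * I (a, b)).
  by apply: integral_ge0 => b _; exact: (I10 (a, b)).
have F20 a : 0 <= \int[leb1]_b ((\1_E b)%:E * I (a, b)).
  by apply: integral_ge0 => b _; exact: (I20 (a, b)).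
rewrite E1 mule_natl mule2n {2}E2.
rewrite -(ge0_integralD leb1 measurableT (fun a _ => F10 a) mF1 (fun a _ => F20 a) mF2).
apply: le_integralT => [a|||a].
- by apply: integral_ge0 => b _; exact: (I0 (a, b)).
- exact: (measurable_fun_fubini_tonelli_F (m2 := leb1) _ mI I0).
- exact: (emeasurable_funD mF1 mF2).
rewrite -(ge0_integralD leb1 measurableT (fun b _ => I10 (a, b))
  (measurable_fun_pair2 a m1I) (fun b _ => I20 (a, b)) (measurable_fun_pair2 a m2I)).
apply: le_integralT => [b|||b].
- exact: (I0 (a, b)).
- exact: (measurable_fun_pair2 a mI).
- apply: emeasurable_funD; first exact: (measurable_fun_pair2 a m1I).
  exact: (measurable_fun_pair2 a m2I).
rewrite /I -!EFinM -EFinD lee_fin !indicE /=.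
have k0 : (0 <= k n (a, b) * `|f b - f a|)%R.
  by apply: mulr_ge0; [exact: (markov_ge0 (mk n))|exact: normr_ge0].
have [aE|aE] := boolP (a \in E); first by rewrite mul1r lerDl (mulr_ge0 _ k0).
have [bE|bE] := boolP (b \in E); first by rewrite mul1r lerDr (mulr_ge0 _ k0).
have -> : f a = 0%R by apply: fE => /mem_set; exact/negP.
have -> : f b = 0%R by apply: fE => /mem_set; exact/negP.
by rewrite subr0 normr0 mulr0 !mul0r addr0.
Qed.

(** A continuous function cut off to [- M, M] is bounded and can jump only at the two end points,
    which form a null set. Dominated convergence over the interval, which has finite measure, then
    applies. *)
Lemma oscillation_restrict (g : R -> R) (M : R) : continuous g -> (0 < M)%R ->
  oscillation leb1 (k n) (fun x => \1_(`[-M, M]) x * g x)%R @[n --> \oo] --> 0.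
Proof.
move=> cg M0; set E : set R := `[(- M)%R, M]%classic; set f := (fun x : measurableTypeR R => \1_E x * g x)%R.
have mE : measurable (E : set (measurableTypeR R)) by exact: measurable_itv.
have mg : measurable_fun setT (g : measurableTypeR R -> R).
  exact: continuous_measurable_fun.
have mf : measurable_fun setT (f : measurableTypeR R -> R).
  by apply: measurable_funM => //; exact: measurable_indic.
have [B fB] : exists B : R, forall x, (`|f x| <= B)%R.
  have : compact (g @` E).
    by apply: continuous_compact; [exact: continuous_subspaceT|exact: segment_compact].
  move=> /compact_bounded[B [_ /(_ (`|B| + 1)%R)]] HB; exists (`|B| + 1)%R => x.
  have B1 : (B < `|B| + 1)%R by rewrite (le_lt_trans (ler_norm _))// ltrDl.
  rewrite /f indicE; have [xE|xE] := boolP (x \in E); rewrite ?mul1r.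
    by apply: HB => //; exists x => //; rewrite -inE.
  by rewrite mul0r normr0 addr_ge0.
have fE x : ~ E x -> f x = 0%R by move=> nE; rewrite /f indicE memNset ?mul0r.
have B0 : (0 <= B)%R by apply: le_trans (fB 0%R).
pose H n a := (\1_E a)%:E * \int[leb1]_b (k n (a, b) * `|f b - f a|)%:E.
have H0 n a : 0 <= H n a.
  rewrite mule_ge0 ?lee_fin//; apply: integral_ge0 => b _.
  by rewrite lee_fin mulr_ge0// (markov_ge0 (mk n)).
have mH n : measurable_fun setT (H n : measurableTypeR R -> \bar R).
  apply: emeasurable_funM; first by apply/measurable_EFinP; exact: measurable_indic.
  apply: (measurable_fun_fubini_tonelli_F (m2 := leb1) _
    (measurable_oscillation_integrand (mk n) mf)).
  by move=> z; exact: (oscillation_integrand_ge0 (mk n)).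
have aeM : {ae leb1, forall a : measurableTypeR R, (a : R) <> M /\ (a : R) <> - M}%R.
  have ae1 c : {ae leb1, forall a : measurableTypeR R, (a : R) <> c}.
    exists [set c]; split; [exact: measurable_set1|exact: lebesgue_measure_set1|].
    by move=> x /= /contrapT.
  by apply: filterS2 (ae1 M) (ae1 (- M)%R) => a.
have HI : \int[leb1]_a H n a @[n --> \oo] --> 0.
  have [//||||||_ _] := @dominated_convergence _ _ _ leb1 setT _
    H (cst 0) (fun a : measurableTypeR R => (2 * B)%:E * (\1_E a)%:E).
  - exact: mH.
  - exact: measurable_cst.
  - apply: filterS aeM => a [aM aN] _; rewrite /H.
    have [aE|aE] := boolP (a \in E); last first.
      by rewrite indicE (negbTE aE); under eq_fun do rewrite mul0e; exact: cvg_cst.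
    rewrite indicE aE; under eq_fun do rewrite mul1e; apply: (oscillation_near mf fB).
    have aI : (a : R) \in (`](- M)%R, M[ : interval R).
      move: aE; rewrite inE /E /= !in_itv/= !lt_neqAle eq_sym => /andP[-> ->].
      by rewrite !andbT; apply/andP; split; exact/eqP.
    have fga : f a = g a by rewrite /f indicE aE mul1r.
    suff : f x @[x --> (a : R)] --> f a by [].
    rewrite fga; apply: (cvg_trans _ (cg a)); apply: near_eq_cvg; near=> x.
    have : x \in (`](- M)%R, M[ : interval R) by near: x; exact: near_in_itvoo aI.
    rewrite in_itv/= => /andP[xM xN]; rewrite /f indicE mem_set ?mul1r//.
    by rewrite /E /= in_itv/= !ltW.
  - apply: integrableZl => //; apply: integrable_indic_itv.
  - apply: aeW => a n _; rewrite gee0_abs// /H muleC.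
    apply: lee_wpmul2r; first by rewrite lee_fin.
    apply: (@le_trans _ _ (\int[leb1]_b ((2 * B)%:E * (k n (a, b))%:E))).
      apply: le_integralT => [b|||b].
      - by rewrite lee_fin mulr_ge0// (markov_ge0 (mk n)).
      - exact: (measurable_fun_pair2 a (measurable_oscillation_integrand (mk n) mf)).
      - apply: measurable_funeM; apply/measurable_EFinP.
        exact: (measurable_fun_pair2 a (markov_measurable (mk n))).
      rewrite -EFinM lee_fin mulrC ler_wpM2r// ?(markov_ge0 (mk n))//.
      by rewrite (le_trans (ler_normB _ _))// mulr2n mulrDl mul1r lerD.
    rewrite ge0_integralZl//; first by rewrite (markov_right (mk n)) mule1.
    - apply/measurable_EFinP.
      exact: (measurable_fun_pair2 a (markov_measurable (mk n))).
    - by move=> b _; rewrite lee_fin (markov_ge0 (mk n)).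
    - by rewrite lee_fin mulr_ge0.
  by rewrite integral0.
have HI2 : 2%:E * \int[leb1]_a H n a @[n --> \oo] --> 0.
  by rewrite -(mule0 2%:E); exact: cvgeZl.
apply: (ge0_le_cvg0 _ _ HI2) => n; first exact: (oscillation_ge0 (mk n)).
exact: oscillation_symmetric_le.
Unshelve. all: by end_near. Qed.

(** The function is first cut off to a large interval, and then approximated there by continuous
    functions, the interval having finite measure; each step costs e / 2. *)
Lemma L1_approx_restrict (f : measurableTypeR R -> R) (e : R) :
  leb1.-integrable setT (EFin \o f) -> (0 < e)%R ->
  exists g : R -> R, exists2 M : R, (0 < M)%R &
    continuous g /\
    \int[leb1]_x (`|f x - \1_(`[(- M)%R, M] : set R) x * g x|)%:E <= e%:E.
Proof.
move=> fi e0; have /integrableP[/measurable_EFinP mf foo] := fi.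
have e20 : (0 < e / 2)%R by rewrite divr_gt0.
pose E n : set (measurableTypeR R) := `[(- n.+1%:R)%R, n.+1%:R]%classic.
have mE n : measurable (E n) by exact: measurable_itv.
pose F n x := `|f x - \1_(E n) x * f x|%:E.
have mF n : measurable_fun setT (F n : measurableTypeR R -> \bar R).
  apply/measurable_EFinP; apply: measurableT_comp => //.
  by apply: measurable_funB => //; apply: measurable_funM => //; exact: measurable_indic.
have F0 n x : 0 <= F n x by rewrite lee_fin.
have Fl : \int[leb1]_x F n x @[n --> \oo] --> 0.
  have [//||||||_ _] := @dominated_convergence _ _ _ leb1 setT _
    F (cst 0) (abse \o EFin \o f).
  - exact: mF.
  - exact: measurable_cst.
  - apply: aeW => x _; apply: cvg_near_cst; exists (Num.bound `|x : R|%R) => // n /= xn.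
    have {}xn : (`|x : R| <= n.+1%:R)%R.
      apply: (le_trans (ltW (archi_boundP (normr_ge0 _)))).
      by rewrite ler_nat (leq_trans xn).
    rewrite /F indicE mem_set ?mul1r ?subrr ?normr0//.
    by rewrite /E /= in_itv/= -ler_norml.
  - by have := integrable_abse fi.
  - apply: aeW => x n _; rewrite gee0_abs//= lee_fin indicE.
    by case: (x \in E n); rewrite ?mul1r ?subrr ?normr0// mul0r subr0.
  by rewrite integral0.
have FI0 n : 0 <= \int[leb1]_x F n x by apply: integral_ge0.
have /(ge0_cvge0P FI0)/(_ _ e20)[n _ /(_ n (leqnn n))/= nF] := Fl.
have fE : leb1.-integrable (E n) (EFin \o f) by exact: integrableS fi.
have Eoo : leb1 (E n) < +oo by rewrite lebesgue_measure_itv/=; case: ifP => // _; exact: ltry.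
have [g_ [gc gi gl]] := approximation_continuous_integrable (mE n) Eoo fE.
have GI0 m : 0 <= \int[leb1]_(x in E n) `|(f x - g_ m x)%:E| by apply: integral_ge0.
have /(ge0_cvge0P GI0)/(_ _ e20)[m _ /(_ m (leqnn m))/= mG] := gl.
exists (g_ m); exists n.+1%:R => //; split; first exact: gc.
have mg : measurable_fun setT (g_ m : measurableTypeR R -> R).
  exact: continuous_measurable_fun.
have mG' : measurable_fun setT
    (fun x : measurableTypeR R => (\1_(E n) x)%:E * `|(f x - g_ m x)%:E|).
  apply: emeasurable_funM; first by apply/measurable_EFinP; exact: measurable_indic.
  apply: measurableT_comp => //; apply/measurable_EFinP; exact: measurable_funB.
apply: (@le_trans _ _ (\int[leb1]_x (F n x + (\1_(E n) x)%:E * `|(f x - g_ m x)%:E|))).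
  apply: le_integralT => [x|||x].
  - by rewrite lee_fin.
  - apply/measurable_EFinP; apply: measurableT_comp => //.
    by apply: measurable_funB => //; apply: measurable_funM => //; exact: measurable_indic.
  - exact: emeasurable_funD.
  rewrite /F lee_fin indicE -/(E n); case: (x \in E n); last by rewrite !mul0r addr0.
  by rewrite !mul1r subrr normr0 add0r.
rewrite (ge0_integralD leb1 measurableT (fun x _ => F0 n x) (mF n) _ mG'); last first.
  by move=> x _; rewrite mule_ge0// lee_fin.
rewrite (splitr e) EFinD; apply: leeD => //.
apply: le_trans mG; rewrite [leRHS]integral_mkcond le_eqVlt; apply/orP; left; apply/eqP.
apply: eq_integral => x _.
by rewrite patchE indicE; case: ifP => _; rewrite ?mul1e ?mul0e.
Qed.

Lemma oscillation_vanishes_line : oscillation_vanishes leb1 k.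
Proof.
move=> f fi; have /integrableP[/measurable_EFinP mf _] := fi.
apply/(ge0_cvge0P (fun n => oscillation_ge0 (mk n) f)) => e e0.
(* A quarter, because [oscillation_le] counts the L^1 error twice. *)
have e40 : (0 < e / 4)%R by rewrite divr_gt0.
have [g [M M0 [gc fg]]] := L1_approx_restrict fi e40.
have mg : measurable_fun setT (fun x : measurableTypeR R => \1_(`[(- M)%R, M] : set R) x * g x)%R.
  apply: measurable_funM; last exact: continuous_measurable_fun.
  by apply: measurable_indic; exact: measurable_itv.
have /(ge0_cvge0P (fun n => oscillation_ge0 (mk n) _)) := oscillation_restrict gc M0.
have e20 : (0 < e / 2)%R by rewrite divr_gt0.
move/(_ _ e20); apply: filterS => n gn.
apply: le_trans (oscillation_le (M := 1) (mk n) mf mg _ _) _ => //.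
  move=> x y; rewrite mul1r [X in (X <= _)%R](_ : _ =
    `|(g y * \1_(`[(- M)%R, M] : set R) y - g x * \1_(`[(- M)%R, M] : set R) x)
     + (f y - g y * \1_(`[(- M)%R, M] : set R) y)
     - (f x - g x * \1_(`[(- M)%R, M] : set R) x)|%R); last by congr `|_|%R; ring.
  rewrite !(mulrC (g _)).
  by rewrite (le_trans (ler_normB _ _))// lerD2r (le_trans (ler_normD _ _)).
rewrite mul1e; apply: (@le_trans _ _ ((e / 2)%:E + 2%:E * (e / 4)%:E)).
  by apply: leeD => //; apply: lee_wpmul2l.
rewrite -EFinM -EFinD lee_fin; lra.
Qed.
End vanishing.

End line_kernel.

(** * Vanishing oscillation for the heat kernel, by induction on the dimension *)

Section heat_oscillation.
Context {R : realType}.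
Local Notation leb1 := (@lebesgue_measure R).
Implicit Type N : nat.

Lemma markov_heat_kernel N (t : R) : 0 < t ->
  markov_kernel (@leb R N) (fun z => heat_kernel t (rnsub z.1 z.2)).
Proof.
move=> t0; split => [|z|x|y].
- by apply: measurable_heat_kernel => //; exact: measurable_rnsub.
- exact: heat_kernel_ge0.
- exact: integral_heat_kernel.
- exact: integral_heat_kernel_sym.
Qed.

Definition line_point (a : measurableTypeR R) : Rn R 1 := cons_coord ([tuple], a).

(** The heat kernel in dimension one, as a kernel on the line. Going through 1-tuples makes its
    symmetry and weight bounds instances of those of [heat_kernel]. *)
Definition gauss t (z : measurableTypeR R * measurableTypeR R) : R :=
  heat_kernel t (rnsub (line_point z.1) (line_point z.2)).

Lemma measurable_line_point : measurable_fun setT line_point.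
Proof.
apply: (measurableT_comp (@measurable_cons_coord R 0)).
exact: measurable_fun_pair.
Qed.

Lemma gaussE t a b : 0 < t -> gauss t (a, b) = normal_pdf (a : R) (Num.sqrt (2 * t)) b.
Proof. by move=> t0; rewrite /gauss heat_kernel_prod// big_ord1. Qed.

Lemma gauss_sym t a b : gauss t (a, b) = gauss t (b, a).
Proof. exact: heat_kernel_sym. Qed.

Lemma markov_gauss t : 0 < t -> markov_kernel leb1 (gauss t).
Proof.
move=> t0; have right a : (\int[leb1]_b (gauss t (a, b))%:E = 1)%E.
  by under eq_integral do rewrite gaussE//; exact: integral_normal_pdf.
split => [|z|//|b].
- apply: measurable_heat_kernel => //; apply: measurable_rnsub.
    exact: (measurableT_comp measurable_line_point measurable_fst).
  exact: (measurableT_comp measurable_line_point measurable_snd).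
- exact: heat_kernel_ge0.
- by under eq_integral do rewrite gauss_sym; exact: right.
Qed.

(** The weight bound with c = 2: (b - a)^2 times the kernel at time t is at most C t times the
    kernel at time 2 t, which has mass 1. *)
Lemma gauss_second_moment : exists C : R, forall t a, 0 < t ->
  (\int[leb1]_b (gauss t (a, b) * (b - a) ^+ 2)%:E <= (C * t)%:E)%E.
Proof.
have [C C0 CP] := @heat_kernel_weight R 1 2 (ltr0n _ 2).
exists C => t a t0; have t20 : 0 < 2 * t by rewrite mulr_gt0.
have mg s : 0 < s -> measurable_fun setT (fun b => gauss s (a, b)).
  by move=> s0; exact: (measurable_fun_pair2 a (markov_measurable (markov_gauss s0))).
apply: (@le_trans _ _ (\int[leb1]_b ((C * t)%:E * (gauss (2 * t) (a, b))%:E))%E).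
  apply: le_integralT => [b|||b].
  - by rewrite lee_fin; apply: mulr_ge0; [exact: heat_kernel_ge0|exact: sqr_ge0].
  - apply/measurable_EFinP; apply: measurable_funM; first exact: mg.
    by apply: measurable_funX; exact: measurable_funB.
  - by apply: measurable_funeM; apply/measurable_EFinP; exact: mg.
  rewrite -EFinM lee_fin mulrC; have := CP t (rnsub (line_point a) (line_point b)) t0.
  rewrite powR_mulrn ?enorm_ge0// enorm_sqr big_ord1 tnth_rnsub divff// powRr1 ?(ltW t0)//.
  by rewrite -(sqrrN (b - a)) opprB.
rewrite ge0_integralZl//.
- by rewrite (markov_right (markov_gauss t20)) mule1.
- by apply/measurable_EFinP; exact: mg.
- by move=> b _; rewrite lee_fin heat_kernel_ge0.
- by rewrite lee_fin mulr_ge0 ?ltW.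
Qed.

Lemma heat_kernel_cons N t (x y : Rn R N) (a b : measurableTypeR R) : 0 < t ->
  heat_kernel t (rnsub (cons_coord (x, a)) (cons_coord (y, b))) =
  heat_kernel t (rnsub x y) * gauss t (a, b).
Proof.
move=> t0; rewrite heat_kernel_prod// big_ord_recl heat_kernel_prod// gaussE// mulrC.
by congr (_ * _); apply: eq_bigr => i _; rewrite !tnthS.
Qed.

(** In dimension 0 there is a single point and nothing oscillates. The inductive step splits the
    kernel into the one in dimension N and [gauss]. *)
Lemma oscillation_vanishes_heat N (s : nat -> R) : (forall n, 0 < s n) ->
  s n @[n --> \oo] --> 0 ->
  oscillation_vanishes (@leb R N) (fun n z => heat_kernel (s n) (rnsub z.1 z.2)).
Proof.
move=> s0 sl; elim: N => [|N IH] f fi; have /integrableP[/measurable_EFinP mf foo] := fi.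
  apply: cvg_near_cst; apply: nearW => n; rewrite /oscillation.
  apply: integral0_eq => x _; apply: integral0_eq => y _.
  by rewrite (_ : f y = f x) ?subrr ?normr0 ?mulr0// (tuple0 y) (tuple0 x).
have [C CP] := gauss_second_moment.
have gl : oscillation_vanishes leb1 (fun n => gauss (s n)).
  apply: (@oscillation_vanishes_line _ _ (fun n => C * s n)).
  - by move=> n; exact: markov_gauss.
  - by move=> n a b; exact: gauss_sym.
  - by move=> n a; exact: CP.
  - by rewrite -(mulr0 C); exact: cvgMr.
pose g := f \o @cons_coord R N.
have mg : measurable_fun setT g by exact: (measurableT_comp mf (@measurable_cons_coord R N)).
have goo : (\int[@leb R N]_x \int[leb1]_y `|g (x, y)|%:E < +oo)%E.
  rewrite -(ge0_integral_lebS (f := fun x => `|f x|%:E))//.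
  by apply/measurable_EFinP; exact: measurableT_comp.
have := oscillation_vanishes_prod (fun n => markov_heat_kernel N (s0 n))
  (fun n => markov_gauss (s0 n)) IH gl mg goo.
apply: cvg_trans; apply: near_eq_cvg; apply: nearW => n.
have mI := measurable_oscillation_integrand (markov_heat_kernel N.+1 (s0 n)) mf.
have I0 := oscillation_integrand_ge0 (markov_heat_kernel N.+1 (s0 n)) f.
pose G x := (\int[@leb R N.+1]_y (heat_kernel (s n) (rnsub x y) * `|f y - f x|)%:E)%E.
have mG : measurable_fun setT G.
  exact: (measurable_fun_fubini_tonelli_F (m2 := @leb R N.+1) _ mI I0).
have G0 x : (0 <= G x)%E by apply: integral_ge0 => y _; exact: (I0 (x, y)).
transitivity (\int[@leb R N.+1]_x G x)%E; last by [].
rewrite (ge0_integral_lebS mG G0).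
apply: eq_integral => x _; apply: eq_integral => a _; rewrite /G.
rewrite (ge0_integral_lebS (measurable_fun_pair2 (cons_coord (x, a)) mI)
  (fun y => I0 (cons_coord (x, a), y))).
apply: eq_integral => y _; apply: eq_integral => b _.
by rewrite /= heat_kernel_cons.
Qed.

End heat_oscillation.

(** * Strong continuity of the heat semigroup in weighted spaces *)

Section strong_continuity.
Context {R : realType} {N : nat}.
Implicit Types (f g : Rn R N -> R) (x y : Rn R N) (s : R).
Local Open Scope ereal_scope.

(** The inner integral of [oscillation]. As a nonnegative quantity dominating |heat s f - f| at each
    point, it can be measured in weighted norms. *)
Definition heat_osc s f x : \bar R :=
  \int[@leb R N]_y (heat_kernel s (rnsub x y) * `|f y - f x|)%:E.

Lemma heat_osc_ge0 s f x : 0 <= heat_osc s f x.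
Proof. by apply: integral_ge0 => y _; rewrite lee_fin mulr_ge0 ?heat_kernel_ge0. Qed.

Let measurable_integrand s f : measurable_fun setT f ->
  measurable_fun [set: Rn R N * Rn R N]
    (fun z => (heat_kernel s (rnsub z.1 z.2) * `|f z.2 - f z.1|)%:E).
Proof.
move=> mf; apply/measurable_EFinP; apply: measurable_funM.
  by apply: measurable_heat_kernel => //; exact: measurable_rnsub.
apply: measurableT_comp => //; apply: measurable_funB.
  exact: (measurableT_comp mf measurable_snd).
exact: (measurableT_comp mf measurable_fst).
Qed.

Let measurable_integrand_section s f x : measurable_fun setT f ->
  measurable_fun setT (fun y => (heat_kernel s (rnsub x y) * `|f y - f x|)%:E).
Proof. by move=> mf; exact: (measurable_fun_pair2 x (measurable_integrand s mf)). Qed.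

Lemma measurable_heat_osc s f : measurable_fun setT f ->
  measurable_fun setT (heat_osc s f).
Proof.
move=> mf.
apply: (measurable_fun_fubini_tonelli_F (m2 := @leb R N) _ (measurable_integrand s mf)).
by move=> z; rewrite lee_fin mulr_ge0 ?heat_kernel_ge0.
Qed.

Lemma heat_osc_le s f g x : (0 < s)%R -> measurable_fun setT f -> measurable_fun setT g ->
  heat_osc s f x <= heat_osc s g x +
    (heat_op s (fun y => `|f y - g y|%:E) x + `|f x - g x|%:E).
Proof.
move=> s0 mf mg.
have mk : measurable_fun setT (fun y => heat_kernel s (rnsub x y)).
  exact: measurable_heat_kernel_section.
have k0 y : (0 <= heat_kernel s (rnsub x y))%R by exact: heat_kernel_ge0.
have mfg : measurable_fun setT (fun y => `|f y - g y|%:E).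
  by apply/measurable_EFinP; apply: measurableT_comp => //; exact: measurable_funB.
have mh := measurable_heat_op_section s x mfg.
have h0 y : 0 <= (heat_kernel s (rnsub x y))%:E * `|f y - g y|%:E.
  by rewrite mule_ge0 ?lee_fin.
have mkc : measurable_fun setT (fun y => (heat_kernel s (rnsub x y))%:E * `|f x - g x|%:E).
  by apply: emeasurable_funM => //; exact/measurable_EFinP.
have kc0 y : 0 <= (heat_kernel s (rnsub x y))%:E * `|f x - g x|%:E.
  by rewrite mule_ge0 ?lee_fin.
have mg' := measurable_integrand_section s x mg.
have g'0 y : 0 <= (heat_kernel s (rnsub x y) * `|g y - g x|)%:E.
  by rewrite lee_fin; exact: mulr_ge0.
have -> : `|f x - g x|%:E =
    \int[@leb R N]_y ((heat_kernel s (rnsub x y))%:E * `|f x - g x|%:E).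
  have mkE : measurable_fun setT (fun y => (heat_kernel s (rnsub x y))%:E).
    exact/measurable_EFinP.
  rewrite (ge0_integralZr _ measurableT mkE) ?lee_fin//; last by move=> y _; rewrite lee_fin.
  by rewrite integral_heat_kernel// mul1e.
rewrite -(ge0_integralD _ measurableT (fun y _ => h0 y) mh (fun y _ => kc0 y) mkc).
rewrite -(ge0_integralD _ measurableT (fun y _ => g'0 y) mg'
  (fun y _ => adde_ge0 (h0 y) (kc0 y)) (emeasurable_funD mh mkc)).
apply: le_integralT => [y|||y].
- by rewrite lee_fin; exact: mulr_ge0.
- exact: measurable_integrand_section.
- by apply: emeasurable_funD => //; exact: emeasurable_funD.
rewrite -!EFinM -!EFinD lee_fin -!mulrDr ler_wpM2l//.
rewrite [X in (X <= _)%R](_ : _ = `|(g y - g x) + ((f y - g y) - (f x - g x))|%R).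
  by rewrite (le_trans (ler_normD _ _))// lerD2l ler_normB.
by congr `|_|%R; ring.
Qed.

Lemma heat_sub_le s f x : (0 < s)%R -> measurable_fun setT f ->
  `|heat s f x - f x|%:E <= heat_osc s f x.
Proof.
(* If the oscillation at x is finite, the kernel times f is integrable, being the sum of the kernel
   times f y - f x and the kernel times the constant f x; so the total integral in [heat] is the
   genuine one. *)
move=> s0 mf; have [->|osc_fin] := eqVneq (heat_osc s f x) +oo; first exact: leey.
have k0 y : (0 <= heat_kernel s (rnsub x y))%R by exact: heat_kernel_ge0.
have mk : measurable_fun setT (fun y => heat_kernel s (rnsub x y)).
  exact: measurable_heat_kernel_section.
have iD : (@leb R N).-integrable setT
    (fun y => (heat_kernel s (rnsub x y) * (f y - f x))%:E).
  apply/integrableP; split.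
    by apply/measurable_EFinP; apply: measurable_funM => //; exact: measurable_funB.
  under eq_integral do rewrite /= normrM (ger0_norm (k0 _)).
  by rewrite ltey.
have iC : (@leb R N).-integrable setT
    (fun y => (heat_kernel s (rnsub x y) * f x)%:E).
  apply/integrableP; split.
    by apply/measurable_EFinP; exact: measurable_funM.
  under eq_integral do rewrite /= normrM (ger0_norm (k0 _)) EFinM.
  have mkE : measurable_fun setT (fun y => (heat_kernel s (rnsub x y))%:E).
    exact/measurable_EFinP.
  rewrite (ge0_integralZr _ measurableT mkE) ?lee_fin//; last by move=> y _; rewrite lee_fin.
  by rewrite integral_heat_kernel// mul1e ltry.
have CE : (\int[@leb R N]_y (heat_kernel s (rnsub x y) * f x))%R = f x.
  rewrite /Rintegral; under eq_integral do rewrite EFinM.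
  rewrite integralZr//; last first.
    apply/integrableP; split; first exact/measurable_EFinP.
    under eq_integral do rewrite /= (ger0_norm (k0 _)).
    by rewrite integral_heat_kernel// ltry.
  by rewrite integral_heat_kernel// mul1e.
have HE : (heat s f x - f x = \int[@leb R N]_y (heat_kernel s (rnsub x y) * (f y - f x)))%R.
  apply/eqP; rewrite subr_eq -[X in _ == (_ + X)%R]CE /heat (gt_eqF s0); apply/eqP.
  rewrite -RintegralD//.
  by congr fine; apply: eq_integral => y _; congr _%:E; ring.
have /integrableP[_ iDoo] := iD.
have oscE : \int[@leb R N]_y `|(heat_kernel s (rnsub x y) * (f y - f x))%:E| = heat_osc s f x.
  by apply: eq_integral => y _; rewrite /= normrM (ger0_norm (k0 _)).
rewrite HE -oscE; have := le_normr_Rintegral measurableT iD; rewrite -lee_fin => /le_trans; apply.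
by rewrite /Rintegral fineK// ge0_fin_numE// integral_ge0.
Qed.

Section weighted_norm.
Variables (p gamma : R).
Hypotheses (N0 : (0 < N)%N) (p1 : (1 < p)%R) (gamma0 : (0 < gamma)%R)
  (gammaN : (gamma < N%:R * (1 - rinv p%:E))%R).

Let p_gt0 : (0 < p)%R. Proof. by rewrite (lt_trans ltr01). Qed.
Let p1E : 1 < p%:E. Proof. by rewrite lte_fin. Qed.

(* The integrand vanishes unless x or y lies in the ball of radius M, so the
   weight |x|^(gamma p) is at most 2^(gamma p) (|x - y|^(gamma p) + M^(gamma p)),
   and |x - y|^(gamma p) is absorbed by the kernel at time 2 t. *)
Lemma heat_osc_truncated (s : nat -> R) f (M : R) : (forall n, 0 < s n)%R ->
  s n @[n --> \oo] --> 0%R -> measurable_fun setT f -> (0 < M)%R ->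
  (forall x, `|f x| <= M)%R -> (forall x, (M < enorm x)%R -> f x = 0%R) ->
  (@leb R N).-integrable setT (EFin \o f) ->
  ewnorm p%:E gamma (heat_osc (s n) f) @[n --> \oo] --> 0.
Proof.
move=> s0 sl mf M0 fM fN fi.
have c0 : (0 < gamma * p)%R by rewrite mulr_gt0.
have [C C0 CP] := @heat_kernel_weight R N (gamma * p)%R c0.
pose A := ((2 * M) `^ (p - 1) * 2 `^ (gamma * p))%R.
have A0 : (0 < A)%R by rewrite mulr_gt0 ?powR_gt0// mulr_gt0.
have s20 n : (0 < 2 * s n)%R by rewrite mulr_gt0.
have O1 := oscillation_vanishes_heat s0 sl fi.
have sl2 : (2 * s n)%R @[n --> \oo] --> 0%R by rewrite -(mulr0 2%R); exact: cvgMr.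
have O2 := oscillation_vanishes_heat s20 sl2 fi.
have pointwise t x : (0 < t)%R -> (t <= 1)%R ->
    ((enorm x `^ gamma)%:E * heat_osc t f x) `^ p <=
    A%:E * (C%:E * heat_osc (2 * t) f x + (M `^ (gamma * p))%:E * heat_osc t f x).
  move=> t0 t1.
  have D0 y : 0 <= `|f y - f x|%:E by rewrite lee_fin.
  have mD : measurable_fun setT (fun y => `|f y - f x|%:E).
    by apply/measurable_EFinP; apply: measurableT_comp => //; exact: measurable_funB.
  have mk u : measurable_fun setT (fun y => heat_kernel u (rnsub x y)).
    exact: measurable_heat_kernel_section.
  have k0 u y : (0 <= heat_kernel u (rnsub x y))%R by exact: heat_kernel_ge0.
  have I0 u y : 0 <= (heat_kernel u (rnsub x y) * `|f y - f x|)%:E.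
    by rewrite lee_fin; apply: mulr_ge0.
  have fB y : (`|f y - f x| <= 2 * M)%R.
    by rewrite (le_trans (ler_normB _ _))// mulr2n mulrDl mul1r lerD.
  rewrite poweRM ?heat_osc_ge0 ?lee_fin ?powR_ge0// poweR_EFin -powRrM.
  (* Jensen, and |f y - f x|^p <= (2 M)^(p - 1) |f y - f x| since f is bounded: the L^p statement is
     reduced to the L^1 convergence of the oscillation. *)
  have step1 : heat_osc t f x `^ p <= ((2 * M) `^ (p - 1))%:E * heat_osc t f x.
    apply: le_trans (_ : \int[@leb R N]_y ((heat_kernel t (rnsub x y))%:E * `|f y - f x|%:E `^ p) <= _).
      have := @integral_weight_powR R _ _ (@leb R N) _ (fun y => `|f y - f x|%:E) p 1%R
        (ltW p1) ltr01 (mk t) (k0 t) mD D0.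
      by rewrite integral_heat_kernel// lexx powR1 mul1e => /(_ isT).
    rewrite -(ge0_integralZl _ measurableT (measurable_integrand_section t x mf)
      (fun y _ => I0 t y)) ?lee_fin ?powR_ge0//.
    apply: le_integralT => [y|||y].
    - by rewrite mule_ge0 ?poweR_ge0 ?lee_fin.
    - by apply: emeasurable_funM; [exact/measurable_EFinP|exact: measurable_poweR_comp].
    - by apply: measurable_funeM; exact: measurable_integrand_section.
    rewrite poweR_EFin -!EFinM lee_fin mulrCA ler_wpM2l//.
    have [->|d0] := eqVneq `|f y - f x|%R 0%R.
      by rewrite mulr0 powR0// gt_eqF.
    have -> : (`|f y - f x| `^ p = `|f y - f x| `^ (p - 1) * `|f y - f x|)%R.
      by rewrite -[X in (_ = _ * X)%R]powRr1// -powRD ?subrK// d0 implybT.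
    rewrite ler_wpM2r//.
    by apply: ge0_ler_powR; rewrite ?nnegrE ?subr_ge0 ?(ltW p1) ?mulr_ge0 ?(ltW M0).
  apply: le_trans (lee_wpmul2l _ step1) _; first by rewrite lee_fin powR_ge0.
  rewrite muleCA /A [in leRHS]EFinM -[leRHS]muleA; apply: lee_wpmul2l.
    by rewrite lee_fin powR_ge0.
  have mC u (K : R) := measurable_funeM K%:E (measurable_integrand_section u x mf).
  have mc0 : (0 <= M `^ (gamma * p))%R by exact: powR_ge0.
  have cI0 u (K : R) y : (0 <= K)%R -> 0 <= K%:E * (heat_kernel u (rnsub x y) * `|f y - f x|)%:E.
    by move=> K0; rewrite mule_ge0.
  have ZI u (K : R) : (0 <= K)%R -> K%:E * heat_osc u f x =
      \int[@leb R N]_y (K%:E * (heat_kernel u (rnsub x y) * `|f y - f x|)%:E).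
    move=> K0; rewrite (ge0_integralZl _ measurableT (measurable_integrand_section u x mf)
      (fun y _ => I0 u y)) ?lee_fin//.
  rewrite !ZI ?powR_ge0 ?(ltW C0)//.
  rewrite -(ge0_integralD _ measurableT (fun y _ => cI0 (2 * t)%R C y (ltW C0)) (mC _ _)
    (fun y _ => cI0 t _ y mc0) (mC _ _)).
  have sI0 y : 0 <= C%:E * (heat_kernel (2 * t) (rnsub x y) * `|f y - f x|)%:E +
      (M `^ (gamma * p))%:E * (heat_kernel t (rnsub x y) * `|f y - f x|)%:E.
    by apply: adde_ge0; apply: cI0 => //; exact: ltW.
  rewrite -(ge0_integralZl _ measurableT (emeasurable_funD (mC _ _) (mC _ _))
    (fun y _ => sI0 y)) ?lee_fin ?powR_ge0//.
  apply: le_integralT => [y|||y].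
  - by apply: cI0; exact: powR_ge0.
  - exact: mC.
  - by apply: measurable_funeM; exact: emeasurable_funD.
  rewrite -!EFinM lee_fin.
  have [->|d0] := eqVneq `|f y - f x|%R 0%R; first by rewrite !mulr0 addr0 mulr0.
  have hC : (enorm (rnsub x y) `^ (gamma * p) * heat_kernel t (rnsub x y) <=
      C * heat_kernel (2 * t) (rnsub x y))%R.
    apply: le_trans (CP t (rnsub x y) t0) _; rewrite -mulrA ler_wpM2l ?(ltW C0)//.
    rewrite ler_piMl//; apply: (@le_trans _ _ (1 `^ (gamma * p / 2))%R).
      by apply: ge0_ler_powR; rewrite ?nnegrE ?(ltW t0)// divr_ge0// ltW.
    by rewrite powR1.
  have CC0 : (0 <= C * heat_kernel (2 * t) (rnsub x y))%R by apply: mulr_ge0 => //; exact: ltW.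
  move: hC CC0 (k0 t y); move: (heat_kernel (2 * t) (rnsub x y)) (heat_kernel t (rnsub x y)).
  move=> k2 k1 hC CC0 k10.
  rewrite !mulrA -mulrDl (mulrA (2 `^ _)%R) ler_wpM2r//.
  have monoM (z : Rn R N) : (enorm z <= M)%R -> (enorm z `^ (gamma * p) <= M `^ (gamma * p))%R.
    by move=> zM; apply: ge0_ler_powR; rewrite ?nnegrE ?enorm_ge0 ?(ltW c0) ?(ltW M0).
  (* Three cases: x in the ball, where the weight is at most M^(gamma p); y in the ball, where the
     weight is split between x - y and y; and both outside, where f x = f y = 0. *)
  have [xM|xM] := ltP M (enorm x); last first.
    have h1 : (enorm x `^ (gamma * p) <= 2 `^ (gamma * p) * M `^ (gamma * p))%R.
      apply: le_trans (monoM _ xM) _; rewrite ler_peMl ?powR_ge0//.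
      by rewrite -[leLHS](powRr0 2%R) ler_powR ?ler1n// ltW.
    apply: le_trans (ler_wpM2r k10 h1) _.
    by rewrite -mulrA ler_wpM2l ?powR_ge0// lerDr.
  have [yM|yM] := ltP M (enorm y).
    by move: d0; rewrite !fN// subrr normr0 eqxx.
  apply: (@le_trans _ _ (2 `^ (gamma * p) * (enorm (rnsub x y) `^ (gamma * p) +
      enorm y `^ (gamma * p)) * k1)%R).
    by rewrite ler_wpM2r// enorm_powR_le// ltW.
  by rewrite -mulrA ler_wpM2l ?powR_ge0// mulrDl lerD// ler_wpM2r// monoM.
have bound t e : (0 < t)%R -> (t <= 1)%R -> (0 < e)%R ->
    \int[@leb R N]_x heat_osc t f x <= e%:E ->
    \int[@leb R N]_x heat_osc (2 * t) f x <= e%:E ->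
    \int[@leb R N]_x `|(enorm x `^ gamma)%:E * heat_osc t f x| `^ p <=
      (A * (C + M `^ (gamma * p)) * e)%:E.
  move=> t0 t1 e0 I1 I2.
  have mo u := measurable_heat_osc u mf.
  have o0 u x : 0 <= heat_osc u f x by exact: heat_osc_ge0.
  have mc0 : (0 <= M `^ (gamma * p))%R by exact: powR_ge0.
  apply: (@le_trans _ _ (\int[@leb R N]_x (A%:E * (C%:E * heat_osc (2 * t) f x +
      (M `^ (gamma * p))%:E * heat_osc t f x)))).
    apply: le_integralT => [x|||x].
    - exact: poweR_ge0.
    - apply: measurable_poweR_comp; apply: measurableT_comp => //; exact: measurable_weight.
    - by apply: measurable_funeM; apply: emeasurable_funD; exact: measurable_funeM.
    rewrite gee0_abs; first exact: pointwise.
    by apply: weight_ge0 => z; exact: heat_osc_ge0.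
  have c1 x : 0 <= C%:E * heat_osc (2 * t) f x by rewrite mule_ge0// lee_fin ltW.
  have c2 x : 0 <= (M `^ (gamma * p))%:E * heat_osc t f x by rewrite mule_ge0.
  have m1 := measurable_funeM C%:E (mo (2 * t)%R).
  have m2 := measurable_funeM (M `^ (gamma * p))%:E (mo t).
  rewrite (ge0_integralZl _ measurableT (emeasurable_funD m1 m2)
    (fun x _ => adde_ge0 (c1 x) (c2 x))) ?lee_fin ?(ltW A0)//.
  rewrite (ge0_integralD _ measurableT (fun x _ => c1 x) m1 (fun x _ => c2 x) m2).
  rewrite (ge0_integralZl _ measurableT (mo _) (fun x _ => o0 _ x)) ?lee_fin ?(ltW C0)//.
  rewrite (ge0_integralZl _ measurableT (mo _) (fun x _ => o0 _ x)) ?lee_fin//.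
  have -> : (A * (C + M `^ (gamma * p)) * e)%:E =
      A%:E * (C%:E * e%:E + (M `^ (gamma * p))%:E * e%:E).
    by rewrite -!EFinM -mulrDl mulrA.
  apply: lee_wpmul2l; first by rewrite lee_fin ltW.
  have C0E : 0 <= C%:E by rewrite lee_fin ltW.
  have mc0E : 0 <= (M `^ (gamma * p))%:E by rewrite lee_fin.
  exact: (leeD (lee_wpmul2l C0E I2) (lee_wpmul2l mc0E I1)).
have E0 n : 0 <= ewnorm p%:E gamma (heat_osc (s n) f) by exact: Lnorm_ge0.
apply/(ge0_cvge0P E0) => e e0.
have K0 : (0 < A * (C + M `^ (gamma * p)))%R.
  by rewrite (mulr_gt0 A0)// addr_gt0// powR_gt0.
have d0 : (0 < e `^ p / (A * (C + M `^ (gamma * p))))%R by rewrite divr_gt0// powR_gt0.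
have Z0 (u : nat -> R) n : 0 <= \int[@leb R N]_x heat_osc (u n) f x.
  by apply: integral_ge0 => x _; exact: heat_osc_ge0.
have /(ge0_cvge0P (Z0 s))/(_ _ d0) near1 := O1.
have /(ge0_cvge0P (Z0 (fun n => 2 * s n)%R))/(_ _ d0) near2 := O2.
have near3 : \forall n \near \oo, (s n <= 1)%R.
  have /cvgrPdist_le/(_ _ ltr01) := sl; apply: filterS => n.
  by rewrite sub0r normrN => /(le_trans (ler_norm _)).
apply: filterS3 near1 near2 near3 => n I1 I2 sn1.
rewrite [X in X <= _]/ewnorm Lnorm_fin_leP ?lee_fin ?(ltW e0)//.
apply: le_trans (bound (s n) _ (s0 n) sn1 d0 I1 I2) _.
by rewrite mulrC divfK ?gt_eqF// poweR_EFin.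
Qed.

(** Both the position and the value of f are cut off at the same level n + 1; the p-th power of the
    weighted error is dominated by that of f and is eventually 0 at each point. *)
Lemma truncation_approx f (e : R) : measurable_fun setT f ->
  ewnorm p%:E gamma (EFin \o f) < +oo -> (0 < e)%R ->
  exists g, exists2 M : R, (0 < M)%R & [/\ measurable_fun setT g, forall x, (`|g x| <= M)%R,
    forall x, (M < enorm x)%R -> g x = 0%R,
    (@leb R N).-integrable setT (EFin \o g) &
    ewnorm p%:E gamma (fun x => `|f x - g x|%:E) <= e%:E].
Proof.
move=> mf foo e0.
pose B n x := (enorm x <= n.+1%:R)%R && (`|f x| <= n.+1%:R)%R.
pose g n x := if B n x then f x else 0%R.
have mabs : measurable_fun setT (fun x => `|f x|%R) by exact: measurableT_comp.
have mB n : measurable_fun setT (B n).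
  by apply: measurable_and; apply: measurable_fun_ler => //; exact: measurable_enorm.
have mg n : measurable_fun setT (g n) by exact: measurable_fun_ifT.
have gM n x : (`|g n x| <= n.+1%:R)%R.
  by rewrite /g; case: ifPn => [/andP[]//|_]; rewrite normr0.
have gN n x : (n.+1%:R < enorm x)%R -> g n x = 0%R.
  by rewrite /g /B ltNge => /negbTE ->.
have gi n : (@leb R N).-integrable setT (EFin \o g n).
  have N0R : (0 < N%:R :> R)%R by rewrite ltr0n.
  have [C C0 CP] := @integral_ball_powR R N 0 N0 (lexx _) N0R.
  apply/integrableP; split; first exact/measurable_EFinP.
  (* The exponent 0 makes the integral of [b] the volume of a ball. The open ball of radius n + 2
     contains the closed one of radius n + 1 that carries [g n]. *)
  pose b x : R := (if enorm x < n.+2%:R then enorm x `^ (- 0) else 0)%R.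
  have b0 x : (0 <= b x)%R by rewrite /b; case: ifP => // _; exact: powR_ge0.
  have mb : measurable_fun setT b.
    apply: measurable_fun_ifT => //.
      by apply: measurable_fun_ltr => //; exact: measurable_enorm.
    apply: (measurableT_comp (measurable_powR _)); exact: measurable_enorm.
  apply: (@le_lt_trans _ _ (\int[@leb R N]_x ((n.+1%:R)%:E * (b x)%:E))).
    apply: le_integralT => [x|||x] //=.
    - by apply/measurable_EFinP; exact: measurableT_comp.
    - by apply: measurable_funeM; exact/measurable_EFinP.
    rewrite -EFinM lee_fin /b; case: ifPn => [xn|].
      by rewrite oppr0 powRr0 mulr1.
    by rewrite -leNgt mulr0 => xn; rewrite gN ?normr0// (lt_le_trans _ xn)// ltr_nat.
  rewrite ge0_integralZl ?lee_fin//; last 2 first.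
  - exact/measurable_EFinP.
  - by move=> x _; rewrite lee_fin.
  have := CP n.+2%:R (ltr0n _ _) => /(lee_wpmul2l (_ : 0 <= (n.+1%:R)%:E)).
  by rewrite lee_fin => /(_ (ler0n _ _))/le_lt_trans; apply; rewrite -EFinM ltry.
pose F n x := ((enorm x `^ gamma * `|f x - g n x|) `^ p)%:E.
pose G x := ((enorm x `^ gamma * `|f x|) `^ p)%:E.
have mw : measurable_fun setT (fun x : Rn R N => enorm x `^ gamma)%R.
  by apply: (measurableT_comp (measurable_powR gamma)); exact: measurable_enorm.
have mF n : measurable_fun setT (F n).
  apply/measurable_EFinP; apply: (measurableT_comp (measurable_powR p)).
  apply: measurable_funM => //; apply: measurableT_comp => //.
  exact: measurable_funB.
have mG : measurable_fun setT G.
  apply/measurable_EFinP; apply: (measurableT_comp (measurable_powR p)).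
  exact: measurable_funM.
have F0 n x : 0 <= F n x by rewrite lee_fin powR_ge0.
have G0 x : 0 <= G x by rewrite lee_fin powR_ge0.
have iG : (@leb R N).-integrable setT G.
  apply/integrableP; split => //; under eq_integral do rewrite gee0_abs//.
  have -> : \int[@leb R N]_x G x = ewnorm p%:E gamma (EFin \o f) `^ p.
    rewrite poweR_Lnorm; last by rewrite gt_eqF.
    apply: eq_integral => x _.
    by rewrite /= normrM (ger0_norm (powR_ge0 _ _)).
  move: foo (Lnorm_ge0 (@leb R N) p%:E (fun x => (enorm x `^ gamma)%:E * (EFin \o f) x)).
  by rewrite -/(ewnorm p%:E gamma (EFin \o f)); case: (ewnorm _ _ _) => // r _ _; rewrite poweR_EFin ltry.
have FE n : \int[@leb R N]_x F n x =
    \int[@leb R N]_x `|(enorm x `^ gamma)%:E * `|f x - g n x|%:E| `^ p.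
  by apply: eq_integral => x _; rewrite /= normrM normr_id (ger0_norm (powR_ge0 _ _)).
have FI0 n : 0 <= \int[@leb R N]_x F n x by exact: integral_ge0.
have Fl : \int[@leb R N]_x F n x @[n --> \oo] --> 0.
  have [//||||||_ _] := @dominated_convergence _ _ _ (@leb R N) setT _ F (cst 0) G.
  - exact: mF.
  - exact: measurable_cst.
  - apply: aeW => x _; apply: cvg_near_cst.
    exists (Num.bound (Num.max (enorm x) `|f x|%R)) => // n /= xn.
    have h : (Num.max (enorm x) `|f x| <= n.+1%:R)%R.
      apply: (le_trans (ltW (archi_boundP _))); first by rewrite le_max enorm_ge0.
      by rewrite ler_nat (leq_trans xn).
    move: h; rewrite ge_max => h; rewrite /F /g /B h subrr normr0 mulr0 powR0//.
    by rewrite gt_eqF.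
  - exact: iG.
  - apply: aeW => x n _; rewrite gee0_abs// lee_fin.
    apply: ge0_ler_powR; rewrite ?nnegrE ?mulr_ge0 ?powR_ge0 ?(ltW p_gt0)//.
    rewrite ler_wpM2l ?powR_ge0// /g; case: ifP => _; last by rewrite subr0.
    by rewrite subrr normr0.
  by rewrite integral0.
have ep0 : (0 < e `^ p)%R by rewrite powR_gt0.
have /(ge0_cvge0P FI0)/(_ _ ep0)[n _ /(_ n (leqnn n))/= nF] := Fl.
exists (g n); exists n.+1%:R; first by rewrite ltr0n.
split; [exact: mg|exact: gM|exact: gN|exact: gi|].
have e0E : 0 <= e%:E by rewrite lee_fin ltW.
rewrite [X in X <= _]/ewnorm Lnorm_fin_leP; [|exact: p_gt0|exact: e0E].
by rewrite -FE.
Qed.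

(** A density argument: the heat semigroup is bounded on the weighted space uniformly in time, so
    replacing f by its truncation costs at most (C + 1) d = e / 2. *)
Lemma heat_osc_cvg0 (s : nat -> R) f : (forall n, 0 < s n)%R ->
  s n @[n --> \oo] --> 0%R -> measurable_fun setT f ->
  ewnorm p%:E gamma (EFin \o f) < +oo ->
  ewnorm p%:E gamma (heat_osc (s n) f) @[n --> \oo] --> 0.
Proof.
move=> s0 sl mf foo.
have [C C0 CP] := ewnorm_heat_op_le N0 p1E (lexx p%:E) (fun h => h) gamma0 gammaN.
have E0 n : 0 <= ewnorm p%:E gamma (heat_osc (s n) f) by exact: Lnorm_ge0.
apply/(ge0_cvge0P E0) => e e0.
pose d := (e / 2 / (C + 1))%R.
have C1 : (0 < C + 1)%R by rewrite addr_gt0.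
have d0 : (0 < d)%R by rewrite divr_gt0// divr_gt0.
have [g [M M0 [mg gM gN gi fg]]] := truncation_approx mf foo d0.
have G0 n : 0 <= ewnorm p%:E gamma (heat_osc (s n) g) by exact: Lnorm_ge0.
have e20 : (0 < e / 2)%R by rewrite divr_gt0.
have /(ge0_cvge0P G0)/(_ _ e20) := heat_osc_truncated s0 sl mg M0 gM gN gi.
apply: filterS => n gn.
have mfg : measurable_fun setT (fun y => `|f y - g y|%:E).
  by apply/measurable_EFinP; apply: measurableT_comp => //; exact: measurable_funB.
have fg0 x : 0 <= `|f x - g x|%:E by rewrite lee_fin.
have mh := measurable_heat_op (s n) mfg fg0.
have h0 x : 0 <= heat_op (s n) (fun y => `|f y - g y|%:E) x by exact: heat_op_ge0.
have mo := measurable_heat_osc (s n) mg.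
apply: (@le_trans _ _ (ewnorm p%:E gamma (fun x => heat_osc (s n) g x +
    (heat_op (s n) (fun y => `|f y - g y|%:E) x + `|f x - g x|%:E)))).
  apply: le_ewnorm; rewrite ?lte_fin//; first exact: measurable_heat_osc.
    by apply: emeasurable_funD => //; exact: emeasurable_funD.
  by apply: aeW => x; rewrite gee0_abs ?heat_osc_ge0// heat_osc_le.
have p1' : 1 <= p%:E by rewrite ltW.
apply: le_trans (ewnormD_le _ p1' mo _ (heat_osc_ge0 (s n) g) _) _.
  exact: emeasurable_funD.
  by move=> x; exact: adde_ge0.
rewrite (splitr e) EFinD; apply: leeD => //.
apply: le_trans (ewnormD_le _ p1' mh mfg h0 fg0) _.
apply: (@le_trans _ _ (C%:E * d%:E + d%:E)).
  apply: leeD => //; apply: le_trans (CP _ _ (s0 n) mfg fg0) _.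
  rewrite subrr mulr0 oppr0 powRr0 mulr1; apply: lee_wpmul2l => //.
  by rewrite lee_fin ltW.
by rewrite -EFinM -EFinD lee_fin /d -[X in (_ + X)%R]mul1r -mulrDl mulrC divfK// gt_eqF.
Qed.

Lemma heat_osc_at_right f : measurable_fun setT f ->
  ewnorm p%:E gamma (EFin \o f) < +oo ->
  ewnorm p%:E gamma (heat_osc s f) @[s --> 0^'+] --> 0.
Proof.
by move=> mf foo; apply/cvge_at_rightP => s [s0 sl]; exact: heat_osc_cvg0.
Qed.

End weighted_norm.

End strong_continuity.

(** * Local existence *)

Section henon_majorant.
Context {R : realType} {N : nat}.
Local Notation spacetime := (measurableTypeR R * Rn R N)%type.
Variables (alpha l gamma : R) (q : \bar R).
Hypotheses (N0 : (0 < N)%N) (alpha0 : 0 < alpha) (gamma0 : 0 < gamma)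
  (lE : l = gamma * alpha) (q1 : (1 < q)%E) (gammaN : gamma < N%:R * (1 - rinv q)).

Definition nonlin_exponent (q : \bar R) (alpha : R) : \bar R :=
  (q * (alpha + 1)%:E)%E.
Local Notation rho := (nonlin_exponent q alpha).
Definition time_exponent N (alpha : R) (q : \bar R) : R := N%:R * alpha / 2 * rinv q.
Local Notation b := (time_exponent N alpha q).
Hypothesis b1 : b < 1.

Let a1_gt1 : 1 < alpha + 1. Proof. by rewrite ltrDr. Qed.
Let a1_gt0 : 0 < alpha + 1. Proof. by rewrite addr_gt0. Qed.
Let q_gt0 : (0 < q)%E. Proof. by rewrite (lt_trans _ q1)// lte_fin. Qed.

Lemma rho_infty : (rho = +oo)%E -> (q = +oo)%E.
Proof. by rewrite /nonlin_exponent; case: q q1. Qed.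

Lemma le_rho : (q <= rho)%E.
Proof.
rewrite /nonlin_exponent; case: q q_gt0 => [p p0||//].
  by rewrite -EFinM lee_fin ler_peMr ?ltW// -lte_fin.
by rewrite gt0_mulye.
Qed.

Lemma rinv_rho : rinv rho = rinv q / (alpha + 1).
Proof.
rewrite /nonlin_exponent; case: q q_gt0 => [p p0||//].
  rewrite lte_fin in p0; rewrite -EFinM !rinv_fin ?gt_eqF ?mulr_gt0//.
  by rewrite invfM.
by rewrite gt0_mulye// rinv_infty mul0r.
Qed.

Lemma rinv_ge0 : 0 <= rinv q.
Proof.
case: q q_gt0 => [p p0||//]; last by rewrite rinv_infty.
by rewrite lte_fin in p0; rewrite rinv_fin ?gt_eqF// invr_ge0 ltW.
Qed.

Lemma time_exponent_ge0 : 0 <= b.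
Proof. by rewrite mulr_ge0 ?rinv_ge0// divr_ge0// mulr_ge0// ltW. Qed.

(** The smoothing rate from L^q to L^rho: its product with alpha + 1 is b, the rate of the
    nonlinearity in L^q. *)
Lemma rho_gap : N%:R / 2 * (rinv q - rinv rho) = b / (alpha + 1).
Proof. by rewrite rinv_rho /time_exponent; field; rewrite gt_eqF. Qed.

Local Open Scope ereal_scope.

Lemma ewnorm_enonlin_le (W : spacetime -> \bar R) (s K : R) : (forall z, 0 <= W z) ->
  (0 <= K)%R -> ewnorm rho gamma (fun x => W (s, x)) <= K%:E ->
  ewnorm q gamma (fun x => enonlin alpha l W (s, x)) <= (K `^ (alpha + 1))%:E.
Proof.
move=> W0 K0.
have E x : (enorm x `^ gamma)%:E * enonlin alpha l W (s, x) =
    ((enorm x `^ gamma)%:E * W (s, x)) `^ (alpha + 1).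
  rewrite /enonlin muleA poweRM ?lee_fin ?powR_ge0// poweR_EFin -powRrM -EFinM.
  rewrite -powRD; first by rewrite lE mulrDr mulr1 addrC.
  by rewrite gt_eqF// addr_gt0// lE mulr_gt0.
have w0 x : 0 <= (enorm x `^ gamma)%:E * W (s, x) by rewrite mule_ge0 ?lee_fin ?powR_ge0.
have K1 : 0 <= (K `^ (alpha + 1))%:E by rewrite lee_fin powR_ge0.
rewrite /ewnorm; under [X in _ -> Lnorm _ _ X <= _]eq_fun do rewrite E.
rewrite /nonlin_exponent; case: q q_gt0 => [p p0|_|//].
  rewrite lte_fin in p0; rewrite -EFinM.
  have pp : (0 < p * (alpha + 1))%R by exact: mulr_gt0.
  rewrite !Lnorm_fin_leP ?lee_fin//.
  rewrite !poweR_EFin mulrC powRrM; congr (_ <= _); apply: eq_integral => x _.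
  by rewrite !gee0_abs ?poweR_ge0// poweRrM.
rewrite gt0_mulye// => /Lnorm_infty_leP h; apply/Lnorm_infty_leP; first exact: K1.
apply: filterS (h _); last by rewrite lee_fin.
move=> x; rewrite !gee0_abs ?poweR_ge0// => h'.
by rewrite -[leRHS]poweR_EFin poweR_le_swap ?lee_fin.
Qed.

Lemma majorant_solution : exists C0 C1 : R, [/\ (0 < C0)%R, (0 < C1)%R &
  forall (u0 : Rn R N -> R) (A T : R), measurable_fun setT u0 -> (0 < A)%R -> (0 < T)%R ->
  ewnorm q gamma (EFin \o u0) <= A%:E ->
  (C1 * (C0 * A) `^ alpha * T `^ (1 - b) <= 2^-1)%R ->
  exists W : spacetime -> \bar R, [/\ measurable_fun setT W, forall z, 0 <= W z,
    forall w, W w = majorant_op alpha l u0 W w &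
    forall t : R, (0 < t <= T)%R -> ewnorm rho gamma (fun x => W (t, x)) <=
      (C0 * A * t `^ (- (b / (alpha + 1))))%:E]].
Proof.
have b0 := time_exponent_ge0.
have be1 : (b / (alpha + 1) < 1)%R by rewrite ltr_pdivrMr// mul1r (lt_trans b1).
have [C C_gt0 CP] := ewnorm_heat_op_le N0 q1 le_rho rho_infty gamma0 gammaN.
have gap1 : (N%:R / 2 * (rinv q - rinv rho) < 1)%R by rewrite rho_gap.
have rle : (rinv rho <= rinv q)%R.
  by rewrite rinv_rho ler_pdivrMr// ler_peMr ?rinv_ge0// ltW.
have [C1 C1_gt0 C1P] := ewnorm_duhamel_le N0 q1 gamma0 gammaN le_rho rho_infty gap1 rle b0 b1.
rewrite rho_gap in CP C1P.
(* M = 2 C A is twice the bound of the linear part; the other half of M is the room left to the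
   Duhamel term, whence the 1/2 in the smallness condition. *)
exists (2 * C)%R, C1; split => //; first by rewrite mulr_gt0.
move=> u0 A T mu0 A0 T0 u0A small.
set beta := (b / (alpha + 1))%R in be1 CP C1P *.
have M0 : (0 < 2 * C * A)%R by rewrite !mulr_gt0.
move ME : (2 * C * A)%R => M in small M0 *.
have rho0 : 0 < rho by rewrite (lt_le_trans q_gt0)// le_rho.
have rho1 : 1 <= rho by rewrite (le_trans (ltW q1))// le_rho.
have mabs : measurable_fun setT (fun y => `|u0 y|%:E).
  by apply/measurable_EFinP; exact: measurableT_comp.
have abs0 y : 0 <= `|u0 y|%:E by rewrite lee_fin.
have absA : ewnorm q gamma (fun y => `|u0 y|%:E) <= A%:E.
  apply: le_trans u0A; apply: le_Lnorm => //.
  - exact: measurable_weight.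
  - by apply: measurable_weight; exact/measurable_EFinP.
  by apply: aeW => x; rewrite !abseM /= normr_id.
have [|||W [mW W0 kW WE]] := @majorant_exists R N alpha l u0 alpha0 mu0 rho gamma T
  (fun t => M * t `^ (- beta))%R; last by exists W.
- exact: rho0.
- by move=> t; rewrite mulr_ge0 ?powR_ge0// ltW.
move=> W mW W0 kW t /andP[t0 tT].
have mH := measurable_heat_op t mabs abs0.
have mE := measurable_enonlin alpha l mW.
have mD : measurable_fun setT (fun x => duhamel (enonlin alpha l W) (t, x)).
  by apply: (measurable_fun_pair2 t (measurable_duhamel mE (enonlin_ge0 _ _ _))).
rewrite /majorant_op/=.
apply: le_trans (ewnormD_le _ rho1 mH mD _ _) _.
- by move=> x; exact: heat_op_ge0.
- by move=> x; apply: duhamel_ge0 => z; exact: enonlin_ge0.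
have -> : (M * t `^ (- beta))%:E = (M / 2 * t `^ (- beta))%:E + (M / 2 * t `^ (- beta))%:E.
  by rewrite -EFinD -mulrDl -splitr.
apply: leeD.
  apply: le_trans (CP t _ t0 mabs abs0) _.
  apply: le_trans (lee_wpmul2l _ absA) _.
    by rewrite lee_fin mulr_ge0 ?powR_ge0// ltW.
  by rewrite -EFinM lee_fin -ME le_eqVlt; apply/orP; left; apply/eqP; field.
have G0 : (0 < M `^ (alpha + 1))%R by rewrite powR_gt0.
apply: le_trans (C1P (enonlin alpha l W) (M `^ (alpha + 1))%R t G0 t0 mE (enonlin_ge0 _ _ _) _) _.
  move=> s /andP[s0 st].
  have sT : (0 < s <= T)%R by rewrite s0 (le_trans (ltW st)).
  apply: le_trans (ewnorm_enonlin_le W0 _ (kW s sT)) _.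
    by rewrite mulr_ge0 ?powR_ge0// ltW.
  rewrite powRM ?powR_ge0 ?(ltW M0)// -powRrM lee_fin mulNr divfK//.
  by rewrite gt_eqF.
rewrite lee_fin.
(* The Duhamel term is bounded by C1 M^alpha t^(1 - b) times M t^(- beta), and the first factor is
   at most 1/2 by smallness. *)
have -> : (1 - beta - b = - beta + (1 - b))%R by ring.
have -> : (t `^ (- beta + (1 - b)) = t `^ (- beta) * t `^ (1 - b))%R.
  by rewrite powRD// (gt_eqF t0) implybT.
have -> : (M `^ (alpha + 1) = M `^ alpha * M)%R.
  by rewrite powRD ?(gt_eqF M0) ?implybT// powRr1 ?(ltW M0).
have tT' : (t `^ (1 - b) <= T `^ (1 - b))%R.
  by apply: ge0_ler_powR; rewrite ?nnegrE ?subr_ge0 ?(ltW t0) ?(ltW T0) ?(ltW b1).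
have Ma0 : (0 <= C1 * M `^ alpha)%R by rewrite mulr_ge0 ?powR_ge0// ltW.
have h := le_trans (ler_wpM2l Ma0 tT') small.
have hb : (0 <= M * t `^ (- beta))%R by rewrite mulr_ge0 ?powR_ge0// ltW.
have := ler_wpM2r hb h; congr (_ <= _)%R; first by ring.
by field.
Qed.

End henon_majorant.

Section weighted_norm_lemmas.
Context {R : realType} {N : nat}.
Local Open Scope ereal_scope.

Lemma ewnorm_ae_fin (p : \bar R) gamma (f : Rn R N -> \bar R) : (0 < N)%N -> 0 < p ->
  measurable_fun setT f -> (forall x, 0 <= f x) -> ewnorm p gamma f < +oo ->
  {ae @leb R N, forall x, f x < +oo}.
Proof.
move=> N0 p0 mf f0 foo.
have w0 x : 0 <= (enorm x `^ gamma)%:E * f x by exact: weight_ge0.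
suff : {ae @leb R N, forall x, (enorm x `^ gamma)%:E * f x < +oo}.
  apply: filterS2 (ae_enorm_gt0 N0) => x x0; case: (f x) (f0 x) => [r _ _|_|//].
    exact: ltry.
  by rewrite gt0_muley ?lte_fin ?powR_gt0.
have mwf := measurable_weight gamma mf.
case: p p0 foo => [p p0 foo|_ foo|//]; last first.
  have := Lnorm_infty_ae (@leb R N) (fun x => (enorm x `^ gamma)%:E * f x).
  by apply: filterS => x fx; exact: le_lt_trans (lee_abs _) (le_lt_trans fx foo).
rewrite lte_fin in p0.
have mI : measurable_fun setT (fun x => `|(enorm x `^ gamma)%:E * f x| `^ p).
  by apply: measurable_poweR_comp; exact: measurableT_comp.
have iI : (@leb R N).-integrable setT (fun x => `|(enorm x `^ gamma)%:E * f x| `^ p).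
  apply/integrableP; split => //.
  under eq_integral do rewrite gee0_abs ?poweR_ge0//.
  rewrite -poweR_Lnorm; last by rewrite gt_eqF.
  move: foo (Lnorm_ge0 (@leb R N) p%:E (fun x => (enorm x `^ gamma)%:E * f x)).
  rewrite -/(ewnorm p%:E gamma f); case: (ewnorm _ _ _) => // r _ _.
  by rewrite poweR_EFin ltry.
apply: filterS (integrable_ae measurableT iI) => x /(_ I).
rewrite gee0_abs//; case: (_ * _) (w0 x) => [r _ _|_|//]; first exact: ltry.
by rewrite /= gt_eqF.
Qed.

Lemma normr_fine_integralB d (X : measurableType d) (mu : {measure set X -> \bar R})
    (f g : X -> R) :
  mu.-integrable setT (EFin \o f) -> mu.-integrable setT (EFin \o g) ->
  `|fine (\int[mu]_x (f x)%:E) - fine (\int[mu]_x (g x)%:E)|%:E <=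
    \int[mu]_x `|f x - g x|%:E.
Proof.
move=> fi gi; have fgi : mu.-integrable setT (EFin \o (fun x => f x - g x)%R).
  have := integrableB measurableT fi gi; apply: eq_integrable => //.
have := le_normr_Rintegral measurableT fgi; rewrite RintegralB//.
rewrite -lee_fin => /le_trans; apply; rewrite /Rintegral.
have /integrableP[_ fgoo] := fgi.
rewrite fineK// ge0_fin_numE//.
by apply: integral_ge0 => x _; rewrite lee_fin.
Qed.

End weighted_norm_lemmas.

Lemma powR_small (R : realType) (th e : R) : 0 < th -> 0 < e ->
  exists2 d : R, 0 < d & forall x, 0 <= x -> x <= d -> x `^ th <= e.
Proof.
move=> th0 e0; exists (e `^ th^-1); first by rewrite powR_gt0.
move=> x x0 xd; apply: (@le_trans _ _ ((e `^ th^-1) `^ th)).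
  by apply: ge0_ler_powR; rewrite ?nnegrE ?powR_ge0 ?(ltW th0).
by rewrite -powRrM mulVf ?gt_eqF// powRr1// ltW.
Qed.

(** * From the majorant to a solution in the required class *)

Section henon_solution.
Context {R : realType} {N : nat}.
Local Notation spacetime := (measurableTypeR R * Rn R N)%type.
Local Notation mu := (@leb_spacetime R N).
Variables (alpha l gamma : R) (q : \bar R).
Hypotheses (N0 : (0 < N)%N) (alpha0 : 0 < alpha) (gamma0 : 0 < gamma)
  (lE : l = gamma * alpha) (q1 : (1 < q)%E) (gammaN : gamma < N%:R * (1 - rinv q)).
Local Notation rho := (nonlin_exponent q alpha).
Local Notation b := (time_exponent N alpha q).
Hypothesis b1 : b < 1.
Variables (u0 : Rn R N -> R) (A T K : R) (W : spacetime -> \bar R).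
Hypotheses (mu0 : measurable_fun setT u0) (A0 : 0 < A) (T0 : 0 < T) (K0 : 0 < K)
  (u0A : (ewnorm q gamma (EFin \o u0) <= A%:E)%E)
  (mW : measurable_fun setT W) (W0 : forall z, (0 <= W z)%E)
  (WE : forall w, W w = majorant_op alpha l u0 W w)
  (kW : forall t : R, 0 < t <= T -> (ewnorm rho gamma (fun x => W (t, x)) <=
     (K * t `^ (- (b / (alpha + 1))))%:E)%E).
Local Open Scope ereal_scope.

Let b0 : (0 <= b)%R. Proof. exact: time_exponent_ge0. Qed.
Let q_gt0 : 0 < q. Proof. by rewrite (lt_trans _ q1)// lte_fin. Qed.
Let q_ge1 : 1 <= q. Proof. exact: ltW. Qed.
Let G := (K `^ (alpha + 1))%R.
Let G0 : (0 < G)%R. Proof. exact: powR_gt0. Qed.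
Let a (x : Rn R N) := `|u0 x|%:E.
Let ma : measurable_fun setT a.
Proof. by apply/measurable_EFinP; exact: measurableT_comp. Qed.
Let a0 x : 0 <= a x. Proof. by rewrite lee_fin. Qed.
Let aA : ewnorm q gamma a <= A%:E.
Proof.
apply: le_trans u0A; apply: le_Lnorm => //.
- exact: measurable_weight.
- by apply: measurable_weight; exact/measurable_EFinP.
by apply: aeW => x; rewrite !abseM /= normr_id.
Qed.
Let F := enonlin alpha l W.
Let mF : measurable_fun setT F. Proof. exact: measurable_enonlin. Qed.
Let F0 z : 0 <= F z. Proof. exact: enonlin_ge0. Qed.

Let FG (t : R) : (t <= T)%R -> forall s : R, (0 < s < t)%R ->
  ewnorm q gamma (fun y => F (s, y)) <= (G * s `^ (- b))%:E.
Proof.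
move=> tT s /andP[s0 st].
have sT : (0 < s <= T)%R by rewrite s0 (le_trans (ltW st)).
have p0 : (0 < alpha + 1)%R by rewrite addr_gt0.
apply: le_trans (ewnorm_enonlin_le alpha0 gamma0 lE q1 W0 _ (kW sT)) _.
  by rewrite mulr_ge0 ?powR_ge0// ltW.
by rewrite powRM ?powR_ge0 ?(ltW K0)// -powRrM lee_fin mulNr divfK// gt_eqF.
Qed.

Let mWt t : measurable_fun setT (fun x => W (t, x)).
Proof. exact: (measurable_fun_pair2 t mW). Qed.

Let mDt t : measurable_fun setT (fun x => duhamel F (t, x)).
Proof. exact: (measurable_fun_pair2 t (measurable_duhamel mF F0)). Qed.

(** The L^rho bound puts the nonlinearity of W in L^q with rate s^(- b). Reading the equation of W
    once more yields every L^r norm, r = q included, with no further smallness: the constant Kr may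
    depend on r, A and T. *)
Lemma majorant_bound (r : \bar R) : q <= r -> (r = +oo -> q = +oo) ->
  (N%:R / 2 * (rinv q - rinv r) < 1)%R -> (rinv r <= rinv q)%R ->
  exists2 Kr : R, (0 < Kr)%R & forall t : R, (0 < t <= T)%R ->
    ewnorm r gamma (fun x => W (t, x)) <= (Kr * t `^ (- (N%:R / 2 * (rinv q - rinv r))))%:E.
Proof.
move=> qr rq gap1 rle.
have [C C_gt0 CP] := ewnorm_heat_op_le N0 q1 qr rq gamma0 gammaN.
have [C1 C1_gt0 C1P] := ewnorm_duhamel_le N0 q1 gamma0 gammaN qr rq gap1 rle b0 b1.
move: (N%:R / 2 * (rinv q - rinv r))%R gap1 CP C1P => e e1 CP C1P.
have r1 : 1 <= r by rewrite (le_trans q_ge1).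
exists (C * A + C1 * G * T `^ (1 - b))%R.
  by rewrite ltr_wpDr ?mulr_gt0// mulr_ge0 ?powR_ge0// mulr_ge0// ltW.
move=> t /andP[t0 tT].
rewrite (_ : (fun x => _) = (fun x => heat_op t a x + duhamel F (t, x))); last first.
  by apply/funext => x; rewrite WE.
have mH := measurable_heat_op t ma a0.
apply: le_trans (ewnormD_le _ r1 mH (mDt t) _ _) _.
- by move=> x; exact: heat_op_ge0.
- by move=> x; exact: duhamel_ge0.
rewrite mulrDl EFinD; apply: leeD.
  apply: le_trans (CP t _ t0 ma a0) _; apply: le_trans (lee_wpmul2l _ aA) _.
    by rewrite lee_fin mulr_ge0 ?powR_ge0// ltW.
  by rewrite -EFinM lee_fin mulrAC.
apply: le_trans (C1P F G t G0 t0 mF F0 (FG tT)) _; rewrite lee_fin.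
have -> : (1 - e - b = (1 - b) + - e)%R by ring.
rewrite powRD; last by rewrite (gt_eqF t0) implybT.
rewrite mulrA ler_wpM2r ?powR_ge0// ler_wpM2l ?mulr_ge0 ?(ltW C1_gt0) ?(ltW G0)//.
by apply: ge0_ler_powR; rewrite ?nnegrE ?subr_ge0 ?(ltW t0) ?(ltW T0) ?(ltW b1).
Qed.

Let gapq : (N%:R / 2 * (rinv q - rinv q) = 0)%R. Proof. by rewrite subrr mulr0. Qed.

Lemma majorant_bounded : exists2 Kq : R, (0 < Kq)%R & forall t : R, (0 < t <= T)%R ->
    ewnorm q gamma (fun x => W (t, x)) <= Kq%:E.
Proof.
have [||||Kq Kq0 KqP] := @majorant_bound q; rewrite ?lexx ?gapq//.
by exists Kq => // t /KqP; rewrite gapq oppr0 powRr0 mulr1.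
Qed.

Lemma majorant_finite (t : R) : (0 < t <= T)%R -> {ae @leb R N, forall x, W (t, x) < +oo}.
Proof.
move=> tT; have [Kq _ KqP] := majorant_bounded.
by apply: (@ewnorm_ae_fin _ _ q gamma) => //; rewrite (le_lt_trans (KqP t tT))// ltry.
Qed.

Variable u : spacetime -> R.
Hypotheses (mu_ : measurable_fun setT u) (uW : forall z, `|u z|%:E <= W z)
  (uE : forall w, W w < +oo ->
    [/\ (@leb R N).-integrable setT
          (fun y => (heat_kernel w.1 (rnsub w.2 y) * u0 y)%:E),
        mu.-integrable setT
          (fun z => (duhamel_kernel w z * (enorm z.2 `^ l * spow alpha (u z)))%:E) &
        (u w)%:E = \int[@leb R N]_y (heat_kernel w.1 (rnsub w.2 y) * u0 y)%:E +
          \int[mu]_z (duhamel_kernel w z * (enorm z.2 `^ l * spow alpha (u z)))%:E]).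

Let h z : R := (enorm z.2 `^ l * spow alpha (u z))%R.

Lemma nonlin_le z : `|h z|%:E <= F z.
Proof.
rewrite /h normrM (ger0_norm (powR_ge0 _ _)) normr_spow spow_ge0E// EFinM /F /enonlin.
apply: lee_wpmul2l; first by rewrite lee_fin powR_ge0.
rewrite -poweR_EFin poweR_le_swap ?lee_fin ?addr_gt0//; exact: uW.
Qed.

Let D w := fine (\int[mu]_z (duhamel_kernel w z * h z)%:E).

Lemma solution_split (t : R) x : (0 < t)%R -> W (t, x) < +oo ->
  u (t, x) = (heat t u0 x + D (t, x))%R.
Proof.
move=> t0 /uE[/= i1 i2 E].
rewrite /heat gt_eqF// /D /Rintegral -fineD; first by rewrite -E.
  exact: integrable_fin_num i1.
exact: integrable_fin_num i2.
Qed.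

Let mh : measurable_fun setT h.
Proof.
apply: measurable_funM; last exact: (measurableT_comp (measurable_spow alpha)).
apply: (measurableT_comp (measurable_powR l)).
exact: (measurableT_comp measurable_enorm measurable_snd).
Qed.

Lemma duhamel_part_le (w : spacetime) : W w < +oo -> `|D w|%:E <= duhamel F w.
Proof.
move=> /uE[_ i2 _].
have i0 : mu.-integrable setT (EFin \o cst 0%R) by exact: integrable0.
have := normr_fine_integralB i2 i0; rewrite integral0 subr0 => /le_trans; apply.
have mk := measurable_duhamel_kernel_section w.
apply: le_integralT => [z|||z].
- by rewrite lee_fin.
- apply/measurable_EFinP; apply: measurableT_comp => //.
  by apply: measurable_funB => //; exact: measurable_funM.
- exact: measurable_duhamel_integrand.
rewrite /= subr0 normrM (ger0_norm (duhamel_kernel_ge0 _ _)) EFinM.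
by apply: lee_wpmul2l; [rewrite lee_fin duhamel_kernel_ge0|exact: nonlin_le].
Qed.

Let measurable_duhamel_timeB s t : measurable_fun setT (fun x =>
    \int[mu]_z (`|duhamel_kernel (t, x) z - duhamel_kernel (s, x) z|%:E * F z)).
Proof.
have mk r : measurable_fun [set: Rn R N * spacetime] (fun v => duhamel_kernel (r, v.1) v.2).
  have mg : measurable_fun [set: Rn R N * spacetime]
      (fun v => (((r : measurableTypeR R), v.1), v.2) : spacetime * spacetime).
    by apply: measurable_fun_pair => //; apply: measurable_fun_pair.
  exact: (measurableT_comp measurable_duhamel_kernel mg).
apply: (measurable_fun_fubini_tonelli_F (m2 := mu)
  (fun v : Rn R N * spacetime =>
    `|duhamel_kernel (t, v.1) v.2 - duhamel_kernel (s, v.1) v.2|%:E * F v.2)).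
  apply: emeasurable_funM; last exact: (measurableT_comp mF).
  by apply/measurable_EFinP; apply: measurableT_comp => //; exact: measurable_funB.
by move=> v; rewrite mule_ge0 ?lee_fin//; exact: F0.
Qed.

(** A pointwise majorant of the increment of u between s and t. The linear part uses the Lipschitz
    bound of the kernel, whose singularity 1 / s is harmless away from s = 0. *)
Definition time_modulus (s t : R) x : \bar R :=
  ((1 + N%:R + 2 * 2 `^ (N%:R / 2)) * ((t - s) / s))%:E *
    (heat_op s a x + (heat_op t a x + heat_op (2 * t) a x)) +
  \int[mu]_z (`|duhamel_kernel (t, x) z - duhamel_kernel (s, x) z|%:E * F z).

Lemma time_modulus_le (s t : R) x : (0 < s)%R -> (s <= t)%R ->
  W (s, x) < +oo -> W (t, x) < +oo -> `|u (t, x) - u (s, x)|%:E <= time_modulus s t x.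
Proof.
move=> s0 st /[dup] Ws /uE[/= i1s i2s _] /[dup] Wt /uE[/= i1t i2t _].
have t0 : (0 < t)%R by rewrite (lt_le_trans s0).
rewrite !solution_split//.
rewrite opprD addrACA.
apply: (@le_trans _ _ (`|heat t u0 x - heat s u0 x|%:E + `|D (t, x) - D (s, x)|%:E)).
  by rewrite -EFinD lee_fin ler_normD.
apply: leeD.
  have c0 : (0 <= (1 + N%:R + 2 * 2 `^ (N%:R / 2)) * ((t - s) / s))%R.
    by rewrite mulr_ge0 ?divr_ge0 ?subr_ge0 ?(ltW s0)// !addr_ge0// mulr_ge0// powR_ge0.
  rewrite /heat !gt_eqF//; apply: le_trans (normr_fine_integralB i1t i1s) _.
  have mH r := measurable_heat_op_section r x ma.
  have H0 r y : 0 <= (heat_kernel r (rnsub x y))%:E * a y.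
    by rewrite mule_ge0 ?lee_fin ?heat_kernel_ge0.
  rewrite -(ge0_integralD _ measurableT (fun y _ => H0 t y) (mH t)
    (fun y _ => H0 (2 * t)%R y) (mH _)).
  rewrite -(ge0_integralD _ measurableT (fun y _ => H0 s y) (mH s)
    (fun y _ => adde_ge0 (H0 t y) (H0 (2 * t)%R y)) (emeasurable_funD (mH _) (mH _))).
  rewrite -(ge0_integralZl _ measurableT
    (emeasurable_funD (mH s) (emeasurable_funD (mH t) (mH (2 * t)%R)))
    (fun y _ => adde_ge0 (H0 s y) (adde_ge0 (H0 t y) (H0 (2 * t)%R y)))) ?lee_fin//.
  apply: le_integralT => [y|||y].
  - by rewrite lee_fin.
  - have mk r : measurable_fun setT (fun y => heat_kernel r (rnsub x y) * u0 y)%R.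
      by apply: measurable_funM => //; exact: measurable_heat_kernel_section.
    by apply/measurable_EFinP; apply: measurableT_comp => //; exact: measurable_funB.
  - by apply: measurable_funeM; do 2 apply: emeasurable_funD => //.
  have := @heat_kernel_timeB R N 1 s t (rnsub x y) ler01 (lexx _) s0 st.
  rewrite powRr1 ?divr_ge0 ?subr_ge0 ?(ltW s0)// => hk.
  rewrite /a -!EFinM lee_fin -mulrBl normrM.
  apply: le_trans (ler_wpM2r (normr_ge0 _) hk) _.
  move: (heat_kernel s _) (heat_kernel t _) (heat_kernel (2 * t) _) => k1 k2 k3.
  by rewrite -[leLHS]mulrA; apply: ler_wpM2l => //; rewrite -!mulrDl addrA.
apply: le_trans (normr_fine_integralB i2t i2s) _.
have mk r := measurable_duhamel_kernel_section (r, x).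
apply: le_integralT => [z|||z].
- by rewrite lee_fin.
- apply/measurable_EFinP; apply: measurableT_comp => //.
  by apply: measurable_funB; exact: measurable_funM.
- apply: emeasurable_funM => //; apply/measurable_EFinP; apply: measurableT_comp => //.
  exact: measurable_funB.
rewrite -mulrBl normrM EFinM; apply: lee_wpmul2l; first by rewrite lee_fin.
exact: nonlin_le.
Qed.

Let measurable_time_modulus s t : measurable_fun setT (time_modulus s t).
Proof.
apply: emeasurable_funD; last exact: measurable_duhamel_timeB.
have mH r := measurable_heat_op r ma a0.
by apply: measurable_funeM; do 2 apply: emeasurable_funD => //.
Qed.

Lemma ewnorm_time_modulus : exists2 L : R, (0 <= L)%R & forall s t : R,
  (0 < s)%R -> (s < t)%R -> (t <= T)%R ->
  ewnorm q gamma (time_modulus s t) <=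
    (L * ((t - s) / s + (t - s) `^ ((1 - b) / 2)))%:E.
Proof.
have [C C_gt0 CP] := ewnorm_heat_op_le N0 q1 (lexx q) (fun E => E) gamma0 gammaN.
have [C1 C1_gt0 C1P] := ewnorm_duhamel_timeB N0 q1 gamma0 gammaN b0 b1.
pose c := (1 + N%:R + 2 * 2 `^ (N%:R / 2) : R)%R.
have c0 : (0 <= c)%R by rewrite !addr_ge0// mulr_ge0// powR_ge0.
have L1 : (0 <= c * (3 * (C * A)))%R by rewrite !mulr_ge0// ltW.
have L2 : (0 <= C1 * G * T `^ ((1 - b) / 2))%R by rewrite !mulr_ge0 ?powR_ge0// ltW.
exists (c * (3 * (C * A)) + C1 * G * T `^ ((1 - b) / 2))%R; first exact: addr_ge0.
move=> s t s0 st tT; have t0 := lt_trans s0 st.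
have H (r : R) : (0 < r)%R -> ewnorm q gamma (heat_op r a) <= (C * A)%:E.
  move=> r0; apply: le_trans (CP r _ r0 ma a0) _; rewrite gapq oppr0 powRr0 mulr1 EFinM.
  by apply: lee_wpmul2l => //; rewrite lee_fin ltW.
have mH r := measurable_heat_op r ma a0.
have H0 r x : 0 <= heat_op r a x by exact: heat_op_ge0.
have ds0 : (0 <= (t - s) / s)%R by rewrite divr_ge0 ?subr_ge0 ?(ltW st) ?(ltW s0).
have cds0 : (0 <= c * ((t - s) / s))%R by exact: mulr_ge0.
have mI := measurable_duhamel_timeB s t.
have I0 x : 0 <= \int[mu]_z (`|duhamel_kernel (t, x) z - duhamel_kernel (s, x) z|%:E * F z).
  by apply: integral_ge0 => z _; rewrite mule_ge0 ?lee_fin//; exact: F0.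
have mS := emeasurable_funD (mH t) (mH (2 * t)%R).
have S0 x := adde_ge0 (H0 t x) (H0 (2 * t)%R x).
have mS3 := emeasurable_funD (mH s) mS.
have S30 x := adde_ge0 (H0 s x) (S0 x).
apply: le_trans (ewnormD_le _ q_ge1 (measurable_funeM _ mS3) mI _ I0) _.
  by move=> x; apply: mule_ge0; [rewrite lee_fin; exact: cds0|exact: S30].
apply: (@le_trans _ _ ((c * ((t - s) / s))%:E * (3 * (C * A))%:E +
    (C1 * G * T `^ ((1 - b) / 2) * (t - s) `^ ((1 - b) / 2))%:E)).
  apply: leeD; last exact: (C1P F G s t T G0 (ltW s0) st tT mF F0 (FG tT)).
  apply: le_trans (ewnormZ_le _ q_gt0 cds0 mS3) _.
  apply: lee_wpmul2l; first by rewrite lee_fin.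
  apply: le_trans (ewnormD_le _ q_ge1 (mH s) mS (H0 s) S0) _.
  have -> : (3 * (C * A))%:E = (C * A)%:E + ((C * A)%:E + (C * A)%:E).
    by rewrite -!EFinD; congr EFin; ring.
  apply: leeD; first exact: H.
  apply: le_trans (ewnormD_le _ q_ge1 (mH _) (mH _) (H0 _) (H0 _)) _.
  by apply: leeD; apply: H => //; rewrite mulr_gt0.
have h1 := mulr_ge0 L1 (powR_ge0 (t - s) ((1 - b) / 2)).
have h2 := mulr_ge0 L2 ds0.
rewrite -EFinM -EFinD lee_fin mulrAC [leRHS]mulrDl !mulrDr.
by rewrite -addrA lerD2l addrA addrC lerDl addr_ge0.
Qed.

(** The symmetric form, with one constant for all times above m: both one-sided limits at a positive
    time follow from it at once. *)
Lemma solution_modulus : exists2 L : R, (0 <= L)%R & forall s t m : R,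
  (0 < m)%R -> (m <= s <= T)%R -> (m <= t <= T)%R ->
  ewnorm q gamma (fun x => (u (s, x) - u (t, x))%:E) <=
    (L * (`|s - t| / m + `|s - t| `^ ((1 - b) / 2)))%:E.
Proof.
have [L L0 LP] := ewnorm_time_modulus; exists L => // s t m m0 /andP[ms sT] /andP[mt tT].
have mut r : measurable_fun setT (fun x => u (r, x)) by exact: (measurable_fun_pair2 r mu_).
have mB r r' : measurable_fun setT (fun x => (u (r, x) - u (r', x))%:E).
  by apply/measurable_EFinP; exact: measurable_funB.
have h1 (r : R) : (m <= r)%R -> (r <= T)%R -> {ae @leb R N, forall x, W (r, x) < +oo}.
  by move=> mr rT; apply: majorant_finite; rewrite (lt_le_trans m0).
have LE (r r' : R) : (m <= r)%R -> (r < r')%R -> (r' <= T)%R ->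
    (L * ((r' - r) / r + (r' - r) `^ ((1 - b) / 2)))%:E <=
    (L * (`|r' - r| / m + `|r' - r| `^ ((1 - b) / 2)))%:E.
  move=> mr rr' r'T; rewrite lee_fin ler_wpM2l// ger0_norm ?subr_ge0 ?(ltW rr')// lerD2r.
  rewrite ler_wpM2l ?subr_ge0 ?(ltW rr')// lef_pV2 ?posrE//.
  exact: lt_le_trans mr.
have [st|ts|->] := ltgtP s t.
- have s0 : (0 < s)%R := lt_le_trans m0 ms.
  rewrite distrC; apply: le_trans (LE _ _ ms st tT).
  apply: le_trans (LP s t s0 st tT); apply: le_ewnorm => //.
  apply: filterS2 (h1 s ms sT) (h1 t mt tT) => x Ws Wt.
  by rewrite -abseN -EFinN opprB /=; apply: time_modulus_le => //; exact: ltW.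
- have t0 : (0 < t)%R := lt_le_trans m0 mt.
  apply: le_trans (LE _ _ mt ts sT).
  apply: le_trans (LP t s t0 ts sT); apply: le_ewnorm => //.
  apply: filterS2 (h1 s ms sT) (h1 t mt tT) => x Ws Wt.
  by apply: time_modulus_le => //; exact: ltW.
- under eq_fun do rewrite subrr; rewrite ewnorm0// lee_fin mulr_ge0// addr_ge0 ?powR_ge0//.
  by rewrite divr_ge0// ltW.
Qed.

Lemma ewnorm_duhamel_nonlin : exists2 Kd : R, (0 < Kd)%R &
  forall t : R, (0 < t)%R -> (t <= T)%R ->
    ewnorm q gamma (fun x => duhamel F (t, x)) <= (Kd * t `^ (1 - b))%:E.
Proof.
have gap1 : (N%:R / 2 * (rinv q - rinv q) < 1)%R by rewrite gapq.
have [C1 C1_gt0 C1P] := ewnorm_duhamel_le N0 q1 gamma0 gammaN (lexx q) (fun E => E)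
  gap1 (lexx _) b0 b1.
exists (C1 * G)%R; first exact: mulr_gt0.
move=> t t0 tT; apply: le_trans (C1P F G t G0 t0 mF F0 (FG tT)) _.
by rewrite gapq subr0.
Qed.

(** Patched at t = 0: the kernel at time 0 vanishes identically as N > 0, hence W (0, .) = 0 and u
    (0, .) = 0 instead of the datum. *)
Definition henon_flow (t : R) (x : Rn R N) : R := if t == 0%R then u0 x else u (t, x).

Let flow0 x : henon_flow 0 x = u0 x. Proof. by rewrite /henon_flow eqxx. Qed.
Let flowE (t : R) : (0 < t)%R -> henon_flow t = fun x => u (t, x).
Proof. by move=> t0; apply/funext => x; rewrite /henon_flow gt_eqF. Qed.

Lemma time_itv_cases t : time_itv q T t -> (0 < t <= T)%R \/ t = 0%R /\ q != +oo.
Proof.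
rewrite /time_itv; case: eqVneq => qE /=; rewrite in_itv/=; first by left.
move=> /andP[]; rewrite le_eqVlt => /predU1P[<- _|t0 tT]; first by right.
by left; rewrite t0.
Qed.

Lemma henon_flow_equation (t : R) : (0 < t <= T)%R \/ t = 0%R ->
  {ae @leb R N, forall x,
      (@lebesgue_measure R).-integrable `[0%R, t]
        (fun s => (heat (t - s) (henon alpha l (henon_flow s)) x)%:E) /\
      henon_flow t x = (heat t u0 x +
        \int[@lebesgue_measure R]_(s in `[0, t])
          heat (t - s) (henon alpha l (henon_flow s)) x)%R}.
Proof.
have fh (s : R) : (0 < s)%R -> henon alpha l (henon_flow s) = (fun y => h (s, y)).
  by move=> s0; apply/funext => y; rewrite /henon flowE// /h /spow /= mulrA.
move=> [/[dup] tT /andP[t0 _]|->].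
  apply: filterS (majorant_finite tT) => x Wx; have [_ i2 _] := uE Wx.
  have [|int eq] := duhamel_heatE i2 (f := fun s => henon alpha l (henon_flow s)).
    by move=> s /andP[s0 _]; exact: fh.
  by split=> //; rewrite eq flowE// solution_split.
apply: aeW => x.
have k0 z : duhamel_kernel (0%R : R, x) z = 0%R.
  by rewrite /duhamel_kernel /=; case: ltP => // z0; rewrite ltNge (ltW z0).
have i2 : mu.-integrable setT (fun z => (duhamel_kernel (0%R : R, x) z * h z)%:E).
  by under eq_fun do rewrite k0 mul0r; exact: integrable0.
have [|int eq] := duhamel_heatE i2 (f := fun s => henon alpha l (henon_flow s)).
  by move=> s /andP[s0 _]; exact: fh.
split=> //; rewrite eq; under eq_integral do rewrite k0 mul0r.
by rewrite integral0 addr0 flow0 /heat eqxx.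
Qed.

Lemma henon_flow_bound (r : \bar R) : admissible N alpha gamma q r ->
  exists M : R, forall t, (0 < t)%R -> (t <= T)%R ->
    (t `^ (N%:R / 2 * (rinv q - rinv r)))%:E * wnorm r gamma (henon_flow t) <= M%:E.
Proof.
move=> adm.
have [qr rq rle gap1] : [/\ q <= r, (r = +oo -> q = +oo), (rinv r <= rinv q)%R &
    (N%:R / 2 * (rinv q - rinv r) < 1)%R].
  move: adm; rewrite /admissible; case: eqVneq => [-> ->|qN [qr ra _]].
    by split; rewrite ?subrr ?mulr0.
  have rq : (rinv r <= rinv q)%R.
    have q0' := rinv_ge0 q1.
    case: r qr ra => [r qr _|_ _|+ _]; last 2 first.
    - by rewrite rinv_infty.
    - by rewrite ltNge leNye.
    case: q q_gt0 qN qr => [p p0 _ pr|//|//].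
    rewrite !lte_fin in p0 pr; have r0 := lt_trans p0 pr.
    by rewrite !rinv_fin ?gt_eqF// lef_pV2 ?posrE// ltW.
  split=> //; [exact: ltW| |].
    move=> rE; move: ra; rewrite rE rinv_infty ltNge divr_ge0//; first exact: (rinv_ge0 q1).
    by rewrite addr_ge0// ltW.
  have p0 : (0 < alpha + 1)%R by rewrite addr_gt0.
  (* 1 / r exceeds 1 / rho, so the rate of L^r is at most that of L^rho, which is b / (alpha + 1) <
     1. *)
  apply: (@le_lt_trans _ _ (b / (alpha + 1))%R); last first.
    by rewrite ltr_pdivrMr// mul1r (lt_trans b1)// ltrDr.
  rewrite -(rho_gap alpha0 q1) (rinv_rho alpha0 q1) ler_wpM2l ?divr_ge0// lerD2l lerN2.
  exact: ltW.
have [Kr Kr0 KrP] := majorant_bound qr rq gap1 rle; exists Kr => t t0 tT.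
have r0 : 0 < r by rewrite (lt_le_trans q_gt0).
rewrite wnorm_ewnorm flowE//; have tT' : (0 < t <= T)%R by rewrite t0.
apply: (@le_trans _ _ ((t `^ (N%:R / 2 * (rinv q - rinv r)))%:E *
  (Kr * t `^ (- (N%:R / 2 * (rinv q - rinv r))))%:E)).
  apply: lee_wpmul2l; first by rewrite lee_fin powR_ge0.
  apply: le_trans (KrP t tT'); apply: le_ewnorm => //.
    by apply/measurable_EFinP; exact: (measurable_fun_pair2 t mu_).
  by apply: aeW => x; exact: uW.
rewrite -EFinM lee_fin mulrCA -powRD ?subrr ?powRr0 ?mulr1//.
by rewrite (gt_eqF t0) implybT.
Qed.

Lemma henon_flow_mem t : time_itv q T t -> in_wLq q gamma (henon_flow t).
Proof.
rewrite /in_wLq wnorm_ewnorm => /time_itv_cases[tT|[-> _]]; last first.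
  have -> : henon_flow 0 = u0 by apply/funext.
  by split => //; rewrite (le_lt_trans u0A)// ltry.
have [Kq _ KqP] := majorant_bounded; have /andP[t0 _] := tT.
have mt : measurable_fun setT (fun x => u (t, x)) by exact: (measurable_fun_pair2 t mu_).
rewrite flowE//; split => //; apply: le_lt_trans (ltry Kq); apply: le_trans (KqP t tT).
apply: le_ewnorm => //; first exact/measurable_EFinP.
by apply: aeW => x; exact: uW.
Qed.

(** The linear part is controlled by the strong continuity of the semigroup, available for finite
    exponents, and the Duhamel part by t^(1 - b). *)
Lemma henon_flow_at0 : q != +oo ->
  wnorm q gamma (fun x => henon_flow s x - u0 x)%R @[s --> 0^'+] --> 0.
Proof.
move=> qoo; have N0' (s : R) : 0 <= wnorm q gamma (fun x => henon_flow s x - u0 x)%R.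
  exact: Lnorm_ge0.
apply/(ge0_cvge0P N0') => e e0; have e20 : (0 < e / 2)%R by rewrite divr_gt0.
have [Kd Kd0 KdP] := ewnorm_duhamel_nonlin.
have b10 : (0 < 1 - b)%R by rewrite subr_gt0.
have [d d0 dP] := powR_small b10 (divr_gt0 e20 Kd0).
have O0 (s : R) : 0 <= ewnorm q gamma (heat_osc s u0) by exact: Lnorm_ge0.
have /(ge0_cvge0P O0)/(_ _ e20) near1 : ewnorm q gamma (heat_osc s u0) @[s --> 0^'+] --> 0.
  move: q1 gammaN u0A qoo; case: q => [p p1 gN pA _|//|//].
  by apply: heat_osc_at_right => //; exact: le_lt_trans pA (ltry _).
near=> s.
have s0 : (0 < s)%R by near: s; exact: nbhs_right_gt.
have sT : (s <= T)%R by near: s; exact: nbhs_right_le.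
have sd : (s <= d)%R by near: s; exact: nbhs_right_le.
have h1 : ewnorm q gamma (heat_osc s u0) <= (e / 2)%:E by near: s.
have tT : (0 < s <= T)%R by rewrite s0.
have mo := measurable_heat_osc s mu0.
rewrite wnorm_ewnorm flowE//.
apply: (@le_trans _ _ (ewnorm q gamma (fun x => heat_osc s u0 x + duhamel F (s, x)))).
  apply: le_ewnorm => //.
  - apply/measurable_EFinP; apply: measurable_funB => //.
    exact: (measurable_fun_pair2 s mu_).
  - exact: emeasurable_funD.
  apply: filterS (majorant_finite tT) => x Wx; rewrite /= solution_split//.
  rewrite addrAC; apply: (@le_trans _ _ (`|heat s u0 x - u0 x|%:E + `|D (s, x)|%:E)).
    by rewrite -EFinD lee_fin ler_normD.
  by apply: leeD; [exact: heat_sub_le|exact: duhamel_part_le].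
apply: le_trans (ewnormD_le _ q_ge1 mo (mDt s) (heat_osc_ge0 s u0) (fun x => duhamel_ge0 _ F0)) _.
rewrite (splitr e) EFinD; apply: leeD => //.
apply: le_trans (KdP s s0 sT) _; rewrite lee_fin mulrC -ler_pdivlMr//.
by apply: dP => //; exact: ltW.
Unshelve. all: by end_near. Qed.

(** The linear part cancels exactly, and only the Duhamel term, of size t^(1 - b), remains; this is
    why the limit is zero even though the semigroup need not be strongly continuous for q = +oo. *)
Lemma henon_flow_initial : q = +oo ->
  wnorm q gamma (fun x => henon_flow t x - heat t u0 x)%R @[t --> 0^'+] --> 0.
Proof.
move=> qoo; have N0' (s : R) : 0 <= wnorm q gamma (fun x => henon_flow s x - heat s u0 x)%R.
  exact: Lnorm_ge0.
apply/(ge0_cvge0P N0') => e e0.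
have [Kd Kd0 KdP] := ewnorm_duhamel_nonlin.
have b10 : (0 < 1 - b)%R by rewrite subr_gt0.
have [d d0 dP] := powR_small b10 (divr_gt0 e0 Kd0).
near=> s.
have s0 : (0 < s)%R by near: s; exact: nbhs_right_gt.
have sT : (s <= T)%R by near: s; exact: nbhs_right_le.
have sd : (s <= d)%R by near: s; exact: nbhs_right_le.
have tT : (0 < s <= T)%R by rewrite s0.
have eE : 0 <= e%:E by rewrite lee_fin ltW.
have : ewnorm q gamma (fun x => duhamel F (s, x)) <= e%:E.
  apply: le_trans (KdP s s0 sT) _; rewrite lee_fin mulrC -ler_pdivlMr//.
  by apply: dP => //; exact: ltW.
rewrite wnorm_ewnorm flowE// /ewnorm qoo => /(Lnorm_infty_leP _ _ eE) DE.
apply/(Lnorm_infty_leP _ _ eE).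
apply: filterS2 (majorant_finite tT) DE => x Wx; apply: le_trans.
rewrite !abseM; apply: lee_wpmul2l => //.
rewrite /= solution_split// addrAC subrr add0r gee0_abs; last exact: duhamel_ge0.
exact: duhamel_part_le.
Unshelve. all: by end_near. Qed.

Lemma henon_flow_continuous t : time_itv q T t ->
  wnorm q gamma (fun x => henon_flow s x - henon_flow t x)%R
    @[s --> within (time_itv q T) (nbhs t)] --> 0.
Proof.
move=> tI; have N0' (s : R) : 0 <= wnorm q gamma (fun x => henon_flow s x - henon_flow t x)%R.
  exact: Lnorm_ge0.
apply/(ge0_cvge0P N0') => e e0; rewrite near_withinE.
have [tT|[t0 qoo]] := time_itv_cases tI; last first.
  have Z0 (s : R) : 0 <= wnorm q gamma (fun x => henon_flow s x - u0 x)%R by exact: Lnorm_ge0.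
  have /(ge0_cvge0P Z0)/(_ _ e0) := henon_flow_at0 qoo.
  rewrite /at_right near_withinE t0; apply: filterS => s sP /time_itv_cases[/andP[s0 _]|[-> _]].
    by under eq_fun do rewrite flow0; exact: sP.
  rewrite wnorm_ewnorm; under eq_fun do rewrite subrr.
  by rewrite ewnorm0// lee_fin ltW.
have [L L0 LP] := solution_modulus.
have /andP[t0 tT'] := tT; have m0 : (0 < t / 2)%R by rewrite divr_gt0.
have L1 : (0 < L + 1)%R by rewrite ltr_wpDl.
have e1 : (0 < e / 2 / (L + 1))%R by rewrite !divr_gt0.
have b2 : (0 < (1 - b) / 2)%R by rewrite divr_gt0// subr_gt0.
have [d d0 dP] := powR_small b2 e1.
(* The first bound keeps s above t / 2; the other two make each term of the modulus at most e / 2 /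
   (L + 1). *)
pose del := (Num.min (t / 2) (Num.min d (t / 2 * (e / 2 / (L + 1)))))%R.
have del0 : (0 < del)%R by rewrite !lt_min m0 d0 mulr_gt0.
have : \forall s \near nbhs t, (`|t - s| < del)%R by exact: (nbhsx_ballx t del del0).
apply: filterS => s; rewrite !lt_min => /and3P[s1 s2 s3] /time_itv_cases sI.
have ms : (t / 2 <= s)%R by move: s1; rewrite ltr_norml => /andP[_]; lra.
have s0 : (0 < s)%R by exact: lt_le_trans ms.
have sT : (s <= T)%R by case: sI => [/andP[]//|[sE _]]; rewrite sE ltW.
rewrite wnorm_ewnorm !flowE//.
apply: le_trans (LP s t (t / 2)%R m0 _ _) _.
- by rewrite ms.
- by rewrite tT' andbT; lra.
rewrite distrC lee_fin; apply: (@le_trans _ _ ((L + 1) * (e / 2 / (L + 1) + e / 2 / (L + 1)))%R).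
  apply: ler_pM => //; [|by rewrite lerDl|].
    by rewrite addr_ge0 ?powR_ge0// divr_ge0// ltW.
  apply: lerD; first by rewrite ler_pdivrMr// mulrC ltW.
  by apply: dP => //; exact: ltW.
by rewrite -mulrDl -splitr mulrC divfK// gt_eqF.
Qed.

Lemma henon_flow_solution (r : \bar R) : admissible N alpha gamma q r ->
  mild_solution alpha l gamma q r u0 T henon_flow.
Proof.
move=> adm; split.
- exact: henon_flow_mem.
- exact: henon_flow_continuous.
- exact: henon_flow_bound.
- exact: henon_flow_initial.
- move=> t /time_itv_cases tI; apply: henon_flow_equation.
  by case: tI => [|[]]; [left|right].
Qed.

End henon_solution.

(** The exponent r is quantified after c, which is what allows the constant of the theorem to
    precede r. A is any positive bound of the norm, so that a datum of norm 0 is covered. *)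
Lemma local_existence (R : realType) (N : nat) (alpha l gamma : R) (q : \bar R) :
  (0 < N)%N -> 0 < alpha -> 0 < gamma -> l = gamma * alpha -> (1 < q)%E ->
  gamma < N%:R * (1 - rinv q) -> time_exponent N alpha q < 1 ->
  exists2 c : R, 0 < c & forall (u0 : Rn R N -> R) (A T : R),
    measurable_fun setT u0 -> 0 < A -> 0 < T -> (wnorm q gamma u0 <= A%:E)%E ->
    c * A `^ alpha * T `^ (1 - time_exponent N alpha q) <= 1 ->
    forall r, admissible N alpha gamma q r ->
    exists u, mild_solution alpha l gamma q r u0 T u.
Proof.
move=> N0 alpha0 gamma0 lE q1 gammaN b1.
have [C0 [C1 [C0_gt0 C1_gt0 CP]]] := majorant_solution N0 alpha0 gamma0 lE q1 gammaN b1.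
(* The factor 2 turns the threshold 1/2 of [majorant_solution] into 1. *)
exists (2 * (C1 * C0 `^ alpha)); first by rewrite !mulr_gt0 ?powR_gt0.
move=> u0 A T mu0 A0 T0; rewrite wnorm_ewnorm => u0A small r adm.
have [|W [mW W0 WE kW]] := CP u0 A T mu0 A0 T0 u0A.
  by rewrite powRM ?(ltW C0_gt0) ?(ltW A0)//; lra.
have K0 : 0 < C0 * A by rewrite mulr_gt0.
have [u [mu uW uE]] := mild_exists alpha0 mu0 mW W0 WE.
exists (henon_flow u0 u).
exact: (henon_flow_solution N0 alpha0 gamma0 lE q1 gammaN b1 mu0 A0 T0 K0 u0A mW W0 WE kW mu uW uE adm).
Qed.

(* Since inve 0 = +oo, the bound reads Tmax = +oo when phi = 0 a.e. *)
Theorem corollaryB2 (R : realType) (N : nat) (alpha l gamma : R) (q : \bar R)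
  (hN : (1 <= N)%N) (halpha : 0 < alpha) (hl0 : 0 < l)
  (hl : l < N%:R * alpha)
  (hgamma : gamma = l / alpha) (hgammaN : gamma < N%:R)
  (hq1 : ((N%:R * alpha / 2)%:E < q)%E)
  (hq2 : ((N%:R / (N%:R - gamma))%:E < q)%E) :
  exists C : R, 0 < C /\
    forall r : \bar R, admissible N alpha gamma q r ->
    forall phi : Rn R N -> R, in_wLq q gamma phi ->
    forall lambda : R, 0 < lambda ->
      (C%:E *
         ((lambda%:E * wnorm q gamma phi)
            `^ (alpha^-1 - N%:R / 2 * rinv q)^-1)^-1
       <= Tmax alpha l gamma q r (fun x => lambda * phi x)%R)%E.
Proof.
have N0 : 0 < N%:R :> R by rewrite ltr0n.
have gamma0 : 0 < gamma by rewrite hgamma divr_gt0.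
have Ng0 : 0 < N%:R - gamma by rewrite subr_gt0.
have lE : l = gamma * alpha by rewrite hgamma divfK// gt_eqF.
have q1 : (1 < q)%E.
  by apply: lt_trans hq2; rewrite lte_fin ltr_pdivlMr// mul1r ltrBlDr ltrDl.
have gammaN : gamma < N%:R * (1 - rinv q).
  move: hq2 q1; case: q {hq1} => [p|_ _|//]; last by rewrite rinv_infty subr0 mulr1.
  rewrite !lte_fin ltr_pdivrMr// => pN p1; have p0 := lt_trans ltr01 p1.
  rewrite rinv_fin ?gt_eqF// mulrBr mulr1 ltrBrDr addrC -ltrBrDr ltr_pdivrMr//.
  by rewrite mulrC.
have b1 : time_exponent N alpha q < 1.
  move: hq1 q1; rewrite /time_exponent; case: q {hq2 gammaN} => [p|_ _|//]; last first.
    by rewrite rinv_infty mulr0.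
  rewrite !lte_fin => pN p1; have p0 := lt_trans ltr01 p1.
  by rewrite rinv_fin ?gt_eqF// ltr_pdivrMr// mul1r.
have [c c0 cP] := local_existence hN halpha gamma0 lE q1 gammaN b1.
pose b := time_exponent N alpha q.
have b10 : 0 < 1 - b by rewrite subr_gt0.
(* The exponent of the theorem is the inverse of this: in c a^alpha T^(1 - b) = 1 the time T is
   proportional to a^(- alpha / (1 - b)). *)
have thE : alpha^-1 - N%:R / 2 * rinv q = (1 - b) / alpha.
  by rewrite /b /time_exponent; field; rewrite gt_eqF.
(* The constant for which the claimed bound T satisfies c a^alpha T^(1 - b) = 1 exactly, a being
   lambda times the norm of phi. *)
exists (c `^ (- (1 - b)^-1)); split; first exact: powR_gt0.
move=> r adm phi [mphi phioo] lambda lambda0.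
have mlphi : measurable_fun setT (fun x => lambda * phi x) by exact: measurable_funM.
have lnorm : (wnorm q gamma (fun x => lambda * phi x)%R <= lambda%:E * wnorm q gamma phi)%E.
  have q0 : (0 < q)%E by rewrite (lt_trans _ q1)// lte_fin.
  have mphiE : measurable_fun setT (EFin \o phi) by exact/measurable_EFinP.
  rewrite !wnorm_ewnorm; exact: (ewnormZ_le gamma q0 (ltW lambda0) mphiE).
have n0 : (0 <= wnorm q gamma phi)%E by exact: Lnorm_ge0.
have nf : wnorm q gamma phi \is a fin_num by rewrite ge0_fin_numE.
move: lnorm n0; rewrite -(fineK nf); move: (fine _) => n lnorm; rewrite lee_fin => n0.
rewrite thE -EFinM; rewrite -EFinM in lnorm.
(* For a datum of norm 0 every time is reached: given T, the number A is chosen so that the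
   smallness condition is an equality on [[0, T']], where T' = max (T, 1) ensures positivity. *)
have [nE|nN] := eqVneq n 0.
  rewrite nE mulr0 poweR_EFin powR0; last by rewrite invr_eq0 gt_eqF// divr_gt0.
  rewrite inve0 gt0_muley ?lte_fin ?powR_gt0// leye_eq; apply/eqP/eq_infty => T.
  pose T' := Num.max T 1.
  have T'0 : 0 < T' by rewrite lt_max ltr01 orbT.
  apply: (@le_trans _ _ T'%:E); first by rewrite lee_fin le_max lexx.
  apply: ereal_sup_ubound; exists T' => //; split => //.
  have cT : 0 < c * T' `^ (1 - b) by rewrite mulr_gt0// powR_gt0.
  apply: (cP _ ((c * T' `^ (1 - b))^-1 `^ alpha^-1) T') => //.
  - by rewrite powR_gt0// invr_gt0.
  - by apply: le_trans lnorm _; rewrite nE mulr0 lee_fin powR_ge0.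
  - have cTV : 0 <= (c * T' `^ (1 - b))^-1 by rewrite invr_ge0 ltW.
    by rewrite -powRrM mulVf ?gt_eqF// powRr1// mulrAC divff// gt_eqF.
have ln0 : 0 < lambda * n by rewrite mulr_gt0// lt_neqAle eq_sym nN.
rewrite poweR_EFin inver gt_eqF ?powR_gt0// -EFinM.
(* The bound is itself an existence time, hence below the supremum; it remains to check the
   smallness condition there. *)
apply: ereal_sup_ubound; eexists; last by [].
have T0 : 0 < c `^ (- (1 - b)^-1) / (lambda * n) `^ ((1 - b) / alpha)^-1.
  by rewrite divr_gt0// powR_gt0.
split => //; apply: (cP _ (lambda * n)) => //.
move: (lambda * n) ln0 => a a0.
rewrite -powRN powRM ?powR_ge0// -!powRrM.
have -> : - (1 - b)^-1 * (1 - b) = -1 by rewrite mulNr mulVf// gt_eqF.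
have -> : - ((1 - b) / alpha)^-1 * (1 - b) = - alpha.
  by rewrite invfM invrK mulNr mulrAC mulVf ?mul1r// gt_eqF.
rewrite powR_inv1 ?(ltW c0)// powRN mulrACA divff ?gt_eqF// mul1r divff//.
by rewrite gt_eqF// powR_gt0.
Qed.
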